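(* For each fixed $k \geq 4$, the equality $$f_k(n + k - 1) = f_k(n) + \frac{k-1}{2}\left(k - \frac{2}{k-1}\right)$$ holds for all but at most $\frac{k^3}{12} - \frac{k^2}{8}$ values of $n\geq k+2$.
   Context: Graphs are finite and simple. A graph $G$ is $k$-critical if it is not $(k-1)$-colorable (in the sense of proper vertex colorings), but every proper subgraph of $G$ is $(k-1)$-colorable. $f_k(n)$ denotes the minimum number of edges in a $k$-critical graph with $n$ vertices (for $k \ge 4$, such graphs exist for $n=k$ and for every $n\geq k+2$). *)

(* Defs.v *)
From HB Require Import structures.
From mathcomp Require Import all_boot all_order all_algebra.
Set Implicit Arguments.
Unset Strict Implicit.
Unset Printing Implicit Defensive.

(* A finite simple graph whose vertices are taken in T: a pair (V, E) of a set
   of vertices and a set of 2-element subsets of V.  V need not be all of T, so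
   the subgraphs of a graph live in the same type. *)
Record sgraph (T : finType) := SGraph {
  graph_sets : {set T} * {set {set T}};
  _ : [forall e in graph_sets.2, (#|e| == 2) && (e \subset graph_sets.1)] }.

HB.instance Definition _ (T : finType) := [isSub for @graph_sets T].
HB.instance Definition _ (T : finType) := [Finite of sgraph T by <:].

Definition vertices (T : finType) (G : sgraph T) : {set T} := (graph_sets G).1.

Definition edges (T : finType) (G : sgraph T) : {set {set T}} :=
  (graph_sets G).2.

Definition subgraph (T : finType) (H G : sgraph T) : bool :=
  (vertices H \subset vertices G) && (edges H \subset edges G).

Definition proper_subgraph (T : finType) (H G : sgraph T) : bool :=
  subgraph H G && (H != G).

(* Only the vertices of G are coloured, not all of T. *)
Definition colorable (T : finType) (c : nat) (G : sgraph T) : bool :=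
  [exists f : {ffun {x : T | x \in vertices G} -> 'I_c},
     [forall x, forall y,
        ([set val x; val y] \in edges G) ==> (f x != f y)]].

Definition critical (T : finType) (k : nat) (G : sgraph T) : bool :=
  ~~ colorable k.-1 G &&
  [forall H : sgraph T, proper_subgraph H G ==> colorable k.-1 H].

(* The minimum number of edges of a k-critical graph with n vertices.  Up to
   isomorphism the vertices are the elements of 'I_n.  The neutral element
   'C(n, 2) bounds the number of edges of every graph on n vertices, so it does
   not affect the minimum when a k-critical graph with n vertices exists (see
   min_edges_le and min_edges_attained); otherwise it is a dummy value. *)
Definition min_edges (k n : nat) : nat :=
  \big[minn/'C(n, 2)]_(G : sgraph 'I_n | (#|vertices G| == n) && critical k G)
     #|edges G|.

Lemma min_edges_le k n (G : sgraph 'I_n) :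
  #|vertices G| = n -> critical k G -> min_edges k n <= #|edges G|.
Proof.
move=> Gn Gk; rewrite /min_edges -big_filter.
have: G \in [seq G <- index_enum (sgraph 'I_n) |
               (#|vertices G| == n) && critical k G].
  by rewrite mem_filter Gn eqxx Gk mem_index_enum.
elim: (filter _ _) => // H s IHs; rewrite inE big_cons => /orP[/eqP <-|/IHs Gs].
  exact: geq_minl.
exact: leq_trans (geq_minr _ _) Gs.
Qed.

Lemma edges_le_bin n (G : sgraph 'I_n) : #|edges G| <= 'C(n, 2).
Proof.
rewrite -[n in 'C(n, 2)]card_ord -card_draws; apply/subset_leq_card/subsetP=> e.
by case: G => -[V E] /= /forall_inP sE /sE/andP[e2 _]; rewrite inE.
Qed.

Lemma min_edges_attained k n :
  (exists2 G : sgraph 'I_n, #|vertices G| = n & critical k G) ->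
  exists G : sgraph 'I_n,
    [/\ #|vertices G| = n, critical k G & #|edges G| = min_edges k n].
Proof.
case=> G0 G0n G0k.
have P0 : (#|vertices G0| == n) && critical k G0 by rewrite G0n eqxx.
case: (@arg_minnP _ G0 (fun G => (#|vertices G| == n) && critical k G)
         (fun G => #|edges G|) P0) => G /andP[/eqP Gn Gk] Gmin.
exists G; split=> //; apply/eqP; rewrite eqn_leq min_edges_le // andbT.
rewrite /min_edges; elim/big_ind: _ => [|x y Gx Gy|H PH].
- exact: edges_le_bin.
- by rewrite leq_min Gx.
- exact: Gmin.
Qed.

(* Main.v *)
Require Import Defs.
From Stdlib Require Import Classical_Prop.
From mathcomp Require Import all_boot all_order all_algebra.
From mathcomp Require Import perm zify ring lra.
Set Implicit Arguments.
Unset Strict Implicit.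
Unset Printing Implicit Defensive.
Import Order.TTheory GRing.Theory Num.Theory.

(** Write c = k - 1.  By the Kostochka-Yancey theorem every k-critical graph satisfies
    (k-2)(k+1)|V| - 2(k-1)|E| <= k(k-3), which bounds f_k(n) below by a linear
    function of slope (k - 2/(k-1))/2.  A Hajos sum with K_k adds k - 1 vertices and
    (k-1)(k - 2/(k-1))/2 edges, so along each residue class modulo k - 1 the gap between
    f_k and that linear function is a nonincreasing sequence of nonnegative numbers with
    integral decrements; it fails to be constant at most as often as its first value
    allows.  The first values are bounded by Gallai's examples, joins of a complete graph
    with the Hajos sum of two cliques (for n = 2k, where these are missing, by a Hajos sum
    joined with one vertex), and these allowances add up to at most k^3/12 - k^2/8.

    The Kostochka-Yancey bound is proved for vertex-critical sets.  In a counterexample S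
    minimal for |V|, then |E|, and then with the largest number of pairs of twins:
    contracting the colour classes of a proper subset R gives a smaller critical graph, so
    R has large potential unless it is a vertex or a K_c; replacing a vertex by a twin
    of a neighbour of degree c forces all but one of the neighbours of a cluster of such
    twins to have large degree; and a kernel-perfect orientation limits the number of
    edges between vertices of degree c and c + 1.  Discharging then contradicts the density of S. *)

(** The decrements are integral because c * (c + 1) is even: at the critical slope c new vertices
    cost exactly (c * (c + 1) - 2) / 2 edges. On the scale 2 * c * |E|, which clears denominators, a
    decrement uses up 2 * c of the initial gap. The class starting at n = k + p has initial gap
    about c * p * (c - p), hence at most about p * (c - p) / 2 exceptions, and the sum over p is
    about c^3 / 12. As no k-critical graph has k + 1 vertices, the class of k + 1 starts only at 2k
    and needs its own example.

    The lower bound is stated for sets that are critical under an arbitrary relation on a fixed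
    type. Contracting, replacing a vertex by a twin and adding edges then only change the relation,
    and critical sets of the new graph are still subsets of the old type. An edge weighs 2 * c in
    the potential, so [Kpot c 1], which is potmax + 2 * c, is one edge above the target. *)

Section Arcs.

Variable T : finType.
Implicit Types (e : rel T) (A B C : {set T}).

Definition simple e := symmetric e /\ irreflexive e.

(* Counts ordered pairs: [arcs e A A] is twice the number of edges inside [A]. *)
Definition arcs e A B := \sum_(x in A) \sum_(y in B) (e x y : nat).

Definition deg e A x := \sum_(y in A) (e x y : nat).

Lemma degE e A x : deg e A x = #|[set y in A | e x y]|.
Proof.
rewrite /deg -sum1_card big_mkcond [RHS]big_mkcond /=.
by apply: eq_bigr => y _; rewrite inE; case: (y \in A); case: (e x y).
Qed.

Lemma arcsC e A B : symmetric e -> arcs e A B = arcs e B A.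
Proof.
move=> sym; rewrite /arcs exchange_big /=.
by apply: eq_bigr => x _; apply: eq_bigr => y _; rewrite sym.
Qed.

Lemma arcsE e A B : arcs e A B = \sum_(x in A) deg e B x.
Proof. by []. Qed.

Lemma sum_disjU (F : T -> nat) A B : [disjoint A & B] ->
  \sum_(x in A :|: B) F x = \sum_(x in A) F x + \sum_(x in B) F x.
Proof.
by move=> dAB; rewrite -bigU //; apply: eq_bigl => x; rewrite !inE.
Qed.

Lemma arcsUl e A B C : [disjoint A & B] ->
  arcs e (A :|: B) C = arcs e A C + arcs e B C.
Proof. by move=> dAB; rewrite /arcs sum_disjU. Qed.

Lemma arcsUr e A B C : [disjoint A & B] ->
  arcs e C (A :|: B) = arcs e C A + arcs e C B.
Proof.
move=> dAB; rewrite /arcs -big_split /=.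
by apply: eq_bigr => x _; rewrite sum_disjU.
Qed.

Lemma arcs_setU e A B : symmetric e -> [disjoint A & B] ->
  arcs e (A :|: B) (A :|: B) = arcs e A A + 2 * arcs e A B + arcs e B B.
Proof.
move=> sym dAB; rewrite arcsUl // !arcsUr // (arcsC B A sym); lia.
Qed.

Lemma deg_sub e A B x : A \subset B -> deg e A x <= deg e B x.
Proof.
move=> sAB; rewrite !degE; apply/subset_leq_card/subsetP => y.
by rewrite !inE => /andP[/(subsetP sAB)-> ->].
Qed.

Lemma arcs_sub e A A' B B' : A \subset A' -> B \subset B' ->
  arcs e A B <= arcs e A' B'.
Proof.
move=> sA sB; rewrite !arcsE [leqRHS](big_setID A) /=.
rewrite (setIidPr sA); apply: leq_trans (leq_addr _ _).
by apply: leq_sum => x _; apply: deg_sub.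
Qed.

Lemma leq_arcs e e' A B :
  (forall x y, x \in A -> y \in B -> e x y -> e' x y) ->
  arcs e A B <= arcs e' A B.
Proof.
move=> ee'; apply: leq_sum => x xA; apply: leq_sum => y yB.
by case: (e x y) (ee' x y xA yB) => // ->.
Qed.

Lemma eq_arcs e e' A B :
  (forall x y, x \in A -> y \in B -> e x y = e' x y) ->
  arcs e A B = arcs e' A B.
Proof.
move=> ee'; apply: eq_bigr => x xA; apply: eq_bigr => y yB; by rewrite ee'.
Qed.

Lemma arcs_split e (p : pred T) A B :
  arcs e A B = arcs e [set w in A | p w] B + arcs e [set w in A | ~~ p w] B.
Proof.
rewrite /arcs (bigID p) /=.
by congr (_ + _); apply: eq_bigl => x; rewrite inE.
Qed.

Lemma arcs1l e x B : arcs e [set x] B = deg e B x.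
Proof. by rewrite /arcs big_set1. Qed.

Lemma arcs0l e B : arcs e set0 B = 0.
Proof. by rewrite /arcs big_set0. Qed.

Lemma arcs11 e x : irreflexive e -> arcs e [set x] [set x] = 0.
Proof. by move=> irr; rewrite arcs1l /deg big_set1 irr. Qed.

Lemma arcs_setU1 e A x : simple e -> x \notin A ->
  arcs e (x |: A) (x |: A) = arcs e A A + 2 * deg e A x.
Proof.
move=> [sym irr] xA; rewrite arcs_setU ?disjoints1 // arcs11 // arcs1l; lia.
Qed.

Definition clique e A := [forall x in A, forall y in A, (x != y) ==> e x y].

Lemma cliqueP e A :
  reflect {in A &, forall x y, x != y -> e x y} (clique e A).
Proof.
apply: (iffP forall_inP) => [cA x y xA yA|cA x xA].
  by move/forall_inP: (cA x xA) => /(_ y yA)/implyP.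
by apply/forall_inP => y yA; apply/implyP; apply: cA.
Qed.

Lemma clique_sub e A B : A \subset B -> clique e B -> clique e A.
Proof.
move=> /subsetP sAB /cliqueP cB; apply/cliqueP => x y /sAB xB /sAB yB.
exact: cB.
Qed.

Lemma deg_lt e A x : irreflexive e -> x \in A -> deg e A x <= #|A|.-1.
Proof.
move=> irr xA; rewrite degE (cardsD1 x A) xA /=.
apply/subset_leq_card/subsetP => y; rewrite !inE => /andP[-> exy].
by rewrite andbT; apply: contraTneq exy => ->; rewrite irr.
Qed.

Lemma deg_le e A x : deg e A x <= #|A|.
Proof. by rewrite degE; apply/subset_leq_card/subsetP => y /[!inE] /andP[]. Qed.

Lemma arcs_le e A : irreflexive e -> arcs e A A <= #|A| * #|A|.-1.
Proof.
move=> irr; rewrite arcsE -sum_nat_const; apply: leq_sum => x.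
exact: deg_lt.
Qed.

Lemma arcs_clique e A : irreflexive e -> clique e A ->
  arcs e A A = #|A| * #|A|.-1.
Proof.
move=> irr /cliqueP cA; rewrite arcsE -sum_nat_const; apply: eq_bigr => x xA.
rewrite degE (cardsD1 x A) xA /=; apply: eq_card => y; rewrite !inE.
case: eqVneq => [->|nyx]; first by rewrite irr andbF.
by case yA: (y \in A) => //=; apply: cA => //; rewrite eq_sym.
Qed.

Lemma clique_arcs e A : simple e ->
  #|A| * #|A|.-1 <= arcs e A A -> clique e A.
Proof.
move=> [sym irr] leA; apply/cliqueP => x y xA yA nxy.
have degx : deg e A x = #|A|.-1.
  apply/eqP; rewrite eqn_leq deg_lt //=; move: leA.
  rewrite arcsE -sum_nat_const (bigD1 x) //= [leqRHS](bigD1 x) //=.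
  have : \sum_(i in A | i != x) deg e A i <= \sum_(i in A | i != x) #|A|.-1.
    by apply: leq_sum => z /andP[zA _]; apply: deg_lt.
  lia.
have : [set z in A | e x z] = A :\ x.
  apply/eqP; rewrite eqEcard -degE degx (cardsD1 x A) xA /= leqnn andbT.
  apply/subsetP => z; rewrite !inE => /andP[-> exz]; rewrite andbT.
  by apply: contraTneq exz => ->; rewrite irr.
by move/setP/(_ y); rewrite !inE yA [y == x]eq_sym nxy /= => ->.
Qed.

End Arcs.

(** * Colourings and vertex-critical sets *)

Section Colouring.

Variable T : finType.
Implicit Types (e : rel T) (A B S R W : {set T}) (c : nat).

Definition colourable c e S : bool :=
  [exists f : {ffun T -> 'I_c},
     [forall x in S, forall y in S, e x y ==> (f x != f y)]].

Lemma colourableP c e S :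
  reflect (exists f : T -> 'I_c, {in S &, forall x y, e x y -> f x != f y})
          (colourable c e S).
Proof.
apply: (iffP existsP) => [[f /forall_inP fP]|[f fP]].
  by exists f => x y xS yS exy; move/forall_inP/(_ y yS)/implyP: (fP x xS); apply.
exists (finfun f); apply/forall_inP => x xS; apply/forall_inP => y yS.
by apply/implyP => exy; rewrite !ffunE; apply: fP.
Qed.

Lemma sub_colourable c e e' S S' : S' \subset S ->
    {in S' &, forall x y, e' x y -> e x y} ->
  colourable c e S -> colourable c e' S'.
Proof.
move=> /subsetP sS se /colourableP[f fP]; apply/colourableP; exists f => x y xS yS exy.
by apply: fP; [exact: sS|exact: sS|exact: se].
Qed.

Lemma colourable_sub c e S S' : S' \subset S -> colourable c e S -> colourable c e S'.
Proof. by move=> sS; apply: sub_colourable. Qed.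

Definition vcrit c e S := ~~ colourable c e S && [forall v in S, colourable c e (S :\ v)].

Lemma vcrit_ncolourable c e S : vcrit c e S -> ~~ colourable c e S.
Proof. by case/andP. Qed.

Lemma vcrit_proper c e S R : vcrit c e S -> R \proper S -> colourable c e R.
Proof.
case/andP=> _ /forall_inP Sv /properP[sRS [v vS vR]].
by apply: colourable_sub (Sv v vS); rewrite subsetD1 sRS.
Qed.

Lemma vcrit_exists c e S : ~~ colourable c e S ->
  exists2 W : {set T}, W \subset S & vcrit c e W.
Proof.
case/(minset_exists (P := fun A : {set T} => ~~ colourable c e A)) => W /minsetP[nW Wmin] sWS.
exists W => //; rewrite /vcrit nW; apply/forall_inP => v vW.
apply: contraT => /Wmin/(_ (subD1set _ _)) /setP/(_ v).
by rewrite vW !inE eqxx.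
Qed.

Lemma vcrit_neq0 c e S : 0 < c -> vcrit c e S -> S != set0.
Proof.
move=> c0 /vcrit_ncolourable; apply: contraNneq => ->; apply/colourableP.
by exists (fun=> Ordinal c0) => x y; rewrite inE.
Qed.

Lemma avoid_color c (P : {set 'I_c}) : #|P| < c -> exists i, i \notin P.
Proof.
move=> ltP; have : 0 < #|~: P| by rewrite cardsCs setCK card_ord subn_gt0.
by case/card_gt0P => i; rewrite inE; exists i.
Qed.

Lemma ncolourable_card c e S : 0 < c -> irreflexive e -> ~~ colourable c e S -> c < #|S|.
Proof.
move=> c0 irr; apply: contraR; rewrite -leqNgt => leS; apply/colourableP.
case: (set_0Vmem S) => [->|[x0 x0S]].
  by exists (fun=> Ordinal c0) => x y; rewrite inE.
exists (fun x => widen_ord leS (enum_rank_in x0S x)) => x y xS yS.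
apply: contraTneq => /(congr1 val) /= /val_inj /(enum_rank_in_inj xS yS) ->.
by rewrite irr.
Qed.

Lemma deg_vcrit c e S x : 0 < c -> symmetric e -> irreflexive e ->
  vcrit c e S -> x \in S -> c <= deg e S x.
Proof.
move=> c0 sym irr Sc xS; rewrite leqNgt; apply/negP => ltx.
have /colourableP[f fP] : colourable c e (S :\ x).
  by apply: vcrit_proper Sc _; rewrite properD1.
have [i iP] : exists i, i \notin [set f y | y in [set y in S | e x y]].
  by apply: avoid_color; apply: leq_ltn_trans (leq_imset_card _ _) _; rewrite -degE.
case/negP: (vcrit_ncolourable Sc); apply/colourableP.
exists (fun y => if y == x then i else f y) => y z yS zS eyz.
have [yx|yx] := eqVneq y x; have [zx|zx] := eqVneq z x.
- by rewrite yx zx irr in eyz.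
- apply: contraNneq iP => ->; apply/imsetP; exists z => //.
  by rewrite inE zS -yx.
- rewrite eq_sym; apply: contraNneq iP => ->; apply/imsetP; exists y => //.
  by rewrite inE yS -zx sym.
- by apply: fP; rewrite ?inE ?yx ?zx.
Qed.

End Colouring.

(** * Hall's theorem *)

Section Hall.

Variables I J : finType.
Implicit Types (r : I -> {set J}) (A P : {set I}).

(** Values in [option J] cover an empty [J]. Induction on the size of [A]: a nonempty proper tight
    subset P is matched by itself, and the rest is matched outside the elements reached by P.
    Without a tight subset, Hall's condition survives the removal of any i0 together with any j0 in
    [r i0]. *)
Lemma hall_in r A :
  (forall P, P \subset A -> #|P| <= #|\bigcup_(i in P) r i|) ->
  exists f : I -> option J,
    {in A &, injective f} /\ forall i, i \in A -> exists2 j, f i = Some j & j \in r i.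
Proof.
have [n] := ubnP #|A|; elim: n => // n IHn in r A *; rewrite ltnS => leA hallA.
have [->|[i0 i0A]] := set_0Vmem A.
  by exists (fun=> None); split=> [i j|i]; rewrite inE.
have [/exists_inP[P sPA /andP[/andP[P0 PA] tight]]|/exists_inPn strict] :=
  boolP [exists (P : {set I} | P \subset A),
           (P != set0) && (P != A) && (#|\bigcup_(i in P) r i| <= #|P|)].
  have ltP : #|P| < #|A| by rewrite proper_card // properEneq PA.
  have [|Q sQ|f [finj fP]] := IHn r P; first exact: leq_trans ltP leA.
    by apply: hallA; apply: subset_trans sPA.
  pose B := \bigcup_(i in P) r i.
  have AD : #|A :\: P| < n.
    apply: leq_trans leA; rewrite -(cardsID P A) (setIidPr sPA).
    by rewrite -addn1 addnC leq_add2r card_gt0.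
  have [Q sQ|g [ginj gP]] := IHn (fun i => r i :\: B) _ AD.
    have dPQ : [disjoint P & Q].
      by rewrite disjoint_sym disjoints_subset (subset_trans sQ) ?subsetDr.
    have := hallA (P :|: Q); rewrite subUset sPA (subset_trans sQ (subsetDl _ _)).
    move=> /(_ isT); rewrite cardsU (disjoint_setI0 dPQ) cards0 subn0.
    rewrite bigcup_setU -/B -(cardsID B (B :|: _)) setUK.
    have -> : (B :|: \bigcup_(i in Q) r i) :\: B = \bigcup_(i in Q) (r i :\: B).
      rewrite setDUl setDv set0U; apply/setP => j; rewrite !inE.
      apply/andP/bigcupP => [[jB /bigcupP[i iQ ji]]|[i iQ]].
        by exists i; rewrite // !inE jB.
      by rewrite !inE => /andP[jB ji]; split=> //; apply/bigcupP; exists i.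
    move=> h; have := leq_trans h (leq_add tight (leqnn _)).
    by rewrite leq_add2l.
  exists (fun i => if i \in P then f i else g i); split=> [i j iA jA|i iA]; last first.
    case: ifPn => iP; first exact: fP.
    have [|j -> /[!inE] /andP[_ jr]] := gP i; first by rewrite inE iP.
    by exists j.
  case: ifPn => iP; case: ifPn => jP.
  - exact: finj.
  - have [u fu ur] := fP _ iP; have [|v gv vr] := gP j; first by rewrite inE jP.
    rewrite fu gv => -[uv]; move: vr; rewrite !inE -uv => /andP[/negP[]].
    by apply/bigcupP; exists i.
  - have [u fu ur] := fP _ jP; have [|v gv vr] := gP i; first by rewrite inE iP.
    rewrite fu gv => -[uv]; move: vr; rewrite !inE uv => /andP[/negP[]].
    by apply/bigcupP; exists j.
  - by apply: ginj; rewrite inE ?iP ?jP.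
have /card_gt0P[j0 j0r] : 0 < #|r i0|.
  by have := hallA [set i0]; rewrite sub1set cards1 big_set1; apply.
have AD : #|A :\ i0| < n by move: leA; rewrite (cardsD1 i0) i0A.
have [Q sQ|g [ginj gP]] := IHn (fun i => r i :\ j0) _ AD.
  have [->|Q0] := eqVneq Q set0; first by rewrite cards0.
  have QA : Q \subset A by apply: subset_trans sQ (subD1set _ _).
  have nQA : Q != A.
    by apply: contraTneq sQ => ->; apply/subsetPn; exists i0; rewrite ?inE ?eqxx.
  have /= := strict _ QA; rewrite Q0 nQA /= -ltnNge => ltQ.
  have -> : \bigcup_(i in Q) (r i :\ j0) = (\bigcup_(i in Q) r i) :\ j0.
    apply/setP => j; rewrite !inE.
    apply/bigcupP/andP => [[i iQ]|[jj0 /bigcupP[i iQ ji]]].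
      by rewrite !inE => /andP[jB ji]; split=> //; apply/bigcupP; exists i.
    by exists i; rewrite // !inE jj0.
  by move: ltQ; rewrite (cardsD1 j0 (\bigcup_(i in Q) r i)); case: (_ \in _) => /=; lia.
exists (fun i => if i == i0 then Some j0 else g i); split=> [i j iA jA|i iA]; last first.
  case: eqP => [->|/eqP ni]; first by exists j0.
  have [|j -> /[!inE] /andP[_ jr]] := gP i; first by rewrite !inE ni.
  by exists j.
case: eqP => [->|/eqP ni]; case: eqP => [->|/eqP nj] //.
- have [|v gv vr] := gP j; first by rewrite !inE nj.
  by rewrite gv => -[uv]; move: vr; rewrite !inE uv eqxx.
- have [|v gv vr] := gP i; first by rewrite !inE ni.
  by rewrite gv => -[uv]; move: vr; rewrite !inE uv eqxx.
- by apply: ginj; rewrite !inE ?ni ?nj.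
Qed.

End Hall.

(** * Kernels and list colouring *)

Section Kernel.

Variables (T : finType) (e D : rel T).
Implicit Types (A B K S : {set T}).

Definition kernel_in A B K :=
  [/\ K \subset A :|: B, {in K &, forall x y, ~~ e x y} &
      forall v, v \in A :|: B -> v \notin K -> exists2 w, w \in K & D v w].

(* Every subgraph has a kernel, which is all that a greedy list colouring needs. *)
Lemma kernel_exists A B : symmetric e -> irreflexive e -> [disjoint A & B] ->
    {in A &, forall x y, ~~ e x y} ->
    {in B &, forall x y, e x y -> D x y} ->
    {in A & B, forall x y, e x y -> D x y || D y x} ->
  exists K, kernel_in A B K.
Proof.
move=> sym irr; have [n] := ubnP #|B|; elim: n => // n IHn in A B *.
rewrite ltnS => leB dAB indA biB orAB.
have [/forall_inP all|/forall_inPn[b bB /exists_inPn noA]] :=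
  boolP [forall b in B, [exists a in A, D b a]].
  exists A; split=> //; first exact: subsetUl.
  by move=> v /setUP[->//|/all/exists_inP[a aA Dva] _]; exists a.
(* No arc goes from b to A, so [orAB] and [biB] make every neighbour of b point to b. A kernel of
   what is left after removing b and its neighbours can therefore be extended by b. *)
pose N := [set v | e b v].
have [| |x y|x y|x y|K [sK indK absK]] := IHn (A :\: N) (B :\: N :\ b).
- apply: leq_trans leB; apply: proper_card; apply/properP; split; last first.
    by exists b => //; rewrite !inE eqxx.
  by rewrite subDset setUC; apply: subset_trans (subsetDl _ _) (subsetUl _ _).
- apply: disjointW dAB; first exact: subsetDl.
  by apply: subset_trans (subsetDl _ _) (subsetDl _ _).
- by rewrite !inE => /andP[_ xA] /andP[_ yA]; apply: indA.
- by rewrite !inE => /and3P[_ _ xA] /and3P[_ _ yA]; apply: biB.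
- by rewrite !inE => /andP[_ xA] /and3P[_ _ yA]; apply: orAB.
have KN x : x \in K -> ~~ e b x.
  by move/(subsetP sK); rewrite !inE => /orP[/andP[]|/and3P[]].
exists (b |: K); split.
- apply/subsetP => x /setU1P[->|/(subsetP sK)]; first by rewrite inE bB orbT.
  by rewrite !inE => /orP[/andP[_ ->//]|/and3P[_ _ ->]]; rewrite orbT.
- move=> x y /setU1P[->|xK] /setU1P[->|yK]; rewrite ?irr //.
  + exact: KN.
  + by rewrite sym; exact: KN.
  + exact: indK.
- move=> v vAB; rewrite !inE negb_or => /andP[vb vK].
  have [ebv|nebv] := boolP (e b v).
    exists b; first by rewrite setU11.
    case/setUP: vAB => [vA|vB]; last by apply: biB; rewrite // sym.
    have := orAB v b vA bB; rewrite sym => /(_ ebv) /orP[//|Dbv].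
    by have := noA _ vA; rewrite Dbv.
  have [|w wK Dvw] := absK v _ vK; last by exists w; rewrite // inE wK orbT.
  by rewrite !inE nebv vb /=; move: vAB; rewrite inE.
Qed.

(** Bondy, Boppana and Siegel: give a colour i to a kernel of the vertices that have i in their
    lists. Every other such vertex loses i from its list but also an out-neighbour in the kernel, so
    the strict inequality survives. *)
Lemma kernel_list_colouring c A B (L : T -> {set 'I_c}) : 0 < c ->
    symmetric e -> irreflexive e -> [disjoint A & B] ->
    {in A &, forall x y, ~~ e x y} ->
    {in B &, forall x y, e x y -> D x y} ->
    {in A & B, forall x y, e x y -> D x y || D y x} ->
    {in A :|: B, forall v, #|[set w in A :|: B | D v w]| < #|L v|} ->
  exists2 f : T -> 'I_c, {in A :|: B, forall v, f v \in L v} &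
    {in A :|: B &, forall x y, e x y -> f x != f y}.
Proof.
move=> c0 sym irr; have [n] := ubnP #|A :|: B|; elim: n => // n IHn in A B L *.
rewrite ltnS => leAB dAB indA biB orAB Lgt.
have [AB0|[v0 v0AB]] := set_0Vmem (A :|: B).
  by exists (fun=> Ordinal c0) => [v|x y]; rewrite AB0 inE.
have /card_gt0P[i iL] : 0 < #|L v0| by apply: leq_ltn_trans (Lgt _ v0AB).
have [|x y|x y|x y|K [sK indK absK]] :=
  @kernel_exists [set v in A | i \in L v] [set v in B | i \in L v] sym irr.
- by apply: disjointW dAB; apply/subsetP => x /[!inE] /andP[].
- by rewrite !inE => /andP[xA _] /andP[yA _]; apply: indA.
- by rewrite !inE => /andP[xA _] /andP[yA _]; apply: biB.
- by rewrite !inE => /andP[xA _] /andP[yA _]; apply: orAB.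
have KAB x : x \in K -> x \in A :|: B.
  by move/(subsetP sK); rewrite !inE -andb_orl => /andP[].
have KL x : x \in K -> i \in L x.
  by move/(subsetP sK); rewrite !inE -andb_orl => /andP[].
have absK' v : v \in A :|: B -> i \in L v -> v \notin K -> exists2 w, w \in K & D v w.
  by move=> vAB iv; apply: absK; rewrite !inE -andb_orl iv andbT -in_setU.
have [w0 w0K] : exists w, w \in K.
  have [?|nK] := boolP (v0 \in K); first by exists v0.
  by have [w ? _] := absK' _ v0AB iL nK; exists w.
have UE : (A :\: K) :|: (B :\: K) = (A :|: B) :\: K by rewrite setDUl.
have [||x y|x y|x y|v|f fL fP] := IHn (A :\: K) (B :\: K) (fun v => L v :\ i).
- rewrite UE; apply: leq_trans leAB; apply: proper_card; apply/properP.
  split; first exact: subsetDl.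
  by exists w0; [exact: KAB|rewrite !inE w0K].
- by apply: disjointW dAB; apply: subsetDl.
- by rewrite !inE => /andP[_ xA] /andP[_ yA]; apply: indA.
- by rewrite !inE => /andP[_ xA] /andP[_ yA]; apply: biB.
- by rewrite !inE => /andP[_ xA] /andP[_ yA]; apply: orAB.
- rewrite UE => /setDP[vAB vK].
  have sub : [set w in (A :|: B) :\: K | D v w] \subset [set w in A :|: B | D v w].
    by apply/subsetP => w; rewrite !inE => /andP[/andP[_ ->] ->].
  have := Lgt v vAB; rewrite (cardsD1 i (L v)).
  have [iv|niv] := boolP (i \in L v); rewrite /= ?add0n; last first.
    by apply: leq_ltn_trans; apply: subset_leq_card.
  rewrite add1n ltnS; apply: leq_trans; apply: proper_card; apply/properP.
  split=> //; have [w wK Dvw] := absK' v vAB iv vK.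
  by exists w; rewrite inE ?Dvw ?andbT ?KAB // in_setD wK.
exists (fun v => if v \in K then i else f v) => [v vAB|x y xAB yAB exy].
  case: ifPn => [/KL//|nK]; have := fL v; rewrite UE in_setD nK => /(_ vAB).
  by rewrite inE => /andP[].
case: ifPn => xK; case: ifPn => yK.
- by have := indK x y xK yK; rewrite exy.
- have := fL y; rewrite UE in_setD yK => /(_ yAB).
  by rewrite !inE eq_sym => /andP[].
- have := fL x; rewrite UE in_setD xK => /(_ xAB).
  by rewrite !inE => /andP[].
- by apply: fP; rewrite // UE in_setD ?xK ?yK.
Qed.

End Kernel.

Section KernelBound.

Variables (T : finType) (e : rel T).
Implicit Types (A B S : {set T}).

Lemma arcs_card A B :
  arcs e A B = #|[set p : T * T | [&& p.1 \in A, p.2 \in B & e p.1 p.2]]|.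
Proof.
rewrite /arcs pair_big /= -sum1_card [LHS]big_mkcond [RHS]big_mkcond /=.
apply: eq_bigr => p _; rewrite inE andbA.
by case: (_ && _) => //=; case: (e _ _).
Qed.

(* If the bound fails, Hall's theorem assigns one private [A]-[B] edge to each vertex of
   [A] and two to each vertex of [B].  Orient the edges assigned to [A] towards [A], all
   other [A]-[B] edges towards [B], and the edges inside [B] both ways: every vertex then
   has fewer out-neighbours than colours left to it by a colouring of the rest of [S]. *)
Lemma arcs_critical_bipartite c S A B : 0 < c -> simple e -> vcrit c e S ->
    A \subset S -> B \subset S -> [disjoint A & B] ->
    {in A &, forall x y, ~~ e x y} ->
    {in A, forall x, deg e S x = c} ->
    {in B, forall x, deg e S x = c.+1} ->
  arcs e A B <= #|A| + 2 * #|B|.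
Proof.
move=> c0 [sym irr] Sc; have [n] := ubnP #|A :|: B|; elim: n => // n IHn in A B *.
rewrite ltnS => leAB sA sB dAB indA degA degB.
rewrite leqNgt; apply/negP => viol.
pose slots := [set p : T * bool | (p.1 \in A) && ~~ p.2 || (p.1 \in B)].
pose F := [set p : T * T | [&& p.1 \in A, p.2 \in B & e p.1 p.2]].
pose r (s : T * bool) := [set p in F | (p.1 == s.1) || (p.2 == s.1)].
have cardF : #|F| = arcs e A B by rewrite arcs_card.
have [P sP|f [finj fP]] := @hall_in _ _ r slots.
  have [->|[s0 s0P]] := set_0Vmem P; first by rewrite cards0.
  pose Z := [set p.1 | p in P].
  have Zs0 : s0.1 \in Z by apply: imset_f.
  have leP : #|P| <= #|A :&: Z| + 2 * #|B :&: Z|.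
    have -> : 2 * #|B :&: Z| = #|setX (B :&: Z) [set: bool]|.
      by rewrite cardsX cardsT card_bool mulnC.
    have -> : #|A :&: Z| = #|setX (A :&: Z) [set false]| by rewrite cardsX cards1 muln1.
    apply: leq_trans (subset_leq_card _) (leq_card_setU _ _).
    apply/subsetP => p pP; have pZ : p.1 \in Z by apply: imset_f.
    have := subsetP sP _ pP; rewrite !inE pZ /= !andbT.
    by case: (p.2) => /=; rewrite ?andbF ?andbT //= eqxx ?andbT.
  (* Edges of F that miss Z run between A :\: Z and B :\: Z. The induction hypothesis bounds their
     number, and [viol] then leaves at least #|P| edges for P. *)
  have IH : arcs e (A :\: Z) (B :\: Z) <= #|A :\: Z| + 2 * #|B :\: Z|.
    apply: IHn; rewrite ?(subset_trans (subsetDl _ _)) //.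
    - rewrite -setDUl; apply: leq_trans leAB; apply: proper_card.
      apply/properP; split; first exact: subsetDl.
      exists s0.1; last by rewrite !inE Zs0.
      by have := subsetP sP _ s0P; rewrite !inE => /orP[/andP[-> _]//|->]; rewrite orbT.
    - by apply: disjointW dAB; apply: subsetDl.
    - by move=> x y /[!inE] /andP[_ xA] /andP[_ yA]; apply: indA.
    - by move=> x /[!inE] /andP[_ xA]; apply: degA.
    - by move=> x /[!inE] /andP[_ xA]; apply: degB.
  have leF : #|F| <= #|\bigcup_(s in P) r s| + arcs e (A :\: Z) (B :\: Z).
    rewrite arcs_card; apply: leq_trans (subset_leq_card _) (leq_card_setU _ _).
    apply/subsetP => p pF; rewrite in_setU; apply/orP.
    have := pF; rewrite {1}/F inE => /and3P[p1 p2 ep].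
    have [/imsetP[s sP' ps]|nz1] := boolP (p.1 \in Z).
      by left; apply/bigcupP; exists s; rewrite // inE pF ps eqxx.
    have [/imsetP[s sP' ps]|nz2] := boolP (p.2 \in Z).
      by left; apply/bigcupP; exists s; rewrite // inE pF ps eqxx orbT.
    by right; rewrite !inE nz1 nz2 p1 p2.
  have := cardsID Z A; have := cardsID Z B; rewrite cardF in leF; lia.
pose D v w := e v w && (if v \in A then f (v, false) != Some (v, w) else
  if w \in A then f (w, false) == Some (w, v) else true).
pose U := A :|: B.
have notAB x : x \in B -> x \notin A.
  by move=> xB; apply: contraTN dAB => xA; apply/pred0Pn; exists x; rewrite /= xA.
have sU : U \subset S by rewrite subUset sA.
have [U0|[u0 u0U]] := set_0Vmem U.
  have A0 : A = set0 by apply/eqP; rewrite -subset0 -U0 subsetUl.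
  by move: viol; rewrite A0 arcs0l.
have /colourableP[g gP] : colourable c e (S :\: U).
  apply: vcrit_proper Sc _; rewrite properE subsetDl /=.
  apply/subsetPn; exists u0; first exact: (subsetP sU).
  by rewrite inE u0U.
pose L v := ~: [set g w | w in [set w in S :\: U | e v w]].
(* Colouring S :\: U first leaves at least [deg e U] colours to a vertex of A and at least one fewer
   to a vertex of B. Hence one private edge for the former and two for the latter. *)
have Lge v : c + deg e U v <= #|L v| + deg e S v.
  have -> : deg e S v = deg e U v + deg e (S :\: U) v.
    by rewrite /deg (big_setID U) /= (setIidPr sU).
  pose I := [set g w | w in [set w in S :\: U | e v w]].
  have leI : #|I| <= deg e (S :\: U) v by rewrite degE leq_imset_card.
  have -> : #|L v| = c - #|I| by rewrite cardsCs setCK card_ord.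
  lia.
have slotA a : a \in A -> (a, false) \in slots by rewrite !inE => ->.
have slotB b j : b \in B -> (b, j) \in slots by rewrite !inE => ->; rewrite orbT.
have fA a : a \in A -> exists b, [/\ b \in B, e a b & f (a, false) = Some (a, b)].
  move=> aA; have [|[u v] fu] := fP (a, false); first by rewrite !inE aA.
  rewrite !inE /= => /andP[/and3P[uA vB euv] /orP[/eqP ua|/eqP va]].
    by exists v; subst u.
  by move: vB; rewrite va => /notAB; rewrite aA.
have fB b j : b \in B -> exists a, [/\ a \in A, e a b & f (b, j) = Some (a, b)].
  move=> bB; have [|[u v] fu] := fP (b, j); first by rewrite !inE bB orbT.
  rewrite !inE /= => /andP[/and3P[uA vB euv] /orP[/eqP ua|/eqP va]].
    by move: bB; rewrite -ua => /notAB; rewrite uA.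
  by exists u; subst v.
have outA a : a \in A -> #|[set w in U | D a w]| < deg e U a.
  move=> aA; have [b [bB eab fab]] := fA a aA.
  rewrite degE; apply/proper_card/properP; split.
    by apply/subsetP => w; rewrite !inE => /andP[-> /andP[->]].
  by exists b; rewrite !inE bB orbT ?eab // /D aA fab eqxx andbF.
have outB b : b \in B -> #|[set w in U | D b w]|.+1 < deg e U b.
  move=> bB; have [a1 [a1A e1 f1]] := fB b false bB.
  have [a2 [a2A e2 f2]] := fB b true bB.
  have n12 : a1 != a2.
    apply/eqP => a12; have := finj (b, false) (b, true) (slotB _ _ bB) (slotB _ _ bB).
    by rewrite f1 f2 a12 => /(_ erefl).
  have Dn a j : a \in A -> f (b, j) = Some (a, b) -> D b a = false.
    move=> aA fba; rewrite /D (negPf (notAB _ bB)) aA.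
    apply/negbTE; rewrite negb_and; apply/orP; right; apply/eqP => faa.
    have := finj (a, false) (b, j) (slotA _ aA) (slotB _ _ bB).
    by rewrite faa fba => /(_ erefl)[ab _]; have := notAB _ bB; rewrite -ab aA.
  rewrite degE.
  have a1N : a1 \in [set y in U | e b y] by rewrite !inE a1A sym.
  rewrite (cardsD1 a1 [set y in U | e b y]) a1N add1n ltnS.
  apply/proper_card/properP; split.
    apply/subsetP => w; rewrite !inE => /andP[-> Dbw].
    have := Dbw; rewrite /D => /andP[-> _]; rewrite !andbT.
    by apply: contraTneq Dbw => ->; rewrite (Dn a1 false).
  exists a2; first by rewrite !inE a2A eq_sym n12 sym e2.
  by rewrite inE (Dn a2 true) ?andbF.
have [| |v vU|h hL hP] := @kernel_list_colouring _ e D c A B L c0 sym irr dAB indA.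
- move=> x y xB yB exy; rewrite /D exy (negPf (notAB _ xB)) (negPf (notAB _ yB)) //.
- move=> x y xA yB exy; rewrite /D exy xA (negPf (notAB _ yB)) /=.
  by rewrite sym exy /= orNb.
- have := Lge v; have := vU; rewrite inE => /orP[vA|vB].
    by rewrite (degA _ vA) (addnC c) leq_add2r; apply: leq_trans; apply: outA.
  rewrite (degB _ vB) (addnC c) addnS -addSn leq_add2r => h.
  by rewrite -ltnS; apply: leq_trans h; apply: outB.
case/negP: (vcrit_ncolourable Sc); apply/colourableP.
have LS x y : x \in U -> y \in S -> y \notin U -> e x y -> h x != g y.
  move=> xU yS yU exy; have := hL x xU; rewrite inE.
  by apply: contraNneq => ->; rewrite imset_f // !inE exy yS !(andbT, andTb) -in_setU.
exists (fun x => if x \in U then h x else g x) => x y xS yS exy.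
case: ifPn => xU; case: ifPn => yU.
- exact: hP.
- exact: LS.
- by rewrite eq_sym LS // sym.
- by apply: gP; rewrite // inE ?xU ?yU.
Qed.

End KernelBound.

(** * The Kostochka-Yancey bound *)

Section Potential.

Variables (c : nat) (T : finType).
Implicit Types (e : rel T) (A B R S W : {set T}).

(* With c = k - 1, [pot] is the Kostochka-Yancey potential (k-2)(k+1)|R| - 2(k-1)|E(R)|,
   [Kpot j] is the potential of K_j, and [potmax] = k(k-3) is that of K_k. *)
Definition pot e R : int :=
  ((c%:Z * c%:Z + c%:Z - 2) * #|R|%:Z - c%:Z * (arcs e R R)%:Z)%R.

Definition Kpot (j : nat) : int :=
  ((c%:Z * c%:Z + c%:Z - 2) * j%:Z - c%:Z * (j%:Z * (j%:Z - 1)))%R.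

Definition potmax : int := (c%:Z * c%:Z - c%:Z - 2)%R.

(** For c > 2 the second root of this quadratic in j, 2 - 2/c, lies between 1 and 2. So among the
    cliques on 1 to c vertices K_1 has the least potential and K_c the next; these are the two
    thresholds of the potential argument. *)
Lemma KpotB j : (Kpot j - Kpot c = (c%:Z - j%:Z) * (c%:Z * (j%:Z - 2) + 2))%R.
Proof. by rewrite /Kpot; ring. Qed.

Lemma Kpot_c : Kpot c = (2 * c%:Z * (c%:Z - 1))%R.
Proof. by rewrite /Kpot; ring. Qed.

Lemma Kpot_gt j : 1 < j < c -> (Kpot c < Kpot j)%R.
Proof.
case/andP=> j2 jc; rewrite -subr_gt0 KpotB; apply: mulr_gt0; first by lia.
have : (0 <= c%:Z * (j%:Z - 2))%R by apply: mulr_ge0; lia.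
lia.
Qed.

Lemma Kpot_ge j : 1 < j <= c -> (Kpot c <= Kpot j)%R.
Proof.
case/andP=> j2; rewrite leq_eqVlt => /predU1P[->//|jc].
by apply/ltW/Kpot_gt; rewrite j2.
Qed.

Lemma Kpot1 : Kpot 1 = (c%:Z * c%:Z + c%:Z - 2)%R.
Proof. by rewrite /Kpot; ring. Qed.

Lemma Kpot_gt1 j : 2 < c -> 1 < j <= c -> (Kpot 1 < Kpot j)%R.
Proof.
move=> c3 /Kpot_ge; apply: lt_le_trans; rewrite Kpot1 Kpot_c; nia.
Qed.

Lemma Kpot_ge1 j : 2 < c -> 0 < j <= c -> (Kpot 1 <= Kpot j)%R.
Proof.
move=> c3 /andP[]; rewrite leq_eqVlt => /predU1P[<-//|j2] jc.
by apply/ltW/Kpot_gt1; rewrite // j2.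
Qed.

Lemma Kpot_pot e A : irreflexive e -> (Kpot #|A| <= pot e A)%R.
Proof.
move=> irr; have := arcs_le A irr; rewrite /Kpot /pot => le.
have : ((arcs e A A)%:Z <= #|A|%:Z * (#|A|%:Z - 1))%R by case: #|A| le => [|n]; lia.
nia.
Qed.

Lemma pot_clique e A : irreflexive e -> clique e A -> pot e A = Kpot #|A|.
Proof.
move=> irr cA; rewrite /pot arcs_clique // /Kpot; case: #|A| => [|n] /=; nia.
Qed.

Lemma pot_setU e A B : symmetric e -> [disjoint A & B] ->
  pot e (A :|: B) = (pot e A + pot e B - 2 * c%:Z * (arcs e A B)%:Z)%R.
Proof.
move=> sym dAB; rewrite /pot arcs_setU // cardsU (disjoint_setI0 dAB) cards0 subn0.
lia.
Qed.

Lemma eq_pot e e' A : {in A &, forall x y, e x y = e' x y} -> pot e A = pot e' A.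
Proof. by move=> ee'; rewrite /pot (@eq_arcs _ e e'). Qed.

Lemma pot_set1 e x : irreflexive e -> pot e [set x] = Kpot 1.
Proof. by move=> irr; rewrite /pot cards1 arcs11 // /Kpot; ring. Qed.

Lemma clique_of_pot e A : 2 < c -> simple e -> 1 < #|A| <= c ->
  (pot e A <= Kpot c)%R -> #|A| = c /\ clique e A.
Proof.
move=> c3 [sym irr] /andP[A2 Ac] potA.
have Ac' : #|A| = c.
  apply/eqP; rewrite eqn_leq Ac leqNgt; apply/negP => lt.
  have := Kpot_gt (j := #|A|); rewrite A2 lt => /(_ isT).
  by have := Kpot_pot A irr; lia.
split=> //; apply: clique_arcs => //.
move: potA; rewrite /pot Ac' /Kpot; move: (arcs e A A) => n.
case: c c3 {A2 Ac Ac'} => // m m3 /=.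
rewrite leqNgt => h; apply/negP => lt.
have : (0 < (m.+1)%:Z * ((m.+1)%:Z * m%:Z - n%:Z))%R by apply: mulr_gt0; lia.
by move: h; lia.
Qed.

End Potential.

(** * Contracting the colour classes of a proper subset *)

Section Contraction.

Variables (c : nat) (T : finType) (e : rel T) (S R : {set T}) (f : T -> 'I_c).
Hypotheses (simple_e : simple e) (crit_S : vcrit c e S).
Hypothesis IH : forall (e' : rel T) (W : {set T}), simple e' -> vcrit c e' W ->
  #|W| < #|S| -> (pot c e' W <= potmax c)%R.
Hypotheses (sRS : R \proper S) (leR : c < #|R|).
Hypothesis fP : {in R &, forall x y, e x y -> f x != f y}.

Let rep (i : 'I_c) : T := enum_val (widen_ord (ltnW leR) i).

Let rep_inj : injective rep.
Proof. by move=> i j /enum_val_inj /(congr1 val) /= /val_inj. Qed.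

Let repR i : rep i \in R.
Proof. exact: enum_valP. Qed.

Let ix x := [pick i | rep i == x].

Let ix_rep i : ix (rep i) = Some i.
Proof.
rewrite /ix; case: pickP => [j /eqP/rep_inj->//|/(_ i)]; by rewrite eqxx.
Qed.

Let ixN x : x \notin R -> ix x = None.
Proof.
move=> xR; rewrite /ix; case: pickP => // i /eqP xE; by rewrite -xE repR in xR.
Qed.

Let joined i v := [exists w in R, (f w == i) && e w v].

(* The colour classes of [R] are contracted to a clique on [c] vertices.  These vertices
   are chosen inside [R], so that the contraction lives on the same type. *)
Let eY : rel T := fun u v =>
  match ix u, ix v with
  | None, None => e u v
  | Some i, None => joined i v
  | None, Some j => joined j u
  | Some i, Some j => i != j
  end.

Let simple_eY : simple eY.
Proof.
have [sym irr] := simple_e; split=> [u v|u]; rewrite /eY.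
  by case: (ix u) (ix v) => [i|] [j|] //; rewrite eq_sym.
by case: (ix u) => [i|]; rewrite ?eqxx.
Qed.

(** A critical set W of the contraction consists of V and of the clique on the classes in J. Putting
    R back in place of this clique loses no crossing edge, changes the potential by at most pot R -
    Kpot #|J|, and gains the edges from the classes outside J, whence the second term on the left.
    For the last clause: if only one vertex u of the single class i had neighbours in V, a colouring
    of the proper subset u |: V would colour W. *)
Lemma contraction_critical : 2 < c ->
  exists (V : {set T}) (J : {set 'I_c}),
    [/\ V \subset S :\: R, J != set0,
        (pot c e (R :|: V) + 2 * c%:Z * (arcs e [set w in R | f w \notin J] V)%:Z
          <= pot c e R + potmax c - Kpot c #|J|)%R &
        forall i, J = [set i] ->
          exists u v, [/\ u \in R /\ v \in R, u != v, f u = i /\ f v = i &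
                         0 < deg e V u /\ 0 < deg e V v]].
Proof.
move=> c3; have [sym irr] := simple_e; have c0 : 0 < c by apply: leq_trans c3.
pose X := rep @: setT.
have sXR : X \subset R by apply/subsetP => _ /imsetP[i _ ->].
have ncolY : ~~ colourable c eY ((S :\: R) :|: X).
  apply: contra (vcrit_ncolourable crit_S) => /colourableP[g gP]; apply/colourableP.
  have repY i : rep i \in S :\: R :|: X by rewrite in_setU imset_f ?orbT.
  exists (fun x => if x \in R then g (rep (f x)) else g x) => x y xS yS exy.
  case: ifPn => xR; case: ifPn => yR.
  - by apply: gP; rewrite // /eY !ix_rep; apply: fP.
  - apply: gP; rewrite ?repY // ?in_setU ?in_setD ?yR ?yS //.
    by rewrite /eY ix_rep ixN //; apply/existsP; exists x; rewrite xR eqxx.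
  - apply: gP; rewrite ?repY // ?in_setU ?in_setD ?xR ?xS //.
    by rewrite /eY ix_rep ixN //; apply/existsP; exists y; rewrite yR eqxx sym.
  - by apply: gP; rewrite ?in_setU ?in_setD ?xR ?xS ?yR ?yS // /eY !ixN.
have [W sW Wc] := vcrit_exists ncolY.
have cardX : #|X| = c by rewrite card_imset // cardsT card_ord.
have ltW : #|W| < #|S|.
  apply: leq_ltn_trans (subset_leq_card sW) _.
  apply: leq_ltn_trans (leq_card_setU _ _) _; rewrite cardX.
  by rewrite -(cardsID R S) (setIidPr (proper_sub sRS)) addnC ltn_add2r.
have potW := IH simple_eY Wc ltW.
pose V := W :\: R; pose J := [set i | rep i \in W].
have WE : W = (rep @: J) :|: V.
  apply/setP => x; rewrite !inE; apply/idP/idP => [xW|/orP[/imsetP[i]|/andP[]//]].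
    rewrite xW andbT; have [xR|] := boolP (x \in R); last by rewrite orbT.
    rewrite orbF.
    have := subsetP sW _ xW; rewrite !inE xR /= => /imsetP[i _ xi].
    by rewrite xi imset_f // inE -xi.
  by rewrite inE => iW ->.
have dJV : [disjoint rep @: J & V].
  rewrite disjoint_sym disjoints_subset; apply: subset_trans (subsetDr _ _) _.
  by rewrite setCS; apply/subsetP => _ /imsetP[i _ ->].
have sVS : V \subset S :\: R.
  apply/subsetP => x; rewrite inE => /andP[xR /(subsetP sW)].
  by rewrite !inE xR /= => /orP[//|/(subsetP sXR)]; rewrite (negPf xR).
have VR v : v \in V -> v \notin R by rewrite inE => /andP[].
have eYV : {in V &, forall x y, eY x y = e x y}.
  by move=> x y xV yV; rewrite /eY !ixN ?VR.
have R0 : 0 < #|R| by apply: leq_trans leR.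
have [u0 u0R] := card_gt0P R0.
have u0S : u0 \in S by apply: (subsetP (proper_sub sRS)).
have J0 : J != set0.
  apply: contraNneq (vcrit_ncolourable Wc) => J0; rewrite WE J0 imset0 set0U.
  apply: sub_colourable (vcrit_proper (R := V) crit_S _) => [|x y xV yV|] //.
    by rewrite eYV.
  apply/properP; split; first by apply: subset_trans sVS (subsetDl _ _).
  by exists u0; rewrite // inE u0R.
have leArcs : arcs eY (rep @: J) V <= arcs e [set w in R | f w \in J] V.
  rewrite /arcs big_imset /=; last by move=> ? ? _ _ /rep_inj.
  rewrite [leqRHS](partition_big f (mem J)) /=; last by move=> w /[!inE] /andP[].
  apply: leq_sum => i iJ; rewrite exchange_big /=; apply: leq_sum => v vV.
  rewrite /eY ix_rep (ixN (VR _ vV)).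
  case: (boolP (joined i v)) => // /existsP[w /and3P[wR /eqP fw ewv]].
  by rewrite (bigD1 w) /= ?ewv // inE wR fw eqxx iJ.
exists V, J; split=> //.
  have dRV : [disjoint R & V].
    by rewrite disjoint_sym disjoints_subset subsetDr.
  have KpotJ := Kpot_pot c (rep @: J) simple_eY.2.
  rewrite card_imset // in KpotJ.
  move: potW; rewrite {1}WE pot_setU //; last exact: simple_eY.1.
  rewrite (pot_setU c sym dRV) (eq_pot c eYV) => potW.
  rewrite (arcs_split e (fun w => f w \in J) R V).
  move: leArcs KpotJ potW; move: (arcs eY _ V) (arcs e [set w in R | f w \in J] V).
  move: (arcs e _ V) (pot c eY _) (pot c e R) (pot c e V) (potmax c) (Kpot c #|J|).
  move=> n3 p1 pR pV M k n1 n2 le1 le2 le3.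
  have : (c%:Z * n1%:Z <= c%:Z * n2%:Z)%R by apply: ler_wpM2l.
  by clear -le2 le3; lia.
move=> i Ji; pose P := [set w in R | (f w == i) && (0 < deg e V w)].
have [/card_gt1P[u [v [uP vP nuv]]]|] := ltnP 1 #|P|.
  move: uP vP; rewrite !inE => /and3P[uR /eqP fu du] /and3P[vR /eqP fv dv].
  by exists u, v.
move=> P1; case/negP: (vcrit_ncolourable Wc).
have [u [uR uP]] : exists u, u \in R /\ P \subset [set u].
  move: P1; rewrite leq_eqVlt => /orP[/cards1P[u Pu]|]; last first.
    by rewrite ltnS leqn0 cards_eq0 => /eqP->; exists u0; rewrite sub0set.
  exists u; rewrite Pu; split=> //.
  by have : u \in P by [rewrite Pu set11]; rewrite inE => /andP[].
have /colourableP[g gP] : colourable c e (u |: V).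
  apply: vcrit_proper crit_S _; rewrite properE subUset sub1set.
  rewrite (subsetP (proper_sub sRS)) //= (subset_trans sVS (subsetDl _ _)) /=.
  have /card_gt1P[x [y [xR yR nxy]]] : 1 < #|R| by apply: leq_trans leR; exact: leqW (ltnW c3).
  have [z zR zu] : exists2 z, z \in R & z != u.
    by have [xu|] := eqVneq x u; [exists y; rewrite // -xu eq_sym|exists x].
  apply/subsetPn; exists z; first exact: (subsetP (proper_sub sRS)).
  by rewrite !inE (negPf zu) zR.
apply/colourableP; exists (fun x => if x == rep i then g u else g x) => x y.
rewrite WE Ji imset_set1.
have key v : v \in V -> eY (rep i) v -> g u != g v.
  move=> vV; rewrite /eY ix_rep ixN ?VR // => /existsP[w /and3P[wR /eqP fw ewv]].
  apply: gP; rewrite ?setU11 ?setU1r //.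
  suff /(subsetP uP)/set1P <- : w \in P by [].
  rewrite !inE wR fw eqxx /= degE card_gt0; apply/set0Pn; exists v.
  by rewrite inE vV.
have nrep v : v \in V -> (v == rep i) = false.
  by move=> /VR; apply: contraNF => /eqP->.
move=> /setU1P[->|xV] /setU1P[->|yV]; rewrite ?eqxx ?nrep // => exy.
- by rewrite simple_eY.2 in exy.
- exact: key.
- by rewrite eq_sym; apply: key; rewrite // simple_eY.1.
- by apply: gP; rewrite ?setU1r // -eYV.
Qed.

End Contraction.

(** * Edge cuts, and edges spread over the boundary of a set *)

Section Connectivity.

Variable T : finType.
Implicit Types (e h : rel T) (A B M R S W : {set T}).

(* With fewer crossing edges, some cyclic shift of the colours of [R] would fit. *)
Lemma edge_connectivity c e S R : 0 < c -> symmetric e -> vcrit c e S ->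
  R != set0 -> R \proper S -> c <= arcs e R (S :\: R).
Proof.
case: c => // c _ sym Sc R0 pRS; have sRS := proper_sub pRS.
have /colourableP[f fP] := vcrit_proper Sc pRS.
have [r0 r0R] := set0Pn _ R0.
have /colourableP[g gP] : colourable c.+1 e (S :\: R).
  apply: vcrit_proper Sc _; rewrite properE subsetDl /=.
  by apply/subsetPn; exists r0; rewrite ?inE ?r0R // (subsetP sRS).
rewrite arcs_card -[c.+1]card_ord -cardsT.
apply: leq_trans (leq_imset_card (fun p : T * T => (g p.2 - f p.1)%R) _).
apply/subset_leq_card/subsetP => d _; apply: contraT => dN.
case/negP: (vcrit_ncolourable Sc); apply/colourableP.
have key x y : x \in R -> y \in S -> y \notin R -> e x y -> (f x + d)%R != g y.
  move=> xR yS yR exy; apply: contraNneq dN => fg.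
  apply/imsetP; exists (x, y) => /=; first by rewrite !inE xR yR yS.
  by rewrite -fg addrAC subrr add0r.
exists (fun x => if x \in R then (f x + d)%R else g x) => x y xS yS exy.
case: ifPn => xR; case: ifPn => yR.
- by rewrite (inj_eq (addIr _)) fP.
- exact: key.
- by rewrite eq_sym key // sym.
- by apply: gP; rewrite // inE ?xR ?yR.
Qed.

(* The element [u] occurs [w u] times in a row, so when all weights are at most [i] the
   entries at distance [i] differ and can be joined by an edge. *)
Definition stubs (w : T -> nat) (s : seq T) := flatten [seq nseq (w u) u | u <- s].

Lemma mem_stubs w s u : u \in stubs w s -> u \in s.
Proof. by case/flatten_mapP => v vs /nseqP[-> _]. Qed.

Lemma sum_stubs w s (F : T -> nat) :
  \sum_(u <- stubs w s) F u = \sum_(u <- s) w u * F u.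
Proof.
rewrite big_flatten big_map; apply: eq_bigr => u _.
by rewrite big_nseq iter_addn addn0 mulnC.
Qed.

Lemma stubs_neq w s i j x0 : uniq s -> (forall u, w u <= i) ->
  j + i < size (stubs w s) ->
  nth x0 (stubs w s) j != nth x0 (stubs w s) (j + i).
Proof.
move=> + wi; elim: s j => [|u s IHs] j //= /andP[us uniq_s].
rewrite /stubs /= -/(stubs w s) size_cat size_nseq => ltj.
rewrite !nth_cat !size_nseq !nth_nseq.
have [jw|wj] := ltnP j (w u).
  have wij : w u <= j + i by apply: leq_trans (wi u) (leq_addl _ _).
  rewrite ltnNge wij /=; apply: contraNneq us => ->.
  by apply: (@mem_stubs w); apply: mem_nth; rewrite ltn_subLR.
have wij : w u <= j + i by apply: leq_trans wj (leq_addr _ _).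
by rewrite ltnNge wij /= -addnBAC // IHs // addnBAC // ltn_subLR.
Qed.

(** A star at u0 with i leaves of positive weight suffices. If M misses u0, the weight of u0 is
    outside M; otherwise all leaves are outside. If there are fewer than i possible leaves, the star
    takes all of them, and M cannot contain two vertices of positive weight. *)
Lemma spread_star (w : T -> nat) R i u0 : u0 \in R -> i <= w u0 ->
  exists h, [/\ simple h, arcs h R R <= 2 * i &
    forall M, M \subset R -> {in M &, forall x y, ~~ h x y} ->
      (exists u v, [/\ u \in M, v \in M, u != v & 0 < w u /\ 0 < w v]) ->
      i <= \sum_(u in R :\: M) w u].
Proof.
move=> u0R wu0; pose P := [set u in R :\ u0 | 0 < w u].
have [Q [sQP leQ QP]] : exists Q : {set T},
    [/\ Q \subset P, #|Q| <= i & Q = P \/ #|Q| = i].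
  have [leP|ltP] := leqP #|P| i; first by exists P; split; auto.
  have : 0 < #|[set B : {set T} | B \subset P & #|B| == i]|.
    by rewrite cards_draws bin_gt0 ltnW.
  by case/card_gt0P => Q; rewrite inE => /andP[sQ /eqP Qi]; exists Q; split; auto; rewrite Qi.
have u0Q : u0 \notin Q.
  by apply/negP => /(subsetP sQP); rewrite !inE eqxx.
have sQR : Q \subset R.
  by apply/subsetP => x /(subsetP sQP); rewrite !inE => /andP[/andP[]].
pose h x y := ((x == u0) && (y \in Q)) || ((y == u0) && (x \in Q)).
have simp : simple h.
  split=> [x y|x]; rewrite /h; first by rewrite orbC.
  by case: eqP => // ->; rewrite (negPf u0Q).
exists h; split=> //.
  rewrite -(setD1K u0R) arcs_setU1 // ?inE ?eqxx //.
  have -> : arcs h (R :\ u0) (R :\ u0) = 0.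
    rewrite /arcs big1 // => x /[!inE] /andP[nx _]; rewrite big1 // => y /[!inE] /andP[ny _].
    by rewrite /h (negPf nx) (negPf ny).
  rewrite add0n leq_mul2l /= degE; apply: leq_trans leQ.
  apply/subset_leq_card/subsetP => y; rewrite !inE /h eqxx /= => /andP[/andP[ny _]].
  by rewrite (negPf ny) orbF.
move=> M sMR indM [u [v [uM vM nuv [wu wv]]]].
have [u0M|u0M] := boolP (u0 \in M); last first.
  by rewrite (bigD1 u0) /= ?inE ?u0M //; apply: leq_trans (leq_addr _ _).
have QM x : x \in Q -> x \notin M.
  by move=> xQ; apply: contraTN isT => xM; have := indM u0 x u0M xM; rewrite /h eqxx xQ.
case: QP => [QP|Qi]; last first.
  rewrite -Qi -sum1_card big_mkcond [leqRHS]big_mkcond /=; apply: leq_sum => x _.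
  case: ifP => // xQ; rewrite inE QM // (subsetP sQR) //=.
  by have := subsetP sQP _ xQ; rewrite inE => /andP[].
have [x [xM nx wx]] : exists x, [/\ x \in M, x != u0 & 0 < w x].
  have [uu0|] := eqVneq u u0; last by exists u.
  by exists v; split=> //; rewrite -uu0 eq_sym.
have : x \in Q by rewrite QP !inE nx wx (subsetP sMR).
by move/QM; rewrite xM.
Qed.

(* Adding the at most [i] edges of [h] to [R] forces every colour class with at least
   two boundary vertices to leave at least [i] of the boundary weight to the others. *)
Lemma spread_graph (w : T -> nat) R i : 2 * i <= \sum_(u in R) w u ->
  exists h, [/\ simple h, arcs h R R <= 2 * i &
    forall M, M \subset R -> {in M &, forall x y, ~~ h x y} ->
      (exists u v, [/\ u \in M, v \in M, u != v & 0 < w u /\ 0 < w v]) ->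
      i <= \sum_(u in R :\: M) w u].
Proof.
move=> le2i; have [/exists_inP[u0 u0R wu0]|/exists_inPn wlt] :=
  boolP [exists u in R, i <= w u]; first exact: spread_star wu0.
have [R0|[x0 x0R]] := set_0Vmem R.
  move: le2i; rewrite R0 big_set0 leqn0 muln_eq0 /= => /eqP->.
  exists (fun _ _ => false); split=> //; first by rewrite arcs0l.
(* [stubs_neq] asks for the bound i at every vertex, not only in R, hence the truncation. *)
pose w' u := if u \in R then w u else 0.
have w'i u : w' u <= i.
  by rewrite /w'; case: ifP => // uR; apply: ltnW; rewrite ltnNge wlt.
pose s := stubs w' (enum R).
have sum_s (F : T -> nat) : \sum_(0 <= j < size s) F (nth x0 s j) = \sum_(u in R) w u * F u.
  rewrite -(big_nth x0 xpredT) sum_stubs big_enum /=.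
  by apply: eq_bigr => u uR; rewrite /w' uR.
have size_s : 2 * i <= size s.
  have := sum_s (fun=> 1); rewrite sum_nat_const_nat muln1 subn0 => ->.
  by under eq_bigr do rewrite muln1.
have sneq (j : 'I_i) : nth x0 s j != nth x0 s (j + i).
  apply: stubs_neq => //; first exact: enum_uniq.
  by apply: leq_trans size_s; have := ltn_ord j; lia.
pose h x y := [exists j : 'I_i, ((x == nth x0 s j) && (y == nth x0 s (j + i)))
                            || ((y == nth x0 s j) && (x == nth x0 s (j + i)))].
have symh : symmetric h by move=> x y; apply: eq_existsb => j; rewrite orbC.
exists h; split=> //.
- split=> // x; apply/negbTE/existsPn => j; rewrite orbb.
  by apply: contraNN (sneq j) => /andP[/eqP<- /eqP<-].
- rewrite arcs_card.
  pose F1 (j : 'I_i) := (nth x0 s j, nth x0 s (j + i)).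
  pose F2 (j : 'I_i) := (nth x0 s (j + i), nth x0 s j).
  apply: leq_trans (subset_leq_card (B := F1 @: setT :|: F2 @: setT) _) _.
    apply/subsetP => -[x y]; rewrite !inE /= => /and3P[_ _ /existsP[j /orP[]]].
      by case/andP => /eqP-> /eqP->; rewrite imset_f.
    by case/andP => /eqP-> /eqP->; rewrite [X in _ || X]imset_f ?orbT.
  apply: leq_trans (leq_card_setU _ _) _; rewrite mul2n -addnn.
  by apply: leq_add; apply: leq_trans (leq_imset_card _ _) _; rewrite cardsT card_ord.
move=> M sMR indM _.
(* The weight outside M is the number of stubs outside M, and an independent M misses at least one
   of the joined stubs j and j + i, for each j < i. *)
have -> : \sum_(u in R :\: M) w u = \sum_(0 <= j < size s) (nth x0 s j \notin M : nat).
  rewrite (sum_s (fun u => u \notin M : nat)) big_mkcond [RHS]big_mkcond /=.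
  by apply: eq_bigr => u _; rewrite inE; case: (u \in M) (u \in R) => [] []; rewrite ?muln0 ?muln1.
rewrite (big_cat_nat _ (n := 2 * i)) //=; apply: leq_trans (leq_addr _ _).
rewrite (big_cat_nat _ (n := i)) //=; last by rewrite leq_pmull.
rewrite -{3}[i]add0n big_addn mul2n -addnn addnK -big_split /=.
rewrite -[X in X <= _](subn0 i) -[X in X <= _]muln1 -sum_nat_const_nat.
rewrite big_nat [leqRHS]big_nat; apply: leq_sum => j /andP[_ ji].
case: (boolP (nth x0 s j \in M)) => //= m1; case: (boolP (_ \in M)) => //= m2.
have := indM _ _ m1 m2; rewrite /h => /existsPn/(_ (Ordinal ji)).
by rewrite !eqxx.
Qed.

End Connectivity.

Lemma ex_min_set (T : finType) (P : pred {set T}) (F : {set T} -> int) :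
  (exists A, P A) -> exists2 A, P A & forall B, P B -> (F A <= F B)%R.
Proof.
case=> A0 PA0; case: (Order.TotalTheory.arg_minP F PA0) => A PA Amin.
by exists A.
Qed.

Lemma ex_quotient (n d : nat) : 0 < n -> 0 < d ->
  exists i, d * i < n <= d * i + d.
Proof.
move=> n0 d0; exists (n.-1 %/ d); have := divn_eq n.-1 d; have := ltn_pmod n.-1 d0.
rewrite [d * _]mulnC; lia.
Qed.

(** * Lower bounds for the potential of proper subsets *)

Section LowPotential.

Variables (c : nat) (T : finType) (e : rel T) (S : {set T}).
Implicit Types (R W X : {set T}).
Hypotheses (c3 : 2 < c) (simple_e : simple e) (crit_S : vcrit c e S).
Hypothesis IH : forall (e' : rel T) (W : {set T}), simple e' -> vcrit c e' W ->
  #|W| < #|S| -> (pot c e' W <= potmax c)%R.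
Hypothesis large_S : (potmax c < pot c e S)%R.

Let c0 : 0 < c. Proof. exact: leq_trans c3. Qed.

Let Kpot1E : Kpot c 1 = (potmax c + 2 * c%:Z)%R.
Proof. by rewrite Kpot1 /potmax; ring. Qed.

Lemma card_colours (J : {set 'I_c}) : #|J| <= c.
Proof. by rewrite -[leqRHS](card_ord c) max_card. Qed.

(** Contracting a violating R' of least potential gives R' :|: V, whose potential is lower by at
    least Kpot 1 - potmax = 2 * c. This contradicts the choice of R' if the union is proper, and
    [large_S] if it is S. *)
Lemma pot_proper_gt R : R \proper S -> 1 < #|R| -> (Kpot c 1 < pot c e R)%R.
Proof.
have [sym irr] := simple_e.
move=> pR R1; rewrite ltNge; apply/negP => potR.
have [|R' /andP[pR' R'1] minR] := @ex_min_set T (fun R => (R \proper S) && (1 < #|R|)) (pot c e).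
  by exists R; rewrite pR.
have {potR} potR' : (pot c e R' <= Kpot c 1)%R.
  by apply: le_trans potR; apply: minR; rewrite pR.
have leR' : c < #|R'|.
  rewrite ltnNge; apply/negP => le; have := Kpot_pot c R' irr.
  have := @Kpot_gt1 c #|R'| c3; rewrite R'1 le => /(_ isT) h1 h2.
  by have := lt_le_trans h1 (le_trans h2 potR'); rewrite ltxx.
have /colourableP[f fP] := vcrit_proper crit_S pR'.
have [V [J [sV J0 potV _]]] := contraction_critical simple_e crit_S IH pR' leR' fP c3.
have kJ : (Kpot c 1 <= Kpot c #|J|)%R.
  by apply: Kpot_ge1; rewrite // card_gt0 J0 card_colours.
have lt : (pot c e (R' :|: V) <= pot c e R' + potmax c - Kpot c 1)%R.
  move: potV kJ; clear; lia.
have sU : R' :|: V \subset S.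
  by rewrite subUset proper_sub //= (subset_trans sV) ?subsetDl.
have [US|US] := eqVneq (R' :|: V) S.
  by move: lt large_S potR' ; rewrite US Kpot1E; clear; lia.
have : (pot c e R' <= pot c e (R' :|: V))%R.
  apply: minR; rewrite properEneq US sU; apply: leq_trans R'1 _.
  exact/subset_leq_card/subsetUl.
move: lt Kpot1E c3; clear; lia.
Qed.

(* A violating [R'] of least potential stays colourable after adding [i] edges, by
   minimality.  If the colouring is contracted to a single class, the edges leaving the
   other classes lower the potential of the extension by a further [2 * c * i]. *)
Lemma pot_clique_proper R : R \proper S -> 1 < #|R| -> (pot c e R <= Kpot c c)%R ->
  #|R| = c /\ clique e R.
Proof.
have [sym irr] := simple_e.
pose small R := [&& R \proper S, 1 < #|R| & ~~ ((#|R| == c) && clique e R)].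
move=> pR R1 potR; case: (boolP ((#|R| == c) && clique e R)) => [/andP[/eqP]//|nR].
have [|R' /and3P[pR' R'1 nR'] minR] := @ex_min_set T small (pot c e).
  by exists R; rewrite /small pR R1.
have {potR} potR' : (pot c e R' <= Kpot c c)%R.
  by apply: le_trans potR; apply: minR; rewrite /small pR R1.
have leR' : c < #|R'|.
  rewrite ltnNge; apply/negP => le.
  have [||h1 h2] := @clique_of_pot c T e R' c3 simple_e; rewrite ?R'1 //.
  by rewrite h1 h2 eqxx in nR'.
have gtR' := pot_proper_gt pR' R'1.
(* i is the largest number of edges whose addition to R' keeps its potential above potmax. *)
have [i iP] : exists i : nat, (potmax c + 2 * c%:Z * i%:Z < pot c e R'
                     <= potmax c + 2 * c%:Z * i%:Z + 2 * c%:Z)%R.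
  have [n nE] : exists n : nat, (pot c e R' - potmax c = n%:Z)%R.
    exists `|pot c e R' - potmax c|%N; move: gtR' Kpot1E; clear; lia.
  have [||i iP] := @ex_quotient n (2 * c).
  - by move: gtR' Kpot1E nE c0; clear; lia.
  - by rewrite muln_gt0.
  by exists i; move: iP nE; move: (pot _ _ _) => p; clear; nia.
(* This follows from pot R' <= Kpot c. By [edge_connectivity] at least c edges leave R', so the
   boundary weight reaches 2 * i as [spread_graph] requires. *)
have i2 : 2 * i < c.
  rewrite ltnNge; apply/negP => le.
  have : (c%:Z * c%:Z <= c%:Z * (2 * i%:Z))%R by apply: ler_wpM2l; lia.
  move: iP potR' c3; rewrite Kpot_c /potmax; move: (pot _ _ _) => p; clear; lia.
pose w u := deg e (S :\: R') u.
have [|h [simple_h arcs_h hP]] := @spread_graph T w R' i.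
  apply: leq_trans (ltnW i2) _; apply: edge_connectivity sym crit_S _ pR' => //.
  by rewrite -card_gt0 ltnW.
pose eh x y := e x y || h x y.
have simple_eh : simple eh.
  by split=> [x y|x]; rewrite /eh ?irr ?simple_h.2 // sym simple_h.1.
have /colourableP[f fP] : colourable c eh R'.
  apply: contraT => /vcrit_exists[W sW Wc].
  have ltW : #|W| < #|S|.
    exact: leq_ltn_trans (subset_leq_card sW) (proper_card pR').
  have pW : W \proper S by apply: sub_proper_trans pR'.
  have cW : c < #|W| := ncolourable_card c0 simple_eh.2 (vcrit_ncolourable Wc).
  have potW := IH simple_eh Wc ltW.
  have arcsW : arcs eh W W <= arcs e W W + 2 * i.
    apply: leq_trans (leq_add (leqnn _) (leq_trans (arcs_sub h sW sW) arcs_h)).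
    rewrite /arcs -big_split; apply: leq_sum => x _ /=.
    rewrite -big_split; apply: leq_sum => y _ /=.
    by rewrite /eh; case: (e x y); case: (h x y).
  have : (pot c e R' <= pot c e W)%R.
    apply: minR; rewrite /small pW (ltn_trans _ cW) ?(ltnW c3) //=.
    by rewrite (gtn_eqF cW).
  have : (c%:Z * (arcs eh W W)%:Z <= c%:Z * (arcs e W W + 2 * i)%N%:Z)%R.
    by apply: ler_wpM2l.
  move: iP potW; rewrite /pot; move: (#|R'|) (#|W|) (arcs e R' R') => n1 n2 n3.
  move: (arcs eh W W) (arcs e W W) (potmax c) => n4 n5 M; clear; lia.
have feP : {in R' &, forall x y, e x y -> f x != f y}.
  by move=> x y xR yR exy; apply: fP; rewrite // /eh exy.
have [V [J [sV J0 potV JP]]] := contraction_critical simple_e crit_S IH pR' leR' feP c3.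
have sU : R' :|: V \subset S.
  by rewrite subUset proper_sub //= (subset_trans sV) ?subsetDl.
have cU : c < #|R' :|: V| by apply: leq_trans leR' _; apply/subset_leq_card/subsetUl.
have U1 : 1 < #|R' :|: V| by apply: ltn_trans cU; apply: ltnW.
(* With two or more classes, Kpot #|J| is at least Kpot c and absorbs pot R', which brings the union
   down to potmax. The added edges matter only for a single class. *)
have [J1|J2] := leqP #|J| 1; last first.
  have kJ : (Kpot c c <= Kpot c #|J|)%R by apply: Kpot_ge; rewrite J2 card_colours.
  have lt : (pot c e (R' :|: V) <= potmax c)%R by move: potV kJ potR'; clear; lia.
  have [US|US] := eqVneq (R' :|: V) S.
    by move: lt large_S; rewrite US leNgt => /negP.
  have := @pot_proper_gt (R' :|: V); rewrite properEneq US sU U1 => /(_ isT isT).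
  by move: lt Kpot1E c0; clear; lia.
have /eqP/cards1P[i0 Ji0] : #|J| = 1 by apply/eqP; rewrite eqn_leq J1 card_gt0.
have [u [v [[uR vR] nuv [fu fv] [du dv]]]] := JP _ Ji0.
(* If the union is S, then V is all of S :\: R' and the boundary weights w count edges to V. The
   class i0 is independent in h and has two boundary vertices, so [hP] applies to it. *)
have sum_i : R' :|: V = S -> i <= arcs e [set x in R' | f x \notin J] V.
  move=> US.
  have VE : V = S :\: R'.
    apply/eqP; rewrite eqEsubset sV; apply/subsetP => x /setDP[xS xR].
    by move: xS; rewrite -US inE (negPf xR).
  rewrite arcsE.
  have -> : [set x in R' | f x \notin J] = R' :\: [set x in R' | f x == i0].
    apply/setP => x; rewrite Ji0 !inE; by case: (x \in R'); rewrite ?andbT ?andbF.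
  rewrite VE; apply: (hP [set x in R' | f x == i0]).
  - by apply/subsetP => x /[!inE] /andP[].
  - move=> x y; rewrite !inE => /andP[xR /eqP fx] /andP[yR /eqP fy].
    apply/negP => hxy; have := fP x y xR yR; rewrite /eh hxy orbT fx fy eqxx.
    by move=> /(_ isT).
  - exists u, v; rewrite !inE uR vR fu fv eqxx; split=> //.
    by split; apply: leq_trans (deg_sub _ _ sV).
have lt := potV; rewrite {2}Ji0 cards1 in lt.
have [US|US] := eqVneq (R' :|: V) S.
  have : (c%:Z * i%:Z <= c%:Z * (arcs e [set x in R' | f x \notin J] V)%:Z)%R.
    by apply: ler_wpM2l => //; apply: sum_i.
  rewrite US in lt.
  move: lt large_S iP Kpot1E; move: (arcs _ _ _) (pot _ _ _) (pot _ _ _) (potmax _) (Kpot _ _).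
  by clear; lia.
have : (pot c e R' <= pot c e (R' :|: V))%R.
  apply: minR; rewrite /small properEneq US sU U1 /=.
  by rewrite (gtn_eqF cU).
have : (0 <= 2 * c%:Z * (arcs e [set x in R' | f x \notin J] V)%:Z)%R by [].
move: lt Kpot1E c0; move: (2 * c%:Z * _)%R (pot _ _ _) (pot _ _ _) (potmax _) (Kpot _ _).
by clear; lia.
Qed.

End LowPotential.

Lemma inj_into (T : finType) c (C : {set T}) (A : {set 'I_c}) : 0 < c -> #|C| <= #|A| ->
  exists h : T -> 'I_c, {in C &, injective h} /\ {in C, forall x, h x \in A}.
Proof.
move=> c0 leCA; have [->|[x0 x0C]] := set_0Vmem C.
  by exists (fun=> Ordinal c0); split=> [x y|x]; rewrite inE.
exists (fun x => enum_val (widen_ord leCA (enum_rank_in x0C x))).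
split=> [x y xC yC /enum_val_inj /(congr1 val) /= /val_inj|x xC].
  exact: enum_rank_in_inj.
exact: enum_valP.
Qed.

(** In the discharging, a vertex in a cluster of size t has c - t neighbours of degree at least c +
    t, each of which sends it at least (c * (t - 1) + 2) / (c + t) by [charge_arith]. These shares
    add up to c - 2. *)
Lemma cluster_arith c t : 1 < t -> t <= c - 2 ->
  (c - 2) * (c + t) <= (c - t) * (c * (t - 1) + 2).
Proof.
move=> t1 tc; have [i ti] : exists i, t = i + 2 by exists (t - 2); lia.
have [j cj] : exists j, c = i + 4 + j by exists (c - t - 2); lia.
have -> : c - 2 = i + 2 + j by lia.
have -> : c - t = j + 2 by lia.
have -> : t - 1 = i + 1 by lia.
by rewrite ti cj; clear; nia.
Qed.

(** For a cluster with a twinless neighbour of degree c the shares must add up to c - 1;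
    [charge_arith_tight] improves their denominator to 2 * t + 1. *)
Lemma cluster_arith_tight c t : 1 < t -> t < c - 2 ->
  (c - 1) * (2 * t).+1 <= (c - t) * (c * (t - 1) + 2).
Proof.
move=> t1 tc; have [i ti] : exists i, t = i + 2 by exists (t - 2); lia.
have [j cj] : exists j, c = i + 5 + j by exists (c - t - 3); lia.
have -> : c - 1 = i + 4 + j by lia.
have -> : c - t = j + 3 by lia.
have -> : t - 1 = i + 1 by lia.
by rewrite ti cj; clear; nia.
Qed.

Lemma charge_arith c t D l : 0 < c -> 1 < t -> c + t <= D -> l <= D ->
  (c * (t - 1) + 2) * l <= (c * (D - c.+1) + 2) * (c + t).
Proof.
move=> c0 t1 leD lD; apply: leq_trans (leq_mul (leqnn _) lD) _.
have [i Di] : exists i, D = c + t + i by exists (D - (c + t)); lia.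
have [j tj] : exists j, t = j + 2 by exists (t - 2); lia.
have -> : D - c.+1 = j + 1 + i by lia.
have -> : t - 1 = j + 1 by lia.
have : 2 * i <= c * i + c * (c * i) by nia.
by rewrite Di tj; clear; nia.
Qed.

Lemma charge_arith_tight c t D l : 1 < t -> t < c - 2 -> c + t <= D ->
    l + (c - t - 1) <= D ->
  (c * (t - 1) + 2) * l <= (c * (D - c.+1) + 2) * (2 * t).+1.
Proof.
move=> t1 tc leD lD; have {}lD : l <= D - (c - t - 1) by lia.
apply: leq_trans (leq_mul (leqnn _) lD) _.
have [i Di] : exists i, D = c + t + i by exists (D - (c + t)); lia.
have [j tj] : exists j, t = j + 2 by exists (t - 2); lia.
have -> : D - c.+1 = j + 1 + i by lia.
have -> : D - (c - t - 1) = 2 * j + 5 + i by lia.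
have -> : t - 1 = j + 1 by lia.
have : 2 * i <= 2 * (c * i) by nia.
by rewrite tj; clear; nia.
Qed.

Section Neighbourhoods.

Variables (T : finType).
Implicit Types (e : rel T) (A S : {set T}) (x y z : T).

(** Closed neighbourhoods, so that distinct twins are adjacent and a cluster is a clique. *)
Definition nbhd e S x := [set y in S | (y == x) || e x y].

Definition twin e S x y := nbhd e S x == nbhd e S y.

Definition cluster e S x := [set y in S | nbhd e S y == nbhd e S x].

Lemma nbhd_self e S x : x \in S -> x \in nbhd e S x.
Proof. by move=> xS; rewrite inE xS eqxx. Qed.

Lemma nbhdC e S x y : symmetric e -> x \in S -> y \in S -> (y \in nbhd e S x) = (x \in nbhd e S y).
Proof. by move=> sym xS yS; rewrite !inE xS yS eq_sym sym. Qed.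

Lemma nbhd_sub e S x : nbhd e S x \subset S.
Proof. by apply/subsetP => y /[!inE] /andP[]. Qed.

Lemma card_nbhd e S x : irreflexive e -> x \in S -> #|nbhd e S x| = (deg e S x).+1.
Proof.
move=> irr xS; rewrite (cardsD1 x) nbhd_self // add1n degE; congr _.+1.
apply: eq_card => y; rewrite !inE; case: eqVneq => //= ->.
by rewrite irr andbF.
Qed.

Lemma cluster_nbhd e S x y : y \in cluster e S x -> nbhd e S y = nbhd e S x.
Proof. by rewrite inE => /andP[_ /eqP]. Qed.

Lemma cluster_self e S x : x \in S -> x \in cluster e S x.
Proof. by move=> xS; rewrite inE xS eqxx. Qed.

Lemma cluster_eq e S x y : y \in cluster e S x -> cluster e S y = cluster e S x.
Proof.
by move=> yC; apply/setP => z; rewrite !inE (cluster_nbhd yC).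
Qed.

Lemma cluster_sub_nbhd e S x : symmetric e -> x \in S -> cluster e S x \subset nbhd e S x.
Proof.
move=> sym xS; apply/subsetP => y yC; have yS : y \in S by move: yC; rewrite inE => /andP[].
by rewrite -(cluster_nbhd yC) nbhd_self.
Qed.

Lemma adj_nbhd e S x y : y \in S -> e x y -> y \in nbhd e S x.
Proof. by move=> yS exy; rewrite inE yS exy orbT. Qed.

Lemma nbhd_adj e S x y : y \in nbhd e S x -> y != x -> e x y.
Proof. by rewrite inE => /andP[_ /orP[/eqP->|//]]; rewrite eqxx. Qed.

Lemma cluster_adj e S x y z : y \in cluster e S x -> z \in nbhd e S x -> z != y -> e y z.
Proof. by move=> yC zx; apply: (@nbhd_adj e S); rewrite (cluster_nbhd yC). Qed.

Lemma deg_nbhd e S x y : irreflexive e -> x \in S -> y \in S ->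
  nbhd e S x = nbhd e S y -> deg e S x = deg e S y.
Proof. by move=> irr xS yS xy; apply/succn_inj; rewrite -!card_nbhd // xy. Qed.

Lemma deg_full e A x : {in A, forall y, e x y} -> deg e A x = #|A|.
Proof.
move=> all; rewrite degE; apply: eq_card => y; rewrite inE.
by case yA: (y \in A) => //=; apply: all.
Qed.

Lemma deg_setD1 e A x : irreflexive e -> deg e (A :\ x) x = deg e A x.
Proof.
move=> irr; rewrite !degE; apply: eq_card => y; rewrite !inE.
by case: eqVneq => //= ->; rewrite irr andbF.
Qed.

Lemma pot_setD1 c e A x : simple e -> x \in A ->
  pot c e A = (pot c e (A :\ x) + Kpot c 1 - 2 * c%:Z * (deg e (A :\ x) x)%:Z)%R.
Proof.
move=> [sym irr] xA; rewrite -{1}(setD1K xA) pot_setU //; last first.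
  by rewrite disjoints1 !inE eqxx.
by rewrite pot_set1 // arcs1l [(Kpot c 1 + _)%R]addrC.
Qed.

End Neighbourhoods.

(** * The structure of a minimal counterexample *)

Section MinimalCounterexample.

Variables (c : nat) (T : finType) (e : rel T) (S : {set T}).
Implicit Types (R W X : {set T}).
Hypotheses (c3 : 2 < c) (simple_e : simple e) (crit_S : vcrit c e S).
Hypothesis IH : forall (e' : rel T) (W : {set T}), simple e' -> vcrit c e' W ->
  #|W| < #|S| -> (pot c e' W <= potmax c)%R.
Hypothesis large_S : (potmax c < pot c e S)%R.

Let c0 : 0 < c. Proof. exact: leq_trans c3. Qed.
Let c1 : 1 < c. Proof. exact: ltnW. Qed.
Let sym : symmetric e. Proof. by case: simple_e. Qed.
Let irr : irreflexive e. Proof. by case: simple_e. Qed.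
Let Kpot1E : Kpot c 1 = (potmax c + 2 * c%:Z)%R.
Proof. by rewrite Kpot1 /potmax; ring. Qed.

Local Notation N := (nbhd e S).
Local Notation cl := (cluster e S).
Local Notation d := (deg e S).

Lemma deg_ge x : x \in S -> c <= d x.
Proof. exact: deg_vcrit. Qed.

(** With c - 1 neighbours in X, the set x |: X would have potential at most Kpot c + Kpot 1 - 2 * c
    * (c - 1) = Kpot 1, against [pot_proper_gt]. If it is all of S, the minimum degree c already
    forces potential at most potmax. *)
Lemma no_near_clique X x : X \subset S -> clique e X -> #|X| = c -> x \in S ->
  x \notin X -> deg e X x < c.-1.
Proof.
move=> sX cX Xc xS xX; rewrite ltnNge; apply/negP => ledeg.
have sR : x |: X \subset S by rewrite subUset sub1set xS.
have cR : #|x |: X| = c.+1 by rewrite cardsU1 xX Xc.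
have [RS|RS] := eqVneq (x |: X) S.
  have : c.+1 * c <= arcs e S S.
    by rewrite arcsE -{1}cR RS -sum_nat_const; apply: leq_sum => y /deg_ge.
  have := large_S; rewrite /pot -{1}RS cR /potmax.
  by move: (arcs e S S) => n; clear; nia.
have := pot_proper_gt c3 simple_e crit_S IH large_S (R := x |: X).
rewrite properEneq RS sR cR => /(_ isT c0).
rewrite (@pot_setD1 _ c e (x |: X) x) ?setU11 // setU1K // pot_clique // Xc Kpot_c Kpot1.
by move: ledeg; move: (deg e X x) c3 => n; clear; nia.
Qed.

Lemma low_clique_nbhd X u : X \subset S -> clique e X -> #|X| = c -> u \in X -> d u = c ->
  exists w, [/\ w \in S, w \notin X & N u = w |: X].
Proof.
move=> sX /cliqueP cX Xc uX du; have uS := subsetP sX _ uX.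
have sXN : X \subset N u.
  apply/subsetP => z zX; rewrite inE (subsetP sX) //=.
  by case: eqVneq => //= nzu; apply: cX => //; rewrite eq_sym.
have : #|N u :\: X| = 1.
  by rewrite cardsD (setIidPr sXN) card_nbhd // du Xc subSnn.
move/eqP/cards1P => [w wE]; exists w.
have : w \in N u :\: X by rewrite wE set11.
rewrite inE => /andP[wX wN]; split=> //; first exact: (subsetP (nbhd_sub e S u)).
by rewrite -wE setUC -{1}(setID (N u) X) (setIidPr sXN).
Qed.

(** Otherwise u and v have distinct outside neighbours w1 and w2. Delete u and v and join w1 to w2:
    a colouring would extend, since X without u and v leaves two colours and w1, w2 are coloured
    differently. So there is a critical W, and dropping the new edge gives it potential at most
    potmax + 2 * c = Kpot 1 in e, against [pot_proper_gt]. *)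
Lemma clique_low_twins X u v : X \subset S -> clique e X -> #|X| = c ->
  u \in X -> v \in X -> d u = c -> d v = c -> N u = N v.
Proof.
move=> sX cX Xc uX vX du dv; have [->//|nuv] := eqVneq u v.
have [w1 [w1S w1X Nu]] := low_clique_nbhd sX cX Xc uX du.
have [w2 [w2S w2X Nv]] := low_clique_nbhd sX cX Xc vX dv.
have [w12|nw] := eqVneq w1 w2; first by rewrite Nu Nv w12.
pose e1 x y := e x y || (x == w1) && (y == w2) || (x == w2) && (y == w1).
have simple_e1 : simple e1.
  split=> [x y|x]; rewrite /e1; last first.
    by rewrite irr /=; case: eqVneq => [->|_]; rewrite ?(negPf nw) ?andbF.
  by rewrite sym [(y == w1) && _]andbC [(y == w2) && _]andbC orbAC.
pose S' := S :\: [set u; v].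
have inS' x : x \in S -> x != u -> x != v -> x \in S'.
  by move=> xS xu xv; rewrite !inE negb_or xu xv.
have notX x y : x \in X -> y \notin X -> y != x.
  by move=> xX; apply: contraNneq => ->.
have w1S' : w1 \in S' by apply: inS'; rewrite ?notX.
have w2S' : w2 \in S' by apply: inS'; rewrite ?notX.
have ncol : ~~ colourable c e1 S'.
  apply: contra (vcrit_ncolourable crit_S) => /colourableP[f fP].
  have fw : f w1 != f w2 by apply: fP; rewrite // /e1 !eqxx orbT.
  pose A := ~: (f @: (X :\: [set u; v])).
  have A2 : 1 < #|A|.
    have := leq_imset_card f (X :\: [set u; v]).
    have -> : #|A| = c - #|f @: (X :\: [set u; v])| by rewrite cardsCs setCK card_ord.
    have -> : #|X :\: [set u; v]| = c - 2.
      by rewrite cardsD (setIidPr _) ?cards2 ?nuv ?Xc // subUset !sub1set uX.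
    by move: c1; move: #|f @: _| => n; clear; lia.
  have other b : exists2 a, a \in A & a != b.
    have /card_gt1P[a1 [a2 [a1A a2A na]]] := A2.
    by have [<-|] := eqVneq a1 b; [exists a2; rewrite // eq_sym|exists a1].
  have [a [b [aA bA nab aw bw]]] : exists a b, [/\ a \in A, b \in A, a != b, a != f w1 & b != f w2].
    have [wA|wA] := boolP (f w1 \in A).
      by have [a aA na] := other (f w1); exists a, (f w1).
    have [b bA nb] := other (f w2); have [a aA na] := other b.
    by exists a, b; split=> //; apply: contraNneq wA => <-.
  have AX a' z : a' \in A -> z \in X -> z != u -> z != v -> a' != f z.
    move=> a'A zX zu zv; apply: contraTneq a'A => ->.
    by rewrite inE negbK imset_f // !inE negb_or zu zv.
  pose g x := if x == u then a else if x == v then b else f x.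
  have gu z : z \in S -> e u z -> g u != g z.
    move=> zS euz; rewrite /g eqxx eq_sym.
    have zu : z != u by apply: contraTneq euz => ->; rewrite irr.
    rewrite (negPf zu); case: (eqVneq z v) => [_|zv]; first by rewrite eq_sym.
    have := adj_nbhd zS euz; rewrite Nu => /setU1P[->|zX]; first by rewrite eq_sym.
    by rewrite eq_sym AX.
  have gv z : z \in S -> e v z -> g v != g z.
    move=> zS evz; rewrite /g eqxx eq_sym [v == u]eq_sym (negPf nuv).
    have zv : z != v by apply: contraTneq evz => ->; rewrite irr.
    rewrite (negPf zv); case: (eqVneq z u) => [_|zu]; first by [].
    have := adj_nbhd zS evz; rewrite Nv => /setU1P[->|zX]; first by rewrite eq_sym.
    by rewrite eq_sym AX.
  apply/colourableP; exists g => x y xS yS exy.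
  have [xu|xu] := eqVneq x u; first by rewrite xu gu // -xu.
  have [xv|xv] := eqVneq x v; first by rewrite xv gv // -xv.
  have [yu|yu] := eqVneq y u; first by rewrite yu eq_sym gu // -yu sym.
  have [yv|yv] := eqVneq y v; first by rewrite yv eq_sym gv // -yv sym.
  rewrite /g (negPf xu) (negPf xv) (negPf yu) (negPf yv).
  by apply: fP; rewrite ?inS' // /e1 exy.
have [W sW Wc] := vcrit_exists ncol.
have pW : W \proper S.
  apply: sub_proper_trans sW _; rewrite properE subsetDl.
  by apply/subsetPn; exists u; rewrite ?(subsetP sX) // !inE eqxx.
have cW := ncolourable_card c0 simple_e1.2 (vcrit_ncolourable Wc).
have potW := IH simple_e1 Wc (proper_card pW).
have arcsW : arcs e1 W W <= arcs e W W + 2.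
  rewrite !arcs_card; pose F := [set p : T * T | [&& p.1 \in W, p.2 \in W & e p.1 p.2]].
  apply: leq_trans (subset_leq_card (B := F :|: [set (w1, w2); (w2, w1)]) _) _.
    apply/subsetP => -[x y]; rewrite !inE /e1 /= => /and3P[-> -> /orP[/orP[->//|]|]].
      by case/andP=> /eqP-> /eqP->; rewrite !eqxx orbT.
    by case/andP=> /eqP-> /eqP->; rewrite !eqxx !orbT.
  apply: leq_trans (leq_card_setU _ _) _; rewrite leq_add2l.
  by rewrite cards2; case: eqP.
have W1 : 1 < #|W| by apply: ltn_trans cW.
have := pot_proper_gt c3 simple_e crit_S IH large_S pW W1.
have : (c%:Z * (arcs e1 W W)%:Z <= c%:Z * (arcs e W W + 2)%N%:Z)%R by apply: ler_wpM2l.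
move: potW Kpot1E; rewrite /pot; move: (Kpot c 1) (arcs e1 W W) (arcs e W W) (potmax c) (#|W|).
by clear; lia.
Qed.

Hypothesis min_arcs : forall e', simple e' -> vcrit c e' S ->
  (potmax c < pot c e' S)%R -> arcs e S S <= arcs e' S S.
Hypothesis max_twins : forall e', simple e' -> vcrit c e' S ->
  (potmax c < pot c e' S)%R -> arcs e' S S = arcs e S S ->
  arcs (twin e' S) S S <= arcs (twin e S) S S.

(* Replace [y] by a new twin of [x].  This does not increase the number of edges, and
   raises the number of twin pairs if it keeps that number; so the new graph is not
   critical on all of [S], and its critical part shows that [N x :\ y] is a clique. *)
Lemma twin_switch x y : x \in S -> y \in S -> d x = c -> e x y -> N x != N y ->
  d y < c + #|cl x| -> (d y = c -> #|cl y| <= #|cl x|) -> clique e (N x :\ y).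
Proof.
move=> xS yS dx exy nxy dy cly.
pose C := cl x; pose Nx := N x :\ y.
have yx : y \in N x by apply: adj_nbhd.
have yC : y \notin C by rewrite inE yS /= eq_sym.
have CS z : z \in C -> z \in S by rewrite inE => /andP[].
have CN z : z \in C -> z \in N x by apply/subsetP/cluster_sub_nbhd.
have Nx_c : #|Nx| = c.
  by have := cardsD1 y (N x); rewrite yx card_nbhd // dx add1n => -[].
pose e' u v := if u == y then v \in Nx else if v == y then u \in Nx else e u v.
have e'y v : e' y v = (v \in Nx) by rewrite /e' eqxx.
have e'N u v : u != y -> v != y -> e' u v = e u v.
  by move=> /negPf uy /negPf vy; rewrite /e' uy vy.
have simple_e' : simple e'.
  split=> [u v|u]; rewrite /e'; last by case: eqP => [->|_]; rewrite ?irr // !inE eqxx.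
  by case: (eqVneq u y) => [uy|_]; case: (eqVneq v y) => [vy|_] //; rewrite ?uy ?vy // sym.
have [sym' irr'] := simple_e'.
have ncol : ~~ colourable c e' S.
  apply: contra (vcrit_ncolourable crit_S) => /colourableP[f fP].
  have [a aP] : exists a, a \notin f @: [set z in S :\: C | e y z].
    apply: avoid_color; apply: leq_ltn_trans (leq_imset_card _ _) _; rewrite -degE.
    have : d y = #|C| + deg e (S :\: C) y.
      rewrite {1}/deg (big_setID C) /= (setIidPr _); last by apply/subsetP.
      congr (_ + _); rewrite -/(deg e C y); apply: deg_full => z zC.
      rewrite sym; apply: (cluster_adj zC) => //.
      by apply: contraNneq yC => ->.
    by move: dy; rewrite -/C; move: (#|C|) (deg _ _ _) => n1 n2; clear; lia.
  (* The colour a is missing among the neighbours of y outside C. In f the vertex y stands for a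
     twin of x, so its colour avoids [N x :\ y]; a member of the clique C coloured a can take over
     [f y] while y takes a. *)
  pose g z := if z == y then a else if z \in C then (if f z == a then f y else f z) else f z.
  have Cy z : z \in C -> z != y by move=> zC; apply: contraNneq yC => <-.
  have fC z : z \in N x -> z != y -> f y != f z.
    move=> zN zy; apply: fP; rewrite ?(subsetP (nbhd_sub e S x)) //.
    by rewrite e'y !inE zy (subsetP (nbhd_sub e S x) _ zN) /=; move: zN; rewrite inE => /andP[].
  have gy z : z \in S -> e y z -> g y != g z.
    move=> zS eyz; have zy : z != y by apply: contraTneq eyz => ->; rewrite irr.
    rewrite /g eqxx (negPf zy); case: ifPn => zC; last first.
      by apply: contraNneq aP => ->; rewrite imset_f // in_set in_setD zC zS.
    by case: (eqVneq (f z) a) => [<-|]; rewrite eq_sym // fC ?CN.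
  have gC z w : z \in C -> w \in S -> w != y -> e z w -> g z != g w.
    move=> zC wS wy ezw; have zy := Cy z zC.
    have fzw : f z != f w by apply: fP; rewrite ?e'N // CS.
    have wN : w \in N x by rewrite -(cluster_nbhd zC); apply: adj_nbhd.
    rewrite /g (negPf zy) zC (negPf wy); case: (boolP (w \in C)) => wC; last first.
      by case: ifP => // _; apply: fC.
    case: (eqVneq (f z) a) => [fza|fza]; case: (eqVneq (f w) a) => [fwa|fwa] //.
    - by rewrite fza fwa eqxx in fzw.
    - by rewrite fC ?CN.
    - by rewrite eq_sym fC ?CN.
  apply/colourableP; exists g => z w zS wS ezw.
  have [zy|zy] := eqVneq z y; first by rewrite zy gy // -zy.
  have [wy|wy] := eqVneq w y; first by rewrite wy eq_sym gy // -wy sym.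
  have [zC|zC] := boolP (z \in C); first exact: gC.
  have [wC|wC] := boolP (w \in C); first by rewrite eq_sym gC // sym.
  by rewrite /g (negPf zy) (negPf zC) (negPf wy) (negPf wC) fP // e'N.
have [W sW Wc] := vcrit_exists ncol.
have arcs'1 : arcs e' (S :\ y) (S :\ y) = arcs e (S :\ y) (S :\ y).
  by apply: eq_arcs => u v; rewrite !inE => /andP[uy _] /andP[vy _]; rewrite e'N.
have arcs' : arcs e' S S = arcs e (S :\ y) (S :\ y) + 2 * c.
  rewrite -{1 2}(setD1K yS) arcs_setU1 // ?inE ?eqxx // arcs'1.
  congr (_ + 2 * _); rewrite degE -Nx_c; apply: eq_card => z.
  by rewrite !inE e'y !inE; case: eqP => //=; case: (z \in S).
have arcsE : arcs e S S = arcs e (S :\ y) (S :\ y) + 2 * d y.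
  by rewrite -{1 2}(setD1K yS) arcs_setU1 // ?inE ?eqxx // deg_setD1.
have dyc := deg_ge yS.
(* If the new graph is critical on all of S, [min_arcs] forces d y = c. Then y trades at most #|C| -
   1 twins for at least #|C| and no other twin pair is lost, against [max_twins]. *)
have [WS|WS] := eqVneq W S.
  rewrite WS in Wc; have large' : (potmax c < pot c e' S)%R.
    apply: lt_le_trans large_S _; rewrite /pot arcs' arcsE.
    have : (c%:Z * c%:Z <= c%:Z * (d y)%:Z)%R by apply: ler_wpM2l.
    by move: (arcs e _ _) (d y) (#|S|) => n1 n2 n3; clear; lia.
  have := min_arcs simple_e' Wc large'; rewrite arcs' arcsE leq_add2l leq_mul2l /= => dyc'.
  have {dyc dyc'} dyc : d y = c by apply/eqP; rewrite eqn_leq dyc'.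
  have := max_twins simple_e' Wc large'; rewrite arcs' arcsE dyc => /(_ erefl).
  rewrite leqNgt => /negP[].
  have symt e1 : symmetric (twin e1 S) by move=> u v; rewrite /twin eq_sym.
  have splitS e1 : arcs (twin e1 S) S S =
      1 + 2 * deg (twin e1 S) (S :\ y) y + arcs (twin e1 S) (S :\ y) (S :\ y).
    rewrite -{2 3}(setD1K yS) arcs_setU // ?disjoints1 ?inE ?eqxx //.
    by rewrite !arcs1l {1}/deg big_set1 /twin eqxx.
  rewrite !splitS.
  have lt1 : deg (twin e S) (S :\ y) y < #|C|.
    apply: leq_trans (cly dyc); rewrite (cardsD1 y (cl y)) cluster_self // add1n ltnS degE.
    apply/subset_leq_card/subsetP => z; rewrite !inE => /andP[/andP[-> ->]].
    by rewrite /twin eq_sym.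
  have N'y : nbhd e' S y = N x.
    apply/setP => z; rewrite !inE e'y !inE; case: eqVneq => [->|_] /=; last first.
      by case: (z \in S).
    by rewrite yS exy orbT.
  have N'N z : z \in S -> z != y -> nbhd e' S z =
      [set w in S | (w \in N z) && (w != y) || (w == y) && (z \in N x)].
    move=> zS zy; apply/setP => w; rewrite !inE /e' (negPf zy) !inE zy zS /=.
    case: (eqVneq w y) => [->|wy]; rewrite ?yS /= ?andbF ?andbT ?orbF.
      by rewrite eq_sym (negPf zy).
    by case: (w \in S).
  have le2 : #|C| <= deg (twin e' S) (S :\ y) y.
    rewrite degE; apply/subset_leq_card/subsetP => z zC.
    have zy : z != y by apply: contraNneq yC => <-.
    rewrite !inE zy (CS _ zC) /= /twin N'y (N'N _ (CS _ zC) zy) (cluster_nbhd zC) (CN _ zC).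
    apply/eqP/setP => w; rewrite !inE andbT.
    case: (eqVneq w y) => [->|_]; first by rewrite yS exy orbT.
    by case: (w \in S); rewrite /= ?andbT ?orbF.
  have le3 : arcs (twin e S) (S :\ y) (S :\ y) <= arcs (twin e' S) (S :\ y) (S :\ y).
    apply: leq_arcs => u v; rewrite !in_setD1 => /andP[uy uS] /andP[vy vS] /eqP uv.
    apply/eqP; rewrite !N'N // uv.
    by rewrite (nbhdC sym xS uS) (nbhdC sym xS vS) uv.
  move: lt1 le2 le3; move: (#|C|) (deg _ _ _) (deg _ _ _) (arcs _ _ _) (arcs _ _ _).
  by clear; lia.
have pW : W \proper S by rewrite properEneq WS.
have potW := IH simple_e' Wc (proper_card pW).
have yW : y \in W.
  apply: contraT => yW; case/negP: (vcrit_ncolourable Wc).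
  apply: sub_colourable (vcrit_proper crit_S pW) => // u v uW vW.
  by rewrite e'N //; apply: contraNneq yW => <-.
have le1 : c <= deg e' (W :\ y) y by rewrite deg_setD1 //; apply: deg_vcrit Wc _.
have sNx : Nx \subset W :\ y.
  apply/setIidPl/eqP; rewrite eqEcard subsetIl Nx_c; apply: leq_trans le1 _.
  rewrite degE; apply/subset_leq_card/subsetP => z.
  by rewrite in_set in_setI e'y andbC.
have deg' : deg e' (W :\ y) y = c.
  apply/eqP; rewrite eqn_leq le1 andbT degE -Nx_c; apply/subset_leq_card/subsetP => z.
  by rewrite in_set e'y => /andP[].
(* In W the new y has degree c, so removing it turns the bound potmax into potmax - Kpot 1 + 2 * c *
   c, which is exactly Kpot c. *)
have [|||Rc Rcl] := pot_clique_proper c3 simple_e crit_S IH large_S (R := W :\ y).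
- by apply: sub_proper_trans pW; apply: subD1set.
- by apply: leq_trans (subset_leq_card sNx); rewrite Nx_c.
- move: potW; rewrite (@pot_setD1 _ c e' W y) // deg' (eq_pot c (e' := e)).
    by rewrite Kpot_c Kpot1E; move: (pot _ _ _) (potmax _); clear; lia.
  by move=> u v; rewrite !inE => /andP[uy _] /andP[vy _]; rewrite e'N.
exact: clique_sub Rcl.
Qed.

(** The K_c on [N x :\ y] has just two vertices u, u' outside the cluster C, and y is not adjacent
    to u. Delete C and y and let u inherit the other neighbours of y: a colouring would extend, with
    y coloured like u and C avoiding the colours of u and u'. Adding the clique y |: C to a critical
    W of this graph restores the inherited edges and gives potential at most Kpot c on more than c
    vertices. If the union is S, then W contains u' too, and the bound drops to potmax since c is at
    least 4. *)
Lemma large_cluster_neighbour x y : x \in S -> y \in S -> d x = c -> e x y ->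
  N x != N y -> clique e (N x :\ y) -> 1 < #|cl x| -> #|cl x| = c - 2 -> False.
Proof.
move=> xS yS dx exy nxy cX C1 Cc; pose C := cl x; pose X := N x :\ y.
have yx : y \in N x by apply: adj_nbhd.
have yC : y \notin C by rewrite inE yS /= eq_sym.
have CS z : z \in C -> z \in S by rewrite inE => /andP[].
have CN z : z \in C -> z \in N x by apply/subsetP/cluster_sub_nbhd.
have Cy z : z \in C -> z != y by move=> zC; apply: contraNneq yC => <-.
have CX : C \subset X by apply/subsetP => z zC; rewrite in_setD1 Cy ?CN.
have Xc : #|X| = c.
  by have := cardsD1 y (N x); rewrite yx card_nbhd // dx add1n => -[].
have sXS : X \subset S by apply: subset_trans (subD1set _ _) (nbhd_sub e S x).
have : #|X :\: C| == 2.
  rewrite cardsD (setIidPr CX) Xc -/C /C Cc; apply/eqP.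
  by move: c1; clear; lia.
case/cards2P => u [u' [nu UE]].
have uX : u \in X :\: C by rewrite UE !inE eqxx.
have u'X : u' \in X :\: C by rewrite UE !inE eqxx orbT.
have XU z : z \in X -> z \notin C -> z = u \/ z = u'.
  move=> zX zC; have : z \in X :\: C by rewrite in_setD zC.
  by rewrite UE => /set2P.
have [uS u'S] : u \in S /\ u' \in S.
  by split; apply: (subsetP sXS); [move: uX|move: u'X]; rewrite in_setD => /andP[].
have uC : u \notin C by move: uX; rewrite in_setD => /andP[].
have u'C : u' \notin C by move: u'X; rewrite in_setD => /andP[].
have uy : u != y by move: uX; rewrite in_setD in_setD1 => /and3P[].
have u'y : u' != y by move: u'X; rewrite in_setD in_setD1 => /and3P[].
have Xadj z w : z \in C -> w \in N x -> w != z -> e z w by apply: cluster_adj.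
have neyu : ~~ e y u.
  apply/negP => eyu; have yX : y \notin X by rewrite !inE eqxx.
  have := no_near_clique sXS cX Xc yS yX; rewrite ltnNge => /negP[].
  apply: leq_trans (_ : #|u |: C| <= _).
    by rewrite cardsU1 uC /C Cc; move: c1; clear; lia.
  rewrite degE; apply/subset_leq_card/subsetP => z /setU1P[->|zC].
    by rewrite in_set eyu andbT; move: uX; rewrite in_setD => /andP[].
  by rewrite in_set (subsetP CX) //= sym Xadj // eq_sym Cy.
pose Ny := [set z in S :\: C | e y z].
pose e1 z w := e z w || (z == u) && (w \in Ny) || (w == u) && (z \in Ny).
have uNy : u \notin Ny by rewrite in_set (negPf neyu) andbF.
have simple_e1 : simple e1.
  split=> [z w|z]; rewrite /e1; first by rewrite sym orbAC.
  by rewrite irr orbb /=; case: eqP => // ->; rewrite (negPf uNy).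
have eE1 z w : e z w -> e1 z w by rewrite /e1 => ->.
pose S' := (S :\: C) :\ y.
have inS' z : z \in S -> z \notin C -> z != y -> z \in S'.
  by move=> zS zC zy; rewrite in_setD1 in_setD zy zC.
have ncol : ~~ colourable c e1 S'.
  apply: contra (vcrit_ncolourable crit_S) => /colourableP[f fP].
  have CA : #|C| <= #|~: [set f u; f u']|.
    have -> : #|~: [set f u; f u']| = c - #|[set f u; f u']|.
      by rewrite cardsCs setCK card_ord.
    by rewrite /C Cc leq_sub2l // cards2; case: eqP.
  have [h [hinj hA]] := inj_into c0 CA.
  have hu z : z \in C -> h z != f u /\ h z != f u'.
    by move/hA; rewrite !inE negb_or => /andP[].
  pose g z := if z == y then f u else if z \in C then h z else f z.
  have gy z : z \in S -> e y z -> g y != g z.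
    move=> zS eyz; have zy : z != y by apply: contraTneq eyz => ->; rewrite irr.
    rewrite /g eqxx (negPf zy); case: ifPn => zC; first by rewrite eq_sym; case: (hu z zC).
    apply: fP; rewrite ?inS' // /e1 eqxx.
    by rewrite [z \in Ny]in_set in_setD zC zS eyz orbT.
  have gC z w : z \in C -> w \in S -> w != y -> e z w -> g z != g w.
    move=> zC wS wy ezw; rewrite /g (negPf (Cy _ zC)) zC (negPf wy).
    case: ifPn => wC.
      apply/negP => /eqP/hinj zw; move: ezw; rewrite zw ?irr //.
    have wX : w \in X by rewrite in_setD1 wy -(cluster_nbhd zC) adj_nbhd.
    by case: (XU w wX wC) => ->; case: (hu z zC).
  apply/colourableP; exists g => z w zS wS ezw.
  have [zy|zy] := eqVneq z y; first by rewrite zy gy // -zy.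
  have [wy|wy] := eqVneq w y; first by rewrite wy eq_sym gy // -wy sym.
  have [zC|zC] := boolP (z \in C); first exact: gC.
  have [wC|wC] := boolP (w \in C); first by rewrite eq_sym gC // sym.
  by rewrite /g (negPf zy) (negPf zC) (negPf wy) (negPf wC) fP ?inS' ?eE1.
have [W sW Wc] := vcrit_exists ncol.
have sWS : W \subset S by apply: subset_trans sW (subset_trans (subD1set _ _) (subsetDl _ _)).
have WN z : z \in W -> z \notin C /\ z != y.
  by move/(subsetP sW); rewrite in_setD1 in_setD => /and3P[-> ->].
have pW : W \proper S.
  by rewrite properE sWS; apply/subsetPn; exists y => //; apply/negP => /WN[]; rewrite eqxx.
have cW := ncolourable_card c0 simple_e1.2 (vcrit_ncolourable Wc).
have potW := IH simple_e1 Wc (proper_card pW).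
have uW : u \in W.
  apply: contraT => uW; case/negP: (vcrit_ncolourable Wc).
  apply: sub_colourable (vcrit_proper crit_S pW) => // z w zW wW.
  have nz : z != u by apply: contraNneq uW => <-.
  have nw : w != u by apply: contraNneq uW => <-.
  by rewrite /e1 (negPf nz) (negPf nw) !orbF.
pose n := deg e W y.
have arcsW : arcs e1 W W <= arcs e W W + 2 * n.
  have splitW e0 : simple e0 ->
      arcs e0 W W = arcs e0 (W :\ u) (W :\ u) + 2 * deg e0 (W :\ u) u.
    by move=> simple_e0; rewrite -{1 2}(setD1K uW) arcs_setU1 // !inE eqxx.
  rewrite !splitW // -addnA -mulnDr.
  have -> : arcs e1 (W :\ u) (W :\ u) = arcs e (W :\ u) (W :\ u).
    apply: eq_arcs => z w; rewrite !in_setD1 => /andP[/negPf zu _] /andP[/negPf wu _].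
    by rewrite /e1 zu wu !orbF.
  rewrite leq_add2l leq_mul2l /= !deg_setD1 //; last exact: simple_e1.2.
  rewrite /n !degE.
  apply: leq_trans (leq_card_setU _ _); apply/subset_leq_card/subsetP => z.
  rewrite in_setU !in_set /e1 eqxx (negPf uNy) andbF orbF /= => /andP[-> /orP[->//|]].
  by rewrite in_set => /andP[_ ->]; rewrite orbT.
pose Q := y |: C.
have Qclique : clique e Q.
  apply/cliqueP => z w /setU1P[->|zC] /setU1P[->|wC]; rewrite ?eqxx // => nzw.
  - by rewrite sym; apply: Xadj.
  - by apply: Xadj; rewrite // eq_sym.
  - by apply: Xadj; rewrite ?CN // eq_sym.
have Qc : #|Q| = c.-1 by rewrite cardsU1 yC /C Cc; move: c1; clear; lia.
have dWQ : [disjoint W & Q].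
  apply/pred0Pn => -[z /andP[/= /WN[zC zy]]].
  by rewrite in_setU1 (negPf zC) (negPf zy).
pose j := #|(X :\: C) :&: W|.
have arcsQ : n + (c - 2) * j <= arcs e W Q.
  rewrite arcsC // arcsUl ?disjoints1 // arcs1l leq_add2l -Cc -/C -sum_nat_const.
  rewrite arcsE; apply: leq_sum => z zC; rewrite degE; apply/subset_leq_card/subsetP => w.
  rewrite in_setI in_setD => /andP[/andP[wC wX] wW]; rewrite in_set wW Xadj //.
    by move: wX; rewrite in_setD1 => /andP[].
  by apply: contraNneq wC => ->.
have j1 : 0 < j by rewrite card_gt0; apply/set0Pn; exists u; rewrite in_setI uX.
have potR : (pot c e (W :|: Q) <= potmax c + Kpot c c.-1 - 2 * c%:Z * (c%:Z - 2) * j%:Z)%R.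
  rewrite pot_setU // (pot_clique c irr Qclique) Qc.
  have h1 : (c%:Z * (arcs e1 W W)%:Z <= c%:Z * (arcs e W W + 2 * n)%N%:Z)%R.
    by apply: ler_wpM2l.
  have h2 : (c%:Z * (n + (c - 2) * j)%N%:Z <= c%:Z * (arcs e W Q)%:Z)%R.
    by apply: ler_wpM2l.
  have c2 : ((c - 2)%N%:Z = c%:Z - 2)%R by move: c1; clear; lia.
  move: h1 h2 potW; rewrite /pot !PoszD !PoszM c2.
  move: (arcs e1 W W) (arcs e W W) (arcs e W Q) (Kpot c c.-1) (potmax c) (#|W|) => n1 n2 n3 k M n4.
  by clear; lia.
have Kpotc : (Kpot c c.-1 = (c%:Z - 1) * (3 * c%:Z - 2))%R.
  have -> : c.-1 = (c - 1)%N by rewrite subn1.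
  by rewrite /Kpot -subzn //; ring.
have sR : W :|: Q \subset S.
  by rewrite subUset sWS subUset sub1set yS; apply/subsetP.
have cR : c < #|W :|: Q| by apply: leq_trans cW _; apply/subset_leq_card/subsetUl.
have [RS|RS] := eqVneq (W :|: Q) S.
  have j2 : j = 2.
    rewrite /j (setIidPl _) UE ?cards2 ?nu //.
    apply/subsetP => z zU; have zX : z \in X :\: C by rewrite UE.
    move: zX; rewrite in_setD in_setD1 => /and3P[zC zy zN].
    have := subsetP (nbhd_sub e S x) _ zN; rewrite -RS in_setU in_setU1 (negPf zC) (negPf zy).
    by rewrite !orbF.
  have c4 : 3 < c by move: C1; rewrite Cc; clear; lia.
  by move: potR large_S; rewrite RS j2 Kpotc /potmax; move: (pot _ _ _) c4; clear; nia.
have [|||Rc _] := pot_clique_proper c3 simple_e crit_S IH large_S (R := W :|: Q).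
- by rewrite properEneq RS.
- exact: ltn_trans cR.
- apply: le_trans potR _; rewrite Kpotc Kpot_c /potmax; move: j1 c3; clear.
  move: j => j j1 c3; have : (0 <= c%:Z * (c%:Z - 2) * (j%:Z - 1))%R.
    by apply: mulr_ge0; [apply: mulr_ge0|]; lia.
  lia.
by rewrite Rc ltnn in cR.
Qed.

(** The second clique makes y adjacent to all but at most one vertex of the first, against
    [no_near_clique]. *)
Lemma two_near_cliques x y z : x \in S -> d x = c -> y \in N x -> z \in N x -> y != x ->
  z != x -> y != z -> clique e (N x :\ y) -> clique e (N x :\ z) -> False.
Proof.
move=> xS dx yN zN yx zx yz cy cz.
have yS := subsetP (nbhd_sub e S x) _ yN.
have Xc : #|N x :\ y| = c.
  by have := cardsD1 y (N x); rewrite yN card_nbhd // dx add1n => -[].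
have sX : N x :\ y \subset S by apply: subset_trans (subD1set _ _) (nbhd_sub e S x).
have yX : y \notin N x :\ y by rewrite !inE eqxx.
have := no_near_clique sX cy Xc yS yX; rewrite ltnNge => /negP[].
have -> : c.-1 = #|N x :\ y :\ z|.
  have := cardsD1 z (N x :\ y); rewrite Xc in_setD1 zN eq_sym yz add1n => -> //.
rewrite degE; apply/subset_leq_card/subsetP => w; rewrite !in_setD1 => /and3P[wz wy wN].
rewrite in_set in_setD1 wy wN /=.
by apply: (cliqueP _ _ cz); rewrite ?in_setD1 ?yz ?wz // eq_sym.
Qed.

(** [twin_switch] applies from the end u with the larger cluster and makes [N u :\ v] a clique. If v
    had another twin w, then w would lie in this clique, hence be a twin of u by [clique_low_twins],
    and so would v. *)
Lemma low_neighbour x y : x \in S -> y \in S -> d x = c -> d y = c -> e x y ->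
  N x != N y -> 1 < #|cl x| -> clique e (N x :\ y) /\ #|cl y| = 1.
Proof.
have key u v : u \in S -> v \in S -> d u = c -> d v = c -> e u v -> N u != N v ->
    clique e (N u :\ v) -> 1 < #|cl v| -> False.
  move=> uS vS du dv euv nuv cuv v1.
  have vN : v \in N u by apply: adj_nbhd.
  have uv : u != v by apply: contraNneq nuv => ->.
  have [w wC wv] : exists2 w, w \in cl v & w != v.
    have /card_gt1P[w1 [w2 [w1C w2C nw]]] := v1.
    by have [w1v|] := eqVneq w1 v; [exists w2; rewrite // -w1v eq_sym|exists w1].
  have wS : w \in S by move: wC; rewrite inE => /andP[].
  have wN : w \in N u.
    by rewrite (nbhdC sym uS wS) (cluster_nbhd wC) adj_nbhd // sym.
  have sX : N u :\ v \subset S by apply: subset_trans (subD1set _ _) (nbhd_sub e S u).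
  have Xc : #|N u :\ v| = c.
    by have := cardsD1 v (N u); rewrite vN card_nbhd // du add1n => -[].
  have dw : d w = c by rewrite (deg_nbhd irr wS vS (cluster_nbhd wC)).
  have := clique_low_twins sX cuv Xc (u := u) (v := w).
  rewrite !in_setD1 uv wv wN nbhd_self // => /(_ isT isT du dw) uw.
  by move: nuv; rewrite uw (cluster_nbhd wC) eqxx.
move=> xS yS dx dy exy nxy x1.
have yS1 : 0 < #|cl y| by apply/card_gt0P; exists y; apply: cluster_self.
have [lexy|ltxy] := leqP #|cl y| #|cl x|; last first.
  have : clique e (N y :\ x).
    apply: twin_switch => //; first by rewrite sym.
    - by rewrite eq_sym.
    - by rewrite dx -ltn_subLR // subnn.
    - by move=> _; apply: ltnW.
  move=> cyx; exfalso; apply: (key y x) => //; first by rewrite sym.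
  by rewrite eq_sym.
have cxy : clique e (N x :\ y).
  apply: twin_switch => //.
  by rewrite dy -ltn_subLR // subnn ltnW.
split=> //; apply/eqP; rewrite eqn_leq yS1 andbT leqNgt; apply/negP.
exact: key cxy.
Qed.

(** Otherwise at most two vertices of [N x] lie outside the cluster. Removing one of them, or x
    itself if there is none, leaves a K_c in which the removed vertex has at least c - 1
    neighbours. *)
Lemma cluster_small x : x \in S -> d x = c -> #|cl x| <= c - 2.
Proof.
move=> xS dx; rewrite leqNgt; apply/negP => lt.
have Nc : #|N x| = c.+1 by rewrite card_nbhd ?dx.
have sC : cl x \subset N x by apply: cluster_sub_nbhd.
have cardO := cardsD (N x) (cl x); rewrite (setIidPr sC) Nc in cardO.
have [z zN [zO degz]] : exists2 z, z \in N x &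
    #|(N x :\: cl x) :\ z| <= 1 /\ c.-1 <= deg e (N x :\ z) z.
  have [O0|[z zO]] := set_0Vmem (N x :\: cl x).
    exists x; rewrite ?nbhd_self // O0 set0D cards0; split=> //.
    have -> : deg e (N x :\ x) x = d x.
      rewrite !degE; apply: eq_card => w; rewrite !inE.
      case: eqVneq => [->|_] /=; first by rewrite irr !andbF.
      by case: (w \in S) => //=; case: (e x w).
    by rewrite dx leq_pred.
  have [zN zC] := setDP zO.
  exists z => //; split.
    have := cardsD1 z (N x :\: cl x); rewrite zO cardO.
    by move: lt; move: #|_| #|_| => n1 n2; move: c1; clear; lia.
  apply: leq_trans (_ : #|cl x| <= _); first by move: lt c1; clear; lia.
  rewrite degE; apply/subset_leq_card/subsetP => w wC.
  have wz : w != z by apply: contraNneq zC => <-.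
  by rewrite in_set in_setD1 wz (subsetP sC) //= sym (cluster_adj wC) // eq_sym.
have zS := subsetP (nbhd_sub e S x) _ zN.
have Xc : #|N x :\ z| = c by have := cardsD1 z (N x); rewrite zN Nc add1n => -[].
have sX : N x :\ z \subset S by apply: subset_trans (subD1set _ _) (nbhd_sub e S x).
have zX : z \notin N x :\ z by rewrite !inE eqxx.
have cX : clique e (N x :\ z).
  apply/cliqueP => u v; rewrite !in_setD1 => /andP[uz uN] /andP[vz vN] nuv.
  have [uC|uC] := boolP (u \in cl x); first by rewrite (cluster_adj uC) // eq_sym.
  have [vC|vC] := boolP (v \in cl x); first by rewrite sym (cluster_adj vC).
  move: zO; rewrite leqNgt => /negP[]; apply/card_gt1P; exists u, v.
  by rewrite !in_setD1 !in_setD uz vz uC vC.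
have := no_near_clique sX cX Xc zS zX.
by move: degz; clear; lia.
Qed.

(** For every outer neighbour u of degree below c + #|cl x| the set [N x :\ u] is a clique, by
    [twin_switch] or [low_neighbour], and [two_near_cliques] allows only one such u. If there is
    none, y is any outer neighbour. *)
Lemma cluster_exception x : x \in S -> d x = c -> 1 < #|cl x| ->
  exists y, [/\ y \in N x :\: cl x,
    forall u, u \in N x :\: cl x -> u != y -> c + #|cl x| <= d u &
    forall z, z \in N x :\: cl x -> d z = c -> z = y].
Proof.
move=> xS dx x1; pose O := N x :\: cl x.
have bad u : u \in O -> d u < c + #|cl x| -> clique e (N x :\ u).
  move=> uO ltu; have [uN uC] := setDP uO; have uS := subsetP (nbhd_sub e S x) _ uN.
  have nux : N x != N u by move: uC; rewrite inE uS /= eq_sym.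
  have exu : e x u by apply: nbhd_adj uN _; apply: contraNneq nux => ->.
  have [du|du] := eqVneq (d u) c; first by case: (low_neighbour xS uS dx du exu nux x1).
  by apply: twin_switch => // du'; rewrite du' eqxx in du.
have Ox u : u \in O -> u != x.
  by move=> /setDP[_ uC]; apply: contraNneq uC => ->; apply: cluster_self.
have low_bad z : z \in O -> d z = c -> d z < c + #|cl x|.
  by move=> _ ->; move: x1; clear; lia.
have uniq_bad u v : u \in O -> v \in O -> d u < c + #|cl x| -> d v < c + #|cl x| -> u = v.
  move=> uO vO bu bv; apply/eqP/contraT => nuv; exfalso.
  apply: (@two_near_cliques x u v) => //; rewrite ?Ox ?bad //.
    by case/setDP: uO.
  by case/setDP: vO.
have [/exists_inP[y yO by_]|/exists_inPn nobad] := boolP [exists y in O, d y < c + #|cl x|].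
  exists y; split=> // [u uO uy|z zO dz]; last by apply: uniq_bad => //; apply: low_bad.
  by rewrite leqNgt; apply: contraNN uy => bu; apply/eqP; apply: uniq_bad.
have /card_gt0P[y yO] : 0 < #|O|.
  rewrite cardsD (setIidPr (cluster_sub_nbhd sym xS)) card_nbhd // dx.
  by have := cluster_small xS dx; move: c1; clear; lia.
exists y; split=> // [u uO _|z zO dz]; first by rewrite leqNgt nobad.
by have := nobad _ zO; rewrite low_bad.
Qed.

(** * Vertices of degree c and c + 1, and the discharging *)

Let L := [set x in S | d x == c].
Let B := [set x in S | d x == c.+1].
Let H := [set x in S | c.+1 < d x].
Let L1 := [set x in L | #|cl x| == 1].
Let L2 := [set x in L | #|cl x| != 1].

Let LP x : x \in L -> x \in S /\ d x = c.
Proof. by rewrite inE => /andP[-> /eqP]. Qed.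

Let L1P x : x \in L1 -> [/\ x \in S, d x = c & #|cl x| = 1].
Proof. by rewrite inE => /andP[/LP[-> ->] /eqP]. Qed.

Let L2P x : x \in L2 -> [/\ x \in S, d x = c & 1 < #|cl x|].
Proof.
rewrite inE => /andP[/LP[xS ->] n1]; split=> //.
have : 0 < #|cl x| by apply/card_gt0P; exists x; apply: cluster_self.
by case: #|cl x| n1 => [|[]].
Qed.

Let single x y : x \in L1 -> y \in S -> N x = N y -> y = x.
Proof.
move=> /L1P[xS _ /eqP/cards1P[w clx]] yS xy.
have : y \in cl x by rewrite inE yS xy eqxx.
by have := cluster_self e xS; rewrite clx => /set1P-> /set1P.
Qed.

Let single_edge x y : x \in L1 -> y \in L1 -> e x y -> clique e (N x :\ y).
Proof.
move=> xL yL exy; have [xS dx sx] := L1P xL; have [yS dy sy] := L1P yL.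
apply: twin_switch => //; rewrite ?dy ?sx ?sy ?addn1 //.
apply: contraTneq exy => /(single xL yS) ->; by rewrite irr.
Qed.

Let single_edge_uniq x y z : x \in L1 -> y \in L1 -> z \in L1 -> e x y -> e x z -> y = z.
Proof.
move=> xL yL zL exy exz; have [xS dx _] := L1P xL; have [yS _ _] := L1P yL.
have [zS _ _] := L1P zL; apply/eqP/contraT => nyz; exfalso.
apply: (@two_near_cliques x y z); rewrite ?adj_nbhd ?single_edge //.
  by apply: contraTneq exy => ->; rewrite irr.
by apply: contraTneq exz => ->; rewrite irr.
Qed.

Let card_split (p : pred T) (A : {set T}) :
  #|A| = #|[set x in A | p x]| + #|[set x in A | ~~ p x]|.
Proof.
rewrite -(cardsID [set x | p x] A).
by congr (_ + _); apply: eq_card => x; rewrite !inE // andbC.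
Qed.

Let single_degree x : x \in L1 -> deg e L1 x <= 1.
Proof.
move=> xL; rewrite degE leqNgt; apply/negP => /card_gt1P[y [z [+ + nyz]]].
rewrite !in_set => /andP[yL exy] /andP[zL exz].
by move: nyz; rewrite (single_edge_uniq xL _ _ exy exz) ?eqxx // !in_set.
Qed.

Let BP b : b \in B -> b \in S /\ d b = c.+1.
Proof. by rewrite inE => /andP[-> /eqP]. Qed.

(** The sets [N x1 :\ y1] and [N x2 :\ y2] are copies of K_c through b. A third neighbour z of b in
    L1 lies in neither, as it has no twin, so both sit among the c + 1 vertices of [N b :\ z] and
    share at least c - 1 of them. Then x2 has c - 1 neighbours in the first, against
    [no_near_clique]. *)
Let crowded_degree b x1 x2 y1 y2 : b \in B -> x1 \in L1 -> x2 \in L1 -> y1 \in L1 -> y2 \in L1 ->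
  x1 != x2 -> e b x1 -> e b x2 -> e x1 y1 -> e x2 y2 -> deg e L1 b <= 2.
Proof.
move=> bB x1L x2L y1L y2L n12 eb1 eb2 e1 e2; rewrite leqNgt; apply/negP => lt.
have [bS db] := BP bB.
have [z zL [ebz z1 z2]] : exists2 z, z \in L1 & [/\ e b z, z != x1 & z != x2].
  have : 0 < #|[set y in L1 | e b y] :\: [set x1; x2]|.
    rewrite cardsD subn_gt0; apply: leq_ltn_trans (subset_leq_card (subsetIr _ _)) _.
    by rewrite cards2 n12 -degE.
  case/card_gt0P => z; rewrite in_setD in_set2 negb_or in_set => /andP[/andP[z1 z2] /andP[zL ebz]].
  by exists z.
have Xprop x y : x \in L1 -> y \in L1 -> e b x -> e x y ->
    [/\ clique e (N x :\ y), #|N x :\ y| = c, N x :\ y \subset S,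
        b \in N x :\ y &
        forall w, w \in L1 -> w != x -> w \notin N x :\ y].
  move=> xL yL ebx exy; have [xS dx _] := L1P xL; have [yS dy _] := L1P yL.
  have cX := single_edge xL yL exy.
  have xy : x != y by apply: contraTneq exy => ->; rewrite irr.
  have yN : y \in N x by apply: adj_nbhd.
  have Xc : #|N x :\ y| = c.
    by have := cardsD1 y (N x); rewrite yN card_nbhd // dx add1n => -[].
  have sX : N x :\ y \subset S by apply: subset_trans (subD1set _ _) (nbhd_sub e S x).
  have xX : x \in N x :\ y by rewrite in_setD1 xy nbhd_self.
  split=> //.
    have exb : e x b by rewrite sym.
    rewrite in_setD1 adj_nbhd // andbT.
    by apply: contra_eq_neq db => ->; rewrite dy; apply/eqP; move: c0; clear; lia.
  move=> w wL; apply: contraNN => wX; have [wS dw _] := L1P wL.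
  by apply/eqP; apply: (single xL wS); apply: (clique_low_twins sX cX Xc).
have [cX1 X1c sX1 bX1 X1N] := Xprop _ _ x1L y1L eb1 e1.
have [cX2 X2c sX2 bX2 X2N] := Xprop _ _ x2L y2L eb2 e2.
have [x2S _ _] := L1P x2L.
have x2X2 : x2 \in N x2 :\ y2.
  by rewrite in_setD1 nbhd_self // andbT; apply: contraTneq e2 => <-; rewrite irr.
have x2X1 : x2 \notin N x1 :\ y1 by apply: X1N; rewrite // eq_sym.
have zN : z \in N b by have [zS _ _] := L1P zL; apply: adj_nbhd.
have inNb X : clique e X -> X \subset S -> b \in X -> z \notin X -> X \subset N b :\ z.
  move=> /cliqueP cX sX bX zX; apply/subsetP => w wX.
  rewrite in_setD1 inE (subsetP sX) //= (contraNneq _ zX) => [|<- //].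
  by case: eqVneq => //= wb; apply: cX; rewrite // eq_sym.
have : #|(N x1 :\ y1) :|: (N x2 :\ y2)| <= c.+1.
  have <- : #|N b :\ z| = c.+1.
    by have := cardsD1 z (N b); rewrite zN card_nbhd // db add1n => -[].
  by apply: subset_leq_card; rewrite subUset !inNb ?X1N ?X2N.
have := cardsUI (N x1 :\ y1) (N x2 :\ y2).
rewrite X1c X2c => cardU leU.
have := no_near_clique sX1 cX1 X1c x2S x2X1; rewrite ltnNge => /negP[].
apply: leq_trans (_ : #|(N x1 :\ y1) :&: (N x2 :\ y2)| <= _).
  by move: cardU leU; move: #|_| #|_| => n1 n2; clear; lia.
rewrite degE; apply/subset_leq_card/subsetP => w; rewrite in_setI => /andP[wX1 wX2].
rewrite in_set wX1 /=; apply: (cliqueP _ _ cX2) => //.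
by apply: contraNneq x2X1 => ->.
Qed.

(* The edges inside [L1] form a matching; [arcs_critical_bipartite] is applied to each of
   the two independent sets obtained by dropping one end of every matching edge, and the
   two bounds are added. *)
Lemma single_arcs : arcs e L1 B + arcs e L1 L1 <= 2 * #|L1| + 2 * #|B|.
Proof.
pose isolated x := deg e L1 x == 0.
pose U := [set x in L1 | isolated x]; pose M := [set x in L1 | ~~ isolated x].
pose lower x := [exists y in L1, e x y && (enum_rank x < enum_rank y)].
pose M0 := [set x in M | lower x]; pose M1 := [set x in M | ~~ lower x].
(* In the sum of [k0] and [k1] the edges between U and B1 and the term 2 * #|B1| appear twice.
   Vertices of B1 have two neighbours in U, so the extra edges pay for the extra term. A vertex of
   B2 has at most two neighbours in L1, by [crowded_degree] if two or more lie in M. *)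
pose B1 := [set b in B | 1 < deg e U b]; pose B2 := [set b in B | ~~ (1 < deg e U b)].
have UL x : x \in U -> x \in L1 by rewrite inE => /andP[].
have ML x : x \in M -> x \in L1 by rewrite inE => /andP[].
have BS b : b \in B -> b \in S by case/BP.
have disUM (Q : {set T}) : Q \subset M -> [disjoint U & Q].
  move=> sQ; apply/pred0Pn => -[x /andP[/= xU xQ]].
  have := subsetP sQ _ xQ; rewrite in_set => /andP[_ /negP[]].
  by move: xU; rewrite in_set => /andP[].
have Uisolated x y : x \in U -> y \in L1 -> ~~ e x y.
  rewrite in_set => /andP[_]; rewrite /isolated degE cards_eq0 => /eqP/setP/(_ y).
  by rewrite in_set in_set0 => h yL; rewrite yL /= in h; rewrite h.
have kernel (Q : {set T}) : Q \subset M -> {in Q &, forall x y, ~~ e x y} ->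
    arcs e U B1 + arcs e Q B1 <= #|U| + #|Q| + 2 * #|B1|.
  move=> sQ indQ; rewrite -arcsUl ?disUM //.
  have -> : #|U| + #|Q| = #|U :|: Q|.
    by rewrite cardsU (disjoint_setI0 (disUM _ sQ)) cards0 subn0.
  have UQL x : x \in U :|: Q -> x \in L1.
    by rewrite in_setU => /orP[/UL//|/(subsetP sQ)/ML].
  have B1B b : b \in B1 -> b \in B by rewrite inE => /andP[].
  apply: (arcs_critical_bipartite c0 simple_e crit_S).
  - by apply/subsetP => x /UQL/L1P[].
  - by apply/subsetP => x /B1B/BS.
  - apply/pred0Pn => -[x /andP[/= /UQL/L1P[_ dx _] /B1B/BP[_]]].
    by rewrite dx => /eqP; rewrite eqn_leq ltnn andbF.
  - move=> x y; rewrite [x \in _]in_setU => /orP[xU|xQ] yUQ.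
      by apply: Uisolated (UQL _ yUQ).
    move: yUQ; rewrite in_setU => /orP[yU|yQ]; last exact: indQ.
    by rewrite sym Uisolated // ML // (subsetP sQ).
  - by move=> x /UQL/L1P[].
  - by move=> x /B1B/BP[].
have k0 : arcs e U B1 + arcs e M0 B1 <= #|U| + #|M0| + 2 * #|B1|.
  apply: kernel; first by apply/subsetP => x; rewrite in_set => /andP[].
  have M0P x : x \in M0 -> x \in L1 /\ lower x by rewrite in_set => /andP[/ML ? ?].
  move=> x y /M0P[xL /exists_inP[x' x'L /andP[ex ltx]]].
  move=> /M0P[yL /exists_inP[y' y'L /andP[ey lty]]]; apply/negP => exy.
  rewrite (single_edge_uniq xL x'L yL ex exy) in ltx.
  have eyx : e y x by rewrite sym.
  by rewrite (single_edge_uniq yL y'L xL ey eyx) ltnNge (ltnW ltx) in lty.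
have k1 : arcs e U B1 + arcs e M1 B1 <= #|U| + #|M1| + 2 * #|B1|.
  apply: kernel; first by apply/subsetP => x; rewrite in_set => /andP[].
  have M1P x : x \in M1 -> x \in L1 /\ ~~ lower x by rewrite in_set => /andP[/ML ? ?].
  move=> x y /M1P[xL /exists_inPn lx] /M1P[yL /exists_inPn ly]; apply/negP => exy.
  have := lx y yL; rewrite exy -leqNgt => le1.
  have := ly x xL; rewrite sym exy -leqNgt => le2.
  have xy : x = y by apply/enum_rank_inj/val_inj/eqP; rewrite eqn_leq le2 le1.
  by rewrite xy irr in exy.
have cardL := card_split isolated L1; have cardM := card_split lower M.
have cardB := card_split (fun b => 1 < deg e U b) B.
have arcsLL : arcs e L1 L1 <= #|M|.
  rewrite (arcs_split e isolated) -/U -/M.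
  have -> : arcs e U L1 = 0.
    rewrite arcsE big1 // => x xU; rewrite degE; apply/eqP; rewrite cards_eq0.
    apply/eqP/setP => y; rewrite in_set in_set0; apply/negP => /andP[yL].
    by apply/negP/Uisolated.
  by rewrite add0n arcsE -sum1_card; apply: leq_sum => x /ML/single_degree.
have arcsM : arcs e M B1 = arcs e M0 B1 + arcs e M1 B1 by rewrite (arcs_split e lower).
have arcsL1 : arcs e L1 B1 = arcs e U B1 + arcs e M B1 by rewrite (arcs_split e isolated).
have arcsLB : arcs e L1 B = arcs e L1 B1 + arcs e L1 B2.
  by rewrite !(arcsC L1) // (arcs_split e (fun b => 1 < deg e U b)).
have arcsUB1 : 2 * #|B1| <= arcs e U B1.
  rewrite arcsC // arcsE mulnC -sum_nat_const; apply: leq_sum => b.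
  by rewrite in_set => /andP[].
have arcsLB2 : arcs e L1 B2 <= 2 * #|B2|.
  rewrite arcsC // arcsE mulnC -sum_nat_const; apply: leq_sum => b.
  rewrite in_set => /andP[bB]; rewrite -leqNgt => degU.
  have [degM|degM] := leqP (deg e M b) 1.
    have -> : deg e L1 b = deg e U b + deg e M b.
      by rewrite -!arcs1l !(arcsC [set b]) // (arcs_split e isolated).
    by rewrite -[2]/(1 + 1) leq_add.
  rewrite degE in degM; have /card_gt1P[x1 [x2 [+ + n12]]] := degM.
  rewrite in_set => /andP[x1M eb1]; rewrite in_set => /andP[x2M eb2].
  have partner x : x \in M -> exists2 y, y \in L1 & e x y.
    rewrite in_set => /andP[_]; rewrite /isolated degE cards_eq0 => /set0Pn[y].
    by rewrite in_set => /andP[yL exy]; exists y.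
  have [y1 y1L e1] := partner _ x1M; have [y2 y2L e2] := partner _ x2M.
  by apply: (crowded_degree bB (ML _ x1M) (ML _ x2M) y1L y2L).
move: k0 k1 cardL cardM cardB arcsLL arcsM arcsL1 arcsLB arcsUB1 arcsLB2.
rewrite -/U -/M -/M0 -/M1 -/B1 -/B2.
move: (arcs e L1 B) (arcs e L1 L1) (arcs e L1 B1) (arcs e L1 B2) (arcs e U B1).
move: (arcs e M B1) (arcs e M0 B1) (arcs e M1 B1) (#|L1|) (#|B|) (#|U|) (#|M|).
move: (#|M0|) (#|M1|) (#|B1|) (#|B2|).
by clear; lia.
Qed.

(* Discharging: [surplus v] is [c] times the excess of the degree of [v] over the target
   average c + 1 - 2/c = k - 2/(k-1), and a vertex of degree at least [c + 2] divides it
   evenly among its neighbours of degree [c]. *)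
Let surplus v := c * (d v - c.+1) + 2.

Let charge v : rat := ((surplus v)%:R / (deg e L v)%:R)%R.

Let charge_ge v p q : 0 < deg e L v -> 0 < q ->
  p * deg e L v <= surplus v * q -> (p%:R / q%:R <= charge v)%R.
Proof.
move=> degv q0 le; rewrite /charge ler_pdivrMr ?ltr0n // mulrAC ler_pdivlMr ?ltr0n //.
by rewrite -!natrM ler_nat.
Qed.

Let received x : rat := (\sum_(v in H) (e x v)%:R * charge v)%R.

Let received_ge x (Q : {set T}) (r : rat) : Q \subset H -> {in Q, forall v, e x v} ->
  {in Q, forall v, (r <= charge v)%R} -> (#|Q|%:R * r <= received x)%R.
Proof.
move=> sQ eQ rQ; rewrite /received (big_setID Q) /= (setIidPr sQ).
have charge0 v : (0 <= charge v)%R by rewrite /charge divr_ge0 ?ler0n.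
apply: (@le_trans _ _ (\sum_(v in Q) (e x v)%:R * charge v)%R); last first.
  by rewrite lerDl; apply: sumr_ge0 => v _; rewrite mulr_ge0 ?ler0n.
rewrite -sum1_card natr_sum mulr_suml; apply: ler_sum => v vQ.
by rewrite eQ // !mul1r rQ.
Qed.

Let low_degree x v : x \in L -> e x v -> 0 < deg e L v.
Proof.
move=> xL exv; rewrite degE card_gt0; apply/set0Pn; exists x.
by rewrite in_set xL sym.
Qed.

(** A vertex of degree D >= c + 2 has surplus at least D, so each of its shares is at least 1. *)
Let received_single x : x \in L1 -> ((deg e H x)%:R <= received x)%R.
Proof.
move=> xL; have xLL : x \in L by move: xL; rewrite in_set => /andP[].
rewrite -[leLHS]mulr1 degE; apply: received_ge => [|v|v].
- by apply/subsetP => v; rewrite in_set => /andP[].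
- by rewrite in_set => /andP[].
rewrite in_set => /andP[vH exv]; have := @charge_ge v 1 1 (low_degree xLL exv) isT.
rewrite divr1; apply; rewrite mul1n muln1.
have [vS dv] : v \in S /\ c.+1 < d v by move: vH; rewrite in_set => /andP[].
apply: leq_trans (_ : d v <= _).
  by apply: deg_sub; apply/subsetP => w /LP[].
rewrite /surplus; have [i ->] : exists i, d v = c.+2 + i.
  by exists (d v - c.+2); rewrite subnKC.
by move: c3; clear; nia.
Qed.

(** The term [deg e L1 x], at most 1, is what x can pass on to a neighbour in L1. The neighbours of
    large degree given by [cluster_exception] supply c - 2. A neighbour in L1 must be the exception
    y, and the clique [N x :\ y] then enlarges the shares. *)
Let received_cluster x : x \in L2 -> ((c - 2 + deg e L1 x)%:R <= received x)%R.
Proof.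
move=> xL; have [xS dx x1] := L2P xL.
have xLL : x \in L by move: xL; rewrite in_set => /andP[].
have [y [yO good low]] := cluster_exception xS dx x1.
pose O := N x :\: cl x; pose t := #|cl x|; pose Q := O :\ y.
have Ox u : u \in O -> [/\ u \in S, N x != N u & e x u].
  case/setDP=> uN uC; have uS := subsetP (nbhd_sub e S x) _ uN.
  have nxu : N x != N u by move: uC; rewrite inE uS /= eq_sym.
  by split=> //; apply: nbhd_adj uN _; apply: contraNneq nxu => ->.
have cardO : #|O| = c.+1 - t.
  by rewrite cardsD (setIidPr (cluster_sub_nbhd sym xS)) card_nbhd ?dx.
have tc : t <= c - 2 := cluster_small xS dx.
have cardQ : #|Q| = c - t.
  have := cardsD1 y O; rewrite yO cardO add1n.
  by move: tc c1; move: (#|O :\ y|); clear; lia.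
have Qgood u : u \in Q -> c + t <= d u by rewrite in_setD1 => /andP[uy uO]; apply: good.
have QO u : u \in Q -> u \in O by rewrite in_setD1 => /andP[].
have QH : Q \subset H.
  apply/subsetP => u uQ; have [uS _ _] := Ox u (QO u uQ); rewrite in_set uS /=.
  by apply: leq_trans (Qgood u uQ); move: x1; rewrite -/t; clear; lia.
have Qe : {in Q, forall u, e x u} by move=> u /QO/Ox[].
have L1O z : z \in L1 -> e x z -> z \in O.
  move=> zL exz; have [zS dz sz] := L1P zL.
  rewrite in_setD adj_nbhd // andbT; apply/negP => zC.
  by move: x1; rewrite -(cluster_eq zC) sz.
have degL1 : deg e L1 x <= 1.
  rewrite degE leqNgt; apply/negP => /card_gt1P[u [v [+ + nuv]]].
  rewrite 2!(in_set (fun y0 => (y0 \in L1) && e x y0)) => /andP[uL eu] /andP[vL ev].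
  have [_ du _] := L1P uL; have [_ dv _] := L1P vL.
  have uy := low u (L1O u uL eu) du; have vy := low v (L1O v vL ev) dv.
  by rewrite uy vy eqxx in nuv.
have ge r k : (k%:R <= (c - t)%:R * r)%R -> {in Q, forall v, (r <= charge v)%R} ->
    (k%:R <= received x)%R.
  by move=> le rQ; apply: le_trans le _; rewrite -cardQ; apply: received_ge.
have [deg0|deg1] := posnP (deg e L1 x).
  rewrite deg0 addn0; apply: (ge ((c * (t - 1) + 2)%:R / (c + t)%:R)%R).
    rewrite mulrA ler_pdivlMr ?ltr0n ?addn_gt0 ?c0 // -!natrM ler_nat.
    exact: cluster_arith.
  move=> u uQ; apply: charge_ge; rewrite ?addn_gt0 ?c0 ?(low_degree xLL) ?Qe //.
  have degu : deg e L u <= d u by apply: deg_sub; apply/subsetP => w /LP[].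
  exact: charge_arith c0 x1 (Qgood u uQ) degu.
have yL : y \in L1.
  move: deg1; rewrite degE card_gt0 => /set0Pn[z]; rewrite in_set => /andP[zL exz].
  have [_ dz _] := L1P zL; by rewrite -(low z) // L1O.
have [yS nxy exy] := Ox y yO; have [_ dy _] := L1P yL.
have [cX _] := low_neighbour xS yS dx dy exy nxy x1.
have tc3 : t < c - 2.
  rewrite ltn_neqAle tc andbT; apply/eqP => tE.
  exact: (large_cluster_neighbour xS yS dx exy nxy cX x1 tE).
have yN : y \in N x by apply: adj_nbhd.
have Xc : #|N x :\ y| = c.
  by have := cardsD1 y (N x); rewrite yN card_nbhd // dx add1n => -[].
have sX : N x :\ y \subset S by apply: subset_trans (subD1set _ _) (nbhd_sub e S x).
have QX u : u \in Q -> u \in N x :\ y by rewrite !in_setD1 => /andP[-> /setDP[]].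
(* Each u in Q has c - t - 1 neighbours in Q, none of degree c, and divides its surplus among that
   many fewer. At degree c + t this leaves at most 2 * t + 1 recipients. *)
apply: (ge ((c * (t - 1) + 2)%:R / (2 * t + 1)%:R)%R).
  rewrite mulrA ler_pdivlMr ?ltr0n ?addn1 // -!natrM ler_nat.
  apply: leq_trans (_ : (c - 1) * (2 * t).+1 <= _).
    by rewrite leq_mul2r; move: degL1 c1; clear; lia.
  exact: cluster_arith_tight.
move=> u uQ; apply: charge_ge; rewrite ?addn1 ?(low_degree xLL) ?Qe //.
have degu : deg e L u + (c - t - 1) <= d u.
  have sL : L \subset S by apply/subsetP => w /LP[].
  rewrite {2}/deg (big_setID L) /= (setIidPr sL) leq_add2l.
  rewrite -/(deg e (S :\: L) u) degE.
  have -> : c - t - 1 = #|Q :\ u|.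
    by have := cardsD1 u Q; rewrite uQ cardQ => ->; rewrite add1n subn1.
  apply/subset_leq_card/subsetP => w; rewrite in_setD1 => /andP[wu wQ].
  have [wS _ _] := Ox w (QO w wQ); rewrite in_set in_setD wS andbT.
  apply/andP; split.
    apply/negP => /LP[_ dw]; have := Qgood w wQ; rewrite dw.
    by move: x1; rewrite -/t; clear; lia.
  by apply: (cliqueP _ _ cX); rewrite ?QX // eq_sym.
exact: charge_arith_tight (Qgood u uQ) degu.
Qed.

Let total_received :
  (\sum_(x in L) received x <= (\sum_(v in H) surplus v)%:R)%R.
Proof.
rewrite /received exchange_big /= natr_sum; apply: ler_sum => v vH.
rewrite -mulr_suml.
have -> : (\sum_(x in L) (e x v)%:R = (deg e L v)%:R :> rat)%R.
  by rewrite /deg natr_sum; apply: eq_bigr => x _; rewrite sym.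
rewrite /charge; have [->|l0] := posnP (deg e L v); first by rewrite mul0r ler0n.
by rewrite mulrCA divff ?mulr1 // pnatr_eq0 -lt0n.
Qed.

Lemma no_minimal_counterexample : False.
Proof.
have surplus_ge : arcs e L1 H + (c - 2) * #|L2| + arcs e L2 L1 <= \sum_(v in H) surplus v.
  rewrite -(ler_nat rat); apply: le_trans total_received.
  have disL : [disjoint L1 & L2].
    by apply/pred0Pn => -[x /andP[/= /L1P[_ _ s1] /L2P[_ _]]]; rewrite s1.
  have LE : L = L1 :|: L2.
    by apply/setP => x; rewrite in_setU /L1 /L2 !in_set -andb_orr orbN andbT.
  have -> : (\sum_(x in L) received x = \sum_(x in L1) received x + \sum_(x in L2) received x)%R.
    by rewrite LE -bigU //; apply: eq_bigl => x; rewrite in_setU.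
  rewrite -addnA natrD; apply: lerD.
    by rewrite arcsE natr_sum; apply: ler_sum => x; apply: received_single.
  rewrite mulnC -sum_nat_const arcsE -big_split natr_sum /=.
  by apply: ler_sum => x; apply: received_cluster.
have Lsplit := card_split (fun x => #|cl x| == 1) L; rewrite -/L1 -/L2 in Lsplit.
have sL : L \subset S by apply/subsetP => w /LP[].
have BLH : S :\: L = B :|: H.
  apply/setP => x; rewrite in_setD in_setU /L /B /H !in_set.
  have [xS|] := boolP (x \in S); last by rewrite !andbF.
  by have := deg_ge xS; rewrite !andbT /=; move: (d x) => n; clear; lia.
have disBH : [disjoint B & H].
  apply/pred0Pn => -[x /andP[/= /BP[_ dx]]]; by rewrite in_set dx ltnn andbF.
have cardS : #|S| = #|L| + #|B| + #|H|.
  rewrite -(cardsID L S) (setIidPr sL) BLH cardsU (disjoint_setI0 disBH) cards0 subn0.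
  by rewrite addnA.
have arcsS A : arcs e A S = arcs e A L1 + arcs e A L2 + arcs e A B + arcs e A H.
  have -> : arcs e A S = arcs e A L + arcs e A (S :\: L).
    rewrite -arcsUr; last by rewrite disjoint_sym disjoints_subset subsetDr.
    by rewrite -{1}(setID S L) (setIidPr sL).
  rewrite BLH arcsUr // addnA; congr (_ + _ + _).
  by rewrite ![arcs e A _](arcsC _ _ sym) (arcs_split e (fun x => #|cl x| == 1)).
have arcsL1 : arcs e L1 S = c * #|L1|.
  by rewrite arcsE mulnC -sum_nat_const; apply: eq_bigr => x /L1P[].
have degS : arcs e S S = c * #|L| + c.+1 * #|B| + \sum_(v in H) d v.
  rewrite arcsE (big_setID L) /= (setIidPr sL) BLH sum_disjU // addnA.
  congr (_ + _ + _); rewrite mulnC -sum_nat_const; apply: eq_bigr => x.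
    by case/LP.
  by case/BP.
have surplusE : \sum_(v in H) surplus v + c * c.+1 * #|H| = c * (\sum_(v in H) d v) + 2 * #|H|.
  rewrite [c * c.+1 * _]mulnC [2 * _]mulnC -!sum_nat_const big_distrr -!big_split /=.
  apply: eq_bigr => v; rewrite in_set => /andP[_ dv]; rewrite /surplus.
  have [i ->] : exists i, d v = c.+1 + i by exists (d v - c.+1); rewrite subnKC // ltnW.
  by rewrite addKn; clear; lia.
(* On the scale of [surplus] a vertex of degree c lacks c - 2 and one of degree c + 1 has 2 to
   spare. By [surplus_ge] the vertices of L2 are paid in full, with one unit left per edge to L1.
   These units and the edges from L1 to H number at least (c - 2) * #|L1| - 2 * #|B| by
   [single_arcs], so the degree sum is too large for [large_S]. *)
have := large_S; have := single_arcs; have := arcsS L1; have := arcsC L1 L2 sym.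
rewrite arcsL1 /pot degS cardS /potmax.
move: surplus_ge Lsplit surplusE c3.
move: (arcs e L1 L1) (arcs e L1 L2) (arcs e L2 L1) (arcs e L1 B) (arcs e L1 H).
move: (#|L1|) (#|L2|) (#|L|) (#|B|) (#|H|) (\sum_(v in H) surplus v) (\sum_(v in H) d v).
by clear=> n1 n2 n3 n4 n5 n6 n7 a1 a2 a3 a4 a5; nia.
Qed.

End MinimalCounterexample.

Theorem pot_vcrit c (T : finType) (e : rel T) (S : {set T}) : 2 < c -> simple e ->
  vcrit c e S -> (pot c e S <= potmax c)%R.
Proof.
move=> c3; have [n] := ubnP #|S|; elim: n => // n IHn in e S *; rewrite ltnS => leS.
(* Lexicographic measure: fewest edges first, then most twin pairs. *)
pose N := (#|S| * #|S|).+1.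
have [m] := ubnP (arcs e S S * N + (N - arcs (twin e S) S S)).
elim: m => // m IHm in e *; rewrite ltnS => lem simple_e crit_S.
have twinN e' : arcs (twin e' S) S S < N.
  by rewrite ltnS arcsE -sum_nat_const; apply: leq_sum => x _; apply: deg_le.
rewrite leNgt; apply/negP => large_S.
have min e' : simple e' -> vcrit c e' S -> (potmax c < pot c e' S)%R ->
    m <= arcs e' S S * N + (N - arcs (twin e' S) S S).
  move=> simple_e' crit' large'; rewrite leqNgt; apply/negP => lt.
  by have := IHm e' lt simple_e' crit'; rewrite leNgt large'.
apply: (no_minimal_counterexample c3 simple_e crit_S) => //.
- by move=> e' W simple_e' crit_W ltW; apply: IHn => //; apply: leq_trans leS.
- move=> e' simple_e' crit' large'; have := leq_trans lem (min e' simple_e' crit' large').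
  move=> le; rewrite leqNgt; apply/negP => lt; move: le; apply/negP; rewrite -ltnNge.
  have := leq_mul lt (leqnn N); rewrite mulSn.
  move: (twinN e) (twinN e'); move: (arcs _ S S * N) (arcs _ S S * N) => a1 a2.
  by move: (arcs _ S S) (arcs _ S S) => t1 t2; clear; lia.
- move=> e' simple_e' crit' large' arcsE'.
  have := leq_trans lem (min e' simple_e' crit' large'); rewrite arcsE' leq_add2l.
  by move: (twinN e) (twinN e'); clear; lia.
Qed.

(** * Joins and Hajos sums *)

Section EdgeDeletion.

Variable T : finType.
Implicit Types (e : rel T) (x y u v : T).

Definition del_edge e x y : rel T :=
  fun u v => e u v && ~~ ((u == x) && (v == y) || (u == y) && (v == x)).

Lemma simple_del_edge e x y : simple e -> simple (del_edge e x y).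
Proof.
move=> [sym irr]; split=> [u v|u]; rewrite /del_edge ?irr // sym.
by rewrite [(u == x) && _]andbC [(u == y) && _]andbC orbC.
Qed.

Lemma arcs_del_edge e x y : simple e -> e x y ->
  arcs e setT setT = (arcs (del_edge e x y) setT setT).+2.
Proof.
move=> [sym irr] exy; have nxy : x != y by apply: contraTneq exy => ->; rewrite irr.
rewrite !arcs_card.
have -> : [set p | [&& p.1 \in [set: T], p.2 \in [set: T] & e p.1 p.2]] =
  [set p | [&& p.1 \in [set: T], p.2 \in [set: T] & del_edge e x y p.1 p.2]]
  :|: [set (x, y); (y, x)].
  apply/setP => -[u v]; rewrite !inE /= /del_edge !xpair_eqE.
  case: (boolP ((u == x) && (v == y) || (u == y) && (v == x))) => [xy|_]; last first.
    by rewrite andbT orbF.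
  by rewrite andbF; case/orP: xy => /andP[/eqP-> /eqP->]; rewrite // sym.
rewrite cardsU (disjoint_setI0 _) ?cards0 ?subn0.
  by rewrite cards2 xpair_eqE negb_and nxy addn2.
apply/pred0Pn => -[[u v] /andP[]] /=; rewrite !inE /del_edge !xpair_eqE /= => /andP[_ /negPf->] //.
Qed.

(** Every proper subgraph misses a vertex or an edge, so single deletions decide criticality. *)
Definition critical_rel c e :=
  [/\ ~~ colourable c e setT, forall v, colourable c e (setT :\ v) &
      forall x y, e x y -> colourable c (del_edge e x y) setT].

Lemma critical_subrel c e : simple e -> vcrit c e setT ->
  exists e', [/\ simple e', critical_rel c e' & arcs e' setT setT <= arcs e setT setT].
Proof.
have [n] := ubnP (arcs e setT setT); elim: n => // n IHn in e *; rewrite ltnS => le simple_e crit.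
have colv v : colourable c e (setT :\ v).
  by case/andP: crit => _ /forall_inP; apply; rewrite inE.
have [/existsP[x /existsP[y /andP[exy nxy]]]|none] :=
  boolP [exists x, exists y, e x y && ~~ colourable c (del_edge e x y) setT].
  have del_e u v : del_edge e x y u v -> e u v by case/andP.
  have arcsE := arcs_del_edge simple_e exy.
  have [|||e' [simple_e' crit' le']] := IHn (del_edge e x y).
  - by move: le; rewrite arcsE; apply: leq_trans.
  - exact: simple_del_edge.
  - rewrite /vcrit nxy; apply/forall_inP => v _.
    by apply: sub_colourable (colv v) => // u w _ _; apply: del_e.
  by exists e'; split=> //; apply: leq_trans le' _; rewrite arcsE; apply: leqW.
exists e; split=> //; split=> //; first exact: vcrit_ncolourable.
move=> x y exy; move/existsPn/(_ x): none => /existsPn/(_ y).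
by rewrite exy negbK.
Qed.

Lemma critical_edge_colouring c e x y : symmetric e -> critical_rel c e -> e x y ->
  exists2 f : T -> 'I_c, f x = f y & forall u v, del_edge e x y u v -> f u != f v.
Proof.
move=> sym [ncol _ /(_ x y)] + exy => /(_ exy) /colourableP[f fP].
have fP' u v : del_edge e x y u v -> f u != f v by move=> euv; apply: fP; rewrite ?inE.
exists f => //; apply/eqP; apply: contraNT ncol => nf; apply/colourableP.
exists f => u v _ _ euv.
have [|nd] := boolP (del_edge e x y u v); first exact: fP'.
move: nd; rewrite /del_edge euv negbK => /orP[] /andP[/eqP-> /eqP->] //.
by rewrite eq_sym.
Qed.

End EdgeDeletion.

(** m refers to ordered pairs, twice the edges. It is only an upper bound and the graph only
    vertex-critical, since [critical_subrel] can delete edges afterwards. *)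
Definition crit_graph c n m := exists (T : finType) (e : rel T),
  [/\ simple e, #|T| = n, vcrit c e setT & arcs e setT setT <= m].

Lemma crit_graph_complete c : 0 < c -> crit_graph c c.+1 (c * c.+1).
Proof.
move=> c0; pose e (x y : 'I_c.+1) := x != y.
have irr : irreflexive e by move=> x; rewrite /e eqxx.
exists 'I_c.+1, e; split; rewrite ?card_ord //.
- by split=> // x y; rewrite /e eq_sym.
- apply/andP; split.
    apply/negP => /colourableP[f fP].
    have : injective f.
      by move=> x y; apply: contra_eq => xy; apply: fP.
    by move/leq_card; rewrite !card_ord ltnn.
  apply/forall_inP => v _; apply: contraT => /(ncolourable_card c0 irr).
  by have := cardsD1 v setT; rewrite inE cardsT card_ord add1n => -[<-]; rewrite ltnn.
- by have := arcs_le setT irr; rewrite cardsT card_ord mulnC.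
Qed.

Lemma colourable_extra c (T : finType) (e : rel T) v : simple e ->
  colourable c e (setT :\ v) -> colourable c.+1 e setT.
Proof.
move=> [sym irr] /colourableP[f fP]; apply/colourableP.
exists (fun x => if x == v then ord_max else widen_ord (leqnSn c) (f x)) => x y _ _ exy.
have lt z : widen_ord (leqnSn c) (f z) != ord_max.
  by rewrite -val_eqE /= neq_ltn ltn_ord.
have [xv|xv] := eqVneq x v; have [yv|yv] := eqVneq y v; rewrite ?lt //.
- by rewrite xv yv irr in exy.
- by rewrite eq_sym lt.
- by rewrite -val_eqE /= val_eqE fP // !inE ?xv ?yv.
Qed.

Lemma crit_graph_nonempty c (T : finType) (e : rel T) : 0 < c -> vcrit c e setT ->
  exists v : T, true.
Proof.
by move=> c0 /(vcrit_neq0 c0) /set0Pn[v _]; exists v.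
Qed.

Lemma sum_option (T : finType) (F : option T -> nat) :
  \sum_(x in [set: option T]) F x = F None + \sum_(x in [set: T]) F (Some x).
Proof.
rewrite (bigD1 None) ?inE //=; congr (_ + _).
rewrite (reindex_omap Some id) /=; last by move=> [z|]; rewrite ?inE ?andbF.
by apply: eq_bigl => x; rewrite !inE eqxx.
Qed.

Lemma crit_graph_join c n m : 0 < c -> crit_graph c n m -> crit_graph c.+1 n.+1 (m + 2 * n).
Proof.
move=> c0 [T [e [[sym irr] Tn crit le]]].
pose e' (x y : option T) := match x, y with
  | Some x, Some y => e x y | None, None => false | _, _ => true end.
exists (option T), e'; split.
- by split=> [[x|] [y|]|[x|]] //=.
- by rewrite card_option Tn.
- have [v0 _] := crit_graph_nonempty c0 crit.
  have colv v : colourable c e (setT :\ v).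
    by case/andP: crit => _ /forall_inP; apply; rewrite inE.
  apply/andP; split.
    apply: contra (vcrit_ncolourable crit) => /colourableP[f fP]; apply/colourableP.
    have fN x : f None != f (Some x) by apply: fP; rewrite ?inE.
    pose g x := odflt (Ordinal c0) (unlift (f None) (f (Some x))).
    have gE x : lift (f None) (g x) = f (Some x).
      by rewrite /g; case: (unlift_some (fN x)) => j -> /= ->.
    exists g => x y _ _ exy; apply: contraTneq (fP (Some x) (Some y) _ _ exy) => [gxy||].
    - by rewrite -!gE gxy eqxx.
    - by rewrite inE.
    - by rewrite inE.
  apply/forall_inP => -[v|] _.
    have /colourableP[f fP] := colv v; apply/colourableP.
    exists (fun x => if x is Some x then widen_ord (leqnSn c) (f x) else ord_max).
    have lt z : widen_ord (leqnSn c) (f z) != ord_max.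
      by rewrite -val_eqE /= neq_ltn ltn_ord.
    move=> [x|] [y|] //= xv yv exy; last by rewrite eq_sym lt.
    by rewrite -val_eqE /= val_eqE fP //; move: xv yv; rewrite !inE.
  have /colourableP[f fP] := colourable_extra (conj sym irr) (colv v0).
  apply/colourableP; exists (fun x => if x is Some x then f x else ord_max).
  by move=> [x|] [y|]; rewrite !inE // => _ _ exy; apply: fP; rewrite ?inE.
- rewrite /arcs sum_option (sum_option (fun y => e' None y : nat)) /= add0n.
  have -> : \sum_(x in [set: T]) 1 = n by rewrite sum1_card cardsT.
  under eq_bigr => x _ do rewrite (sum_option (fun y => e' (Some x) y : nat)) /=.
  rewrite big_split /= sum1_card cardsT Tn; move: le; rewrite /arcs.
  by move: (\sum_(x in setT) _) => a; lia.
Qed.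

Lemma crit_graph_joins c n m i : 0 < c -> crit_graph c n m ->
  crit_graph (c + i) (n + i) (m + 2 * i * n + i * (i - 1)).
Proof.
move=> c0 cnm; elim: i => [|i IHi]; first by rewrite muln0 !mul0n !addn0.
rewrite !addnS; have := crit_graph_join (ltn_addr i c0) IHi.
suff -> : m + 2 * i * n + i * (i - 1) + 2 * (n + i) = m + 2 * i.+1 * n + i.+1 * (i.+1 - 1) by [].
by case: i {IHi} => [|i]; rewrite ?subn1 /=; nia.
Qed.

Section Hajos.

Variables (c : nat) (T : finType) (e : rel T) (x y : T).
Hypotheses (c1 : 1 < c) (simple_e : simple e) (crit_e : critical_rel c e) (exy : e x y).

Let z0 : 'I_c := Ordinal (ltnW c1).

Let cross (u : T) (i : 'I_c) := (u == x) && (i != z0) || (u == y) && (i == z0).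

Let crossE u i : cross u i = (u == if i == z0 then y else x).
Proof.
by rewrite /cross; case: (eqVneq i z0) => _ /=; rewrite ?andbF ?andbT ?orbF.
Qed.

(* The Hajos sum of [e] with K_(c+1) along the edge [x y]: the edge [x y] is deleted, [x] is
   also a vertex of K_(c+1), and [y] takes over the neighbour [z0] of [x] there. *)
Definition hajos : rel (T + 'I_c) := fun a b =>
  match a, b with
  | inl u, inl v => del_edge e x y u v
  | inr i, inr j => i != j
  | inl u, inr i => cross u i
  | inr i, inl u => cross u i
  end.

Lemma simple_hajos : simple hajos.
Proof.
have [symd irrd] := simple_del_edge x y simple_e.
by split=> [[u|i] [v|j]|[u|i]] //=; rewrite ?symd ?irrd ?eqxx // eq_sym.
Qed.

Let nxy : x != y.
Proof. by apply: contraTneq exy => ->; rewrite simple_e.2. Qed.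

(** A colouring must give x and y the same colour, or the edge between them could be restored. The
    clique on [inr] uses all c colours, and its vertex with that colour is adjacent to x or y. *)
Lemma vcrit_hajos : vcrit c hajos setT.
Proof.
have [sym irr] := simple_e; have [ncol colv _] := crit_e.
apply/andP; split.
  apply: contra ncol => /colourableP[f fP]; have {}fP a b : hajos a b -> f a != f b.
    by move=> hab; apply: fP; rewrite ?inE.
  apply/colourableP; exists (f \o inl) => u v _ _ euv /=.
  have [fxy|fxy] := eqVneq (f (inl x)) (f (inl y)); last first.
    have [nd|] := boolP (del_edge e x y u v); first exact: fP.
    rewrite /del_edge euv negbK => /orP[] /andP[/eqP-> /eqP->] //.
    by rewrite eq_sym.
  have finj : injective (f \o inr).
    by move=> i j; apply: contra_eq => /= nij; apply: fP.
  have /codomP[i fi] : f (inl x) \in codom (f \o inr).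
    by apply: (inj_card_onto finj); rewrite card_ord.
  have cr : cross (if i == z0 then y else x) i.
    by rewrite crossE.
  have := fP (inl (if i == z0 then y else x)) (inr i) cr.
  have -> : f (inl (if i == z0 then y else x)) = f (inr i) by case: ifP; rewrite -?fxy fi.
  by rewrite eqxx.
apply/forall_inP => -[v|i] _; apply/colourableP; last first.
  (* The transposition assigns the common colour of x and y to the deleted clique vertex i. *)
  have [f fxy fP] := critical_edge_colouring sym crit_e exy.
  exists (fun a => match a with inl u => f u | inr j => tperm i (f x) j end).
  have key u j : j != i -> cross u j -> f u != tperm i (f x) j.
    move=> ji cr; have -> : f u = f x by case/orP: cr => /andP[/eqP-> _].
    by rewrite -{1}(tpermL i (f x)) (inj_eq perm_inj) eq_sym.
  move=> [u|j] [v|j']; rewrite !inE ?andbT //=.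
  - by move=> _ _; apply: fP.
  - by move=> _ ji; apply: key.
  - by move=> ji _ cr; rewrite eq_sym; apply: key.
  - by move=> _ _; rewrite (inj_eq perm_inj).
have /colourableP[f fP] := colv v.
(* a is the colour of z0: equal to that of x, which keeps it off the clique vertices adjacent to x,
   and different from that of y, the neighbour of z0. *)
have [a [ay ax]] : exists a : 'I_c, (y != v -> a != f y) /\ (x != v -> a = f x).
  have [xv|xv] := eqVneq x v.
    have [a] := avoid_color (P := [set f y]) (leq_ltn_trans (eq_leq (cards1 _)) c1).
    by rewrite inE => ?; exists a.
  exists (f x); split=> // yv; apply: fP; rewrite // !inE ?xv ?yv //.
exists (fun b => match b with inl u => f u | inr j => tperm z0 a j end).
have key u j : u != v -> cross u j -> f u != tperm z0 a j.
  move=> uv /orP[] /andP[/eqP ue jz].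
    by rewrite ue -ax -?ue // -{1}(tpermL z0 a) (inj_eq perm_inj) eq_sym.
  by rewrite (eqP jz) tpermL eq_sym ue ay // -ue.
move=> [u|j] [w|j']; rewrite !inE ?andbT //=.
- by move=> uv wv /andP[euw _]; apply: fP; rewrite // !inE ?uv ?wv.
- by move=> uv _; apply: key.
- by move=> _ uv cr; rewrite eq_sym; apply: key.
- by move=> _ _; rewrite (inj_eq perm_inj).
Qed.

Lemma sum_sumT (F : T + 'I_c -> nat) :
  \sum_(a in [set: T + 'I_c]) F a =
  \sum_(u in [set: T]) F (inl u) + \sum_(i in [set: 'I_c]) F (inr i).
Proof.
rewrite (eq_bigl xpredT) => [|a]; last by rewrite inE.
rewrite big_sumType /=; congr (_ + _); apply: eq_bigl => a; by rewrite inE.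
Qed.

Lemma arcs_hajos : arcs hajos setT setT + 2 = arcs e setT setT + c * c.+1.
Proof.
have sum_cross i : \sum_(u in [set: T]) (cross u i : nat) = 1.
  rewrite (bigD1 (if i == z0 then y else x)) ?inE //= crossE eqxx big1 ?addn0 //.
  by move=> u /andP[_ /negPf nu]; rewrite crossE nu.
have crossT : \sum_(i in [set: 'I_c]) \sum_(u in [set: T]) (cross u i : nat) = c.
  by rewrite (eq_bigr (fun=> 1)) // sum1_card cardsT card_ord.
have complete : \sum_(i in [set: 'I_c]) \sum_(j in [set: 'I_c]) (i != j : nat) = c * c.-1.
  have := @arcs_clique _ (fun i j : 'I_c => i != j) setT.
  rewrite cardsT card_ord; apply; first by move=> i; rewrite eqxx.
  by apply/cliqueP.
rewrite (arcs_del_edge simple_e exy) [LHS]addn2 /arcs sum_sumT /=; congr _.+2.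
under eq_bigr => u _ do rewrite (sum_sumT (fun b => hajos (inl u) b : nat)) /=.
rewrite big_split /= [X in _ + X + _]exchange_big /= crossT.
under [X in _ + X = _]eq_bigr => i _ do rewrite (sum_sumT (fun b => hajos (inr i) b : nat)) /=.
rewrite big_split /= crossT complete -!addnA; congr (_ + _).
by case: c c1 => // c' _ /=; lia.
Qed.

End Hajos.

Lemma crit_graph_hajos c n m : 1 < c -> crit_graph c n m ->
  crit_graph c (n + c) (m + c * c.+1 - 2).
Proof.
move=> c1 [T [e [simple_e Tn crit le]]].
have [e' [simple_e' crit' le']] := critical_subrel simple_e crit.
have [x [y exy]] : exists x y, e' x y.
  have [/existsP[x /existsP[y exy]]|none] := boolP [exists x, exists y, e' x y].
    by exists x, y.
  case: crit' => /negP[]; apply/colourableP; exists (fun=> Ordinal (ltnW c1)) => x y _ _ exy.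
  by move/existsPn/(_ x): none => /existsPn/(_ y); rewrite exy.
exists (T + 'I_c)%type, (hajos e' x y c1); split.
- exact: simple_hajos.
- by rewrite card_sum Tn card_ord.
- exact: vcrit_hajos.
- have := arcs_hajos c1 simple_e' exy; move: (leq_trans le' le).
  by move: (arcs _ _ _) (arcs _ _ _) => a1 a2; lia.
Qed.

(** * Translation between relations and [sgraph] *)

Section Sgraph.

Variable T : finType.
Implicit Types (G H : sgraph T) (x y u v a b : T).

Definition adj G : rel T := fun x y => [set x; y] \in edges G.

Lemma edgesP G E : E \in edges G -> #|E| = 2 /\ E \subset vertices G.
Proof.
case: G => -[V F] /= h EF; have := h; move/forall_inP/(_ E EF).
by case/andP => /eqP.
Qed.

Lemma simple_adj G : simple (adj G).
Proof.
split=> [x y|x]; rewrite /adj; first by rewrite setUC.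
by apply/negbTE/negP => /edgesP[]; rewrite cards2 eqxx.
Qed.

Lemma arcs_adj G : arcs (adj G) setT setT = 2 * #|edges G|.
Proof.
rewrite arcs_card -sum1_card.
rewrite (partition_big (fun p : T * T => [set p.1; p.2]) (mem (edges G))) /=; last first.
  by move=> p; rewrite !inE.
rewrite mulnC -sum_nat_const; apply: eq_bigr => E EG.
have [/eqP/cards2P[a [b [nab Eab]]] _] := edgesP EG.
rewrite -[RHS](_ : #|[set (a, b); (b, a)]| = 2); last first.
  by rewrite cards2 xpair_eqE negb_and nab.
rewrite -sum1_card; apply: eq_bigl => -[u v]; rewrite !inE /adj !xpair_eqE /=.
apply/andP/idP => [[_ /eqP E1]|]; last first.
  by case/orP=> /andP[/eqP-> /eqP->]; rewrite ?[[set b; a]]setUC -Eab.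
have uv : u != v.
  have [+ _] := edgesP EG; rewrite -E1 cards2; by case: (u != v).
have := set21 u v; have := set22 u v; rewrite E1 Eab !inE.
by case/orP=> /eqP vE; case/orP=> /eqP uE; rewrite uE vE ?eqxx ?orbT // uE vE eqxx in uv *.
Qed.

Lemma colorableE c G : 0 < c -> colorable c G = colourable c (adj G) (vertices G).
Proof.
move=> c0; apply/existsP/colourableP => [[f /forallP fP]|[f fP]].
  exists (fun x => if insub x is Some u then f u else Ordinal c0) => x y xV yV exy.
  by rewrite !insubT; have /forallP/(_ (Sub y yV))/implyP := fP (Sub x xV); apply.
exists [ffun u : {x : T | x \in vertices G} => f (val u)].
apply/forallP => x; apply/forallP => y; apply/implyP => exy.
by rewrite !ffunE fP // ?(valP x) ?(valP y).
Qed.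

Lemma vcrit_of_critical c G : 0 < c -> critical c.+1 G -> vertices G = setT ->
  vcrit c (adj G) setT.
Proof.
move=> c0 /andP[ncol /forallP crit] VG; rewrite /= colorableE // VG in ncol.
rewrite /vcrit ncol; apply/forall_inP => v _.
pose F := [set E in edges G | v \notin E].
have FP : [forall E in ((setT :\ v, F) : {set T} * {set {set T}}).2,
    (#|E| == 2) && (E \subset ((setT :\ v, F) : {set T} * {set {set T}}).1)].
  apply/forall_inP => E /=; rewrite inE => /andP[EG vE].
  by have [-> _] := edgesP EG; rewrite eqxx subsetD1 subsetT.
pose H : sgraph T := SGraph FP.
have properH : proper_subgraph H G.
  apply/andP; split.
    apply/andP; split; first by rewrite VG subsetT.
    by apply/subsetP => E; rewrite inE => /andP[].
  apply: contraTneq isT => HG; have := congr1 (@vertices T) HG.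
  by rewrite VG => /setP/(_ v); rewrite /vertices /= !inE eqxx.
have /implyP/(_ properH) := crit H; rewrite /= colorableE //.
apply: sub_colourable => // x y; rewrite !inE => /andP[xv _] /andP[yv _] exy.
have exy' : [set x; y] \in edges G := exy.
by rewrite /adj /edges /= inE exy' !inE negb_or eq_sym xv eq_sym yv.
Qed.

Lemma critical_of_rel c (e : rel T) : 0 < c -> simple e -> critical_rel c e ->
  exists G, [/\ vertices G = setT, critical c.+1 G & 2 * #|edges G| = arcs e setT setT].
Proof.
move=> c0 [sym irr] [ncol colv cole].
pose F := [set [set p.1; p.2] | p in [set p : T * T | e p.1 p.2]].
have FP : [forall E in ((setT, F) : {set T} * {set {set T}}).2,
    (#|E| == 2) && (E \subset ((setT, F) : {set T} * {set {set T}}).1)].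
  apply/forall_inP => E /= /imsetP[[x y]]; rewrite inE /= => exy ->.
  have nxy : x != y by apply: contraTneq exy => ->; rewrite irr.
  by rewrite subsetT andbT cards2 nxy.
pose G : sgraph T := SGraph FP; have VG : vertices G = setT by [].
have adjE : adj G =2 e.
  move=> x y; apply/imsetP/idP => [[[u v]]|exy]; last by exists (x, y); rewrite ?inE.
  rewrite inE /= => euv E1.
  have uv : u != v by apply: contraTneq euv => ->; rewrite irr.
  have xy : x != y.
    by have := congr1 (fun A : {set T} => #|A|) E1; rewrite /= !cards2 uv; case: (x != y).
  have := set21 x y; have := set22 x y; rewrite E1 !inE.
  case/orP=> /eqP yE; case/orP=> /eqP xE; move: xy; rewrite xE yE ?eqxx // => _.
  by rewrite sym.
exists G; split=> //; last by rewrite -arcs_adj; apply: eq_arcs => x y _ _.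
apply/andP; split.
  rewrite /= colorableE // VG; apply: contra ncol.
  by apply: sub_colourable => // x y _ _; rewrite adjE.
apply/forallP => H; apply/implyP => /andP[/andP[sV sE] nHG]; rewrite /= colorableE //.
have adjH x y : adj H x y -> e x y by rewrite -adjE; apply: (subsetP sE).
have [VH|[v vH]] : vertices H = setT \/ exists v, v \notin vertices H.
  have [|/subsetPn[v _ vH]] := boolP (setT \subset vertices H); last by right; exists v.
  by rewrite subTset => /eqP; left.
  have [E EG EH] : exists2 E, E \in edges G & E \notin edges H.
    apply/subsetPn; apply: contraNN nHG => sE'; apply/eqP/val_inj.
    have eE : edges H = edges G by apply/eqP; rewrite eqEsubset sE.
    by apply: injective_projections; [exact: VH|exact: eE].
  have /imsetP[[x y]] := EG; rewrite inE /= => exy Exy.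
  apply: sub_colourable (cole x y exy); first exact: subsetT.
  move=> u w _ _ uw; rewrite /del_edge adjH //=; apply: contra EH => uwE.
  suff -> : E = [set u; w] by [].
  by case/orP: uwE => /andP[/eqP-> /eqP->]; rewrite // setUC.
apply: sub_colourable (colv v); first by rewrite subsetD1 subsetT.
by move=> u w _ _; apply: adjH.
Qed.

End Sgraph.

Lemma crit_graph_ord c n m : crit_graph c n m ->
  exists e : rel 'I_n, [/\ simple e, critical_rel c e & arcs e setT setT <= m].
Proof.
case=> T [e [simple_e Tn crit le]].
have [e' [[sym irr] [ncol colv cole] le']] := critical_subrel simple_e crit; subst n.
pose e2 (i j : 'I_#|T|) := e' (enum_val i) (enum_val j).
have e2E x y : e2 (enum_rank x) (enum_rank y) = e' x y by rewrite /e2 !enum_rankK.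
exists e2; split.
- by split=> [i j|i]; rewrite /e2.
- split.
  + apply: contra ncol => /colourableP[f fP]; apply/colourableP.
    exists (f \o enum_rank) => x y _ _ exy; apply: fP; rewrite ?inE //.
    by rewrite e2E.
  + move=> v; have /colourableP[f fP] := colv (enum_val v); apply/colourableP.
    exists (f \o enum_val) => i j; rewrite !inE !andbT => iv jv eij.
    by apply: fP; rewrite // !inE (inj_eq enum_val_inj) ?iv ?jv.
  + move=> x y exy; have /colourableP[f fP] := cole _ _ exy; apply/colourableP.
    exists (f \o enum_val) => i j _ _ dij; apply: fP; rewrite ?inE //.
    by move: dij; rewrite /del_edge /= !(inj_eq enum_val_inj).
- apply: leq_trans le; apply: leq_trans le'; rewrite /arcs.
  rewrite [leqRHS](reindex_onto enum_val enum_rank) => [|x _]; last exact: enum_rankK.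
  rewrite (eq_bigl xpredT) => [|i]; last by rewrite inE.
  rewrite [leqRHS](eq_bigl xpredT) => [|i]; last by rewrite inE enum_valK eqxx.
  apply: leq_sum => i _.
  rewrite [leqRHS](reindex_onto enum_val enum_rank) => [|x _]; last exact: enum_rankK.
  rewrite (eq_bigl xpredT) => [|j]; last by rewrite inE.
  by rewrite [leqRHS](eq_bigl xpredT) => [|j]; last by rewrite inE enum_valK eqxx.
Qed.

Lemma crit_graph_sgraph c n m : 0 < c -> crit_graph c n m ->
  exists G : sgraph 'I_n, [/\ #|vertices G| = n, critical c.+1 G & 2 * #|edges G| <= m].
Proof.
move=> c0 /crit_graph_ord[e [simple_e crit le]].
have [G [VG critG eG]] := critical_of_rel c0 simple_e crit.
by exists G; rewrite VG cardsT card_ord eG.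
Qed.

Lemma min_edges_upper c n m : 0 < c -> crit_graph c n m -> 2 * min_edges c.+1 n <= m.
Proof.
move=> c0 /(crit_graph_sgraph c0)[G [Gn critG le]].
by apply: leq_trans le; rewrite leq_mul2l min_edges_le.
Qed.

(** Any example on n vertices guarantees that [min_edges] is attained and not a default value. *)
Lemma crit_graph_min_edges c n m : 0 < c -> crit_graph c n m ->
  crit_graph c n (2 * min_edges c.+1 n).
Proof.
move=> c0 /(crit_graph_sgraph c0)[G0 [G0n critG0 _]].
have [G [Gn critG <-]] := min_edges_attained (ex_intro2 _ _ G0 G0n critG0).
have VG : vertices G = setT by apply/eqP; rewrite eqEcard subsetT cardsT card_ord Gn /=.
exists 'I_n, (adj G); split; rewrite ?card_ord ?arcs_adj //; first exact: simple_adj.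
exact: vcrit_of_critical.
Qed.

(** * Bounds on [min_edges] and first values of the residue classes *)

Lemma crit_graph_lower c n m : 2 < c -> crit_graph c n m ->
  (c * c + c) * n <= c * m + 2 * n + (c * c - c - 2).
Proof.
move=> c3 [T [e [simple_e Tn crit le]]].
have := pot_vcrit c3 simple_e crit; rewrite /pot /potmax cardsT Tn => pot_le.
have : (c%:Z * (arcs e setT setT)%:Z <= c%:Z * m%:Z)%R by apply: ler_wpM2l.
move: pot_le; move: (arcs e _ _) => a; clear -c3 => pot_le le.
have cc : c + 2 <= c * c by nia.
by lia.
Qed.

Lemma crit_graph_step c n m : 1 < c -> crit_graph c n m ->
  2 * min_edges c.+1 (n + c) <= 2 * min_edges c.+1 n + c * c.+1 - 2.
Proof.
move=> c1 cg; have c0 := ltnW c1.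
exact: min_edges_upper (crit_graph_hajos c1 (crit_graph_min_edges c0 cg)).
Qed.

(** The Hajos sum of two copies of K_(p+1) has 2 * p + 1 vertices, and joining K_(c-p) raises the
    number of colours from p to c. With k = c + 1 the range of p gives n = k + p from k + 2 to 2k -
    1. *)
Lemma crit_graph_small c p : 1 < p -> p <= c ->
  crit_graph c (c + 1 + p) (c * (c + 1 + p) + p * (c + 1 - p) - 2).
Proof.
move=> p1 pc; have p0 := ltnW p1.
have := crit_graph_joins (c - p) p0 (crit_graph_hajos p1 (crit_graph_complete p0)).
have -> : p + (c - p) = c by rewrite subnKC.
have [i ->] : exists i, c = p + i by exists (c - p); lia.
have -> : p + i - p = i by lia.
have -> : p.+1 + p + i = p + i + 1 + p by lia.
have -> : p + i + 1 - p = i + 1 by lia.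
suff -> : p * p.+1 + p * p.+1 - 2 + 2 * i * (p.+1 + p) + i * (i - 1) =
          (p + i) * (p + i + 1 + p) + p * (i + 1) - 2 by [].
have h : 2 <= p * p.+1 by nia.
by case: i => [|i]; rewrite ?subn1 /=; nia.
Qed.

(** Two triangles have Hajos sum C_5. Joined with K_(c-3) it is critical for c - 1 colours; a Hajos
    sum with K_c then gives 2 * c + 1 vertices, and one joined vertex leads to c colours and n =
    2k. *)
Lemma crit_graph_double c : 2 < c ->
  crit_graph c (2 * c + 2) (2 * c * c + 6 * c - 8).
Proof.
move=> c3; have [i ci] : exists i, c = i + 3 by exists (c - 3); lia.
have g1 := crit_graph_joins i (isT : 0 < 2)
  (crit_graph_hajos (isT : 1 < 2) (crit_graph_complete (isT : 0 < 2))).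
have c2 : 1 < 2 + i by lia.
have := crit_graph_join (ltnW c2) (crit_graph_hajos c2 g1).
have -> : (3 + 2 + i + (2 + i)).+1 = 2 * c + 2 by lia.
suff -> : 2 * 3 + 2 * 3 - 2 + 2 * i * (3 + 2) + i * (i - 1) + (2 + i) * (2 + i).+1 - 2 +
   2 * (3 + 2 + i + (2 + i)) = 2 * c * c + 6 * c - 8.
  by have -> : (2 + i).+1 = c by lia.
by rewrite ci; case: i {ci g1 c2} => [|i]; rewrite ?subn1 /=; nia.
Qed.

(** Every strict decrease is by at least 1 and uses up b of the budget b * h 0 - L, on which the
    induction runs. Whether the sequence still decreases is decided classically. *)
Lemma eventually_constant (h : nat -> int) (b L : int) : (0 < b)%R ->
  (forall j, (h j.+1 <= h j)%R) -> (forall j, (L <= b * h j)%R) ->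
  exists s : seq nat, (b * (size s)%:Z <= b * h 0%N - L)%R /\
    (forall j, j \notin s -> h j.+1 = h j).
Proof.
move=> b0; have [n] := ubnP `|(b * h 0%N - L)%R|%N.
elim: n => // n IHn in h *; rewrite ltnS => le hmono hL.
have [const|nconst] := classic (forall j, h j.+1 = h j).
  by exists [::]; split=> //=; have := hL 0%N; lia.
have drop : exists j, h j.+1 != h j.
  apply: NNPP => none; apply: nconst => j; apply/eqP; apply: contraT => hj.
  by case: none; exists j.
case: (ex_minnP drop) => j hj minj.
have before i : i <= j -> h i = h 0%N.
  elim: i => // i IHi ij; rewrite -IHi 1?ltnW //; apply/eqP.
  by apply: contraTT ij => /minj; rewrite -leqNgt.
have ltj : (h j.+1 <= h 0%N - 1)%R.
  by have := hmono j; rewrite -(before j) //; move: hj; lia.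
have step : (b * h j.+1 <= b * h 0%N - b)%R.
  have : (b * h j.+1 <= b * (h 0%N - 1))%R by apply: ler_wpM2l; lia.
  lia.
have [|i|i|s [size_s hs]] := IHn (fun i => h (j.+1 + i)).
- by rewrite addn0; have := hL j.+1; have := hL 0%N; lia.
- by rewrite addnS.
- by [].
exists (j :: [seq j.+1 + i | i <- s]); rewrite addn0 in size_s; split.
  by rewrite /= size_map -addn1 PoszD; lia.
move=> i; rewrite inE negb_or => /andP[ij inot].
have [ltij|ltji] := ltnP i j; first by rewrite !before // ltnW.
have lt : j < i by rewrite ltn_neqAle eq_sym ij.
rewrite -(subnKC lt) -addnS; apply: hs; apply: contraNN inot => is'.
by apply/mapP; exists (i - j.+1); rewrite ?subnKC.
Qed.

(* For n = c + 3 + r the graph of [crit_graph_small] exceeds the Kostochka-Yancey bound on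
   2 * c * |E| by exactly this amount. *)
Definition class_defect (c r : nat) : int :=
  (c%:Z * ((r%:Z + 2) * (c%:Z - r%:Z - 2)) - 2 * c%:Z + 2 * (r%:Z + 2))%R.

Lemma sum_class_defect c m :
  (6 * \sum_(r < m) class_defect c r =
   c%:Z * (3 * c%:Z * m%:Z * (m%:Z + 3)
           - (m%:Z + 1) * (m%:Z + 2) * (2 * m%:Z + 3) + 6)
   - 12 * c%:Z * m%:Z + 6 * m%:Z * (m%:Z + 3))%R.
Proof.
elim: m => [|m IHm]; first by rewrite big_ord0; ring.
have mE : Posz m.+1 = (m%:Z + 1)%R by lia.
by rewrite big_ord_recr /= mulrDr IHm /class_defect mE; ring.
Qed.

(** * Residue classes *)

Section Counting.

Variable c : nat.
Hypothesis c3 : 2 < c.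

Local Notation f := (min_edges c.+1).

Let c0 : 0 < c. Proof. exact: leq_trans c3. Qed.
Let c1 : 1 < c. Proof. exact: ltnW. Qed.

Let first_bound r := if r.+2 <= c then c * (c + 3 + r) + r.+2 * (c + 1 - r.+2) - 2
                     else 2 * c * c + 6 * c - 8.

Lemma crit_graph_first r : r < c -> crit_graph c (c + 3 + r) (first_bound r).
Proof.
rewrite /first_bound; case: ifP => [pc _|pc rc].
  have := @crit_graph_small c r.+2 isT pc.
  by have -> : c + 1 + r.+2 = c + 3 + r by lia.
have := crit_graph_double c3.
by have -> : 2 * c + 2 = c + 3 + r by lia.
Qed.

Lemma crit_graph_class r j : r < c ->
  crit_graph c (c + 3 + r + j * c) (2 * f (c + 3 + r + j * c)).
Proof.
move=> rc; apply: (crit_graph_min_edges c0 (m := first_bound r + j * (c * c.+1 - 2))).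
elim: j => [|j IHj]; first by rewrite !mul0n !addn0; apply: crit_graph_first.
rewrite !mulSn [c + j * c]addnC addnA [_ - 2 + _]addnC addnA.
have := crit_graph_hajos c1 IHj; rewrite addnBA //.
by apply: leq_trans (_ : 2 * 1 <= _) => //; apply: leq_mul.
Qed.

(** The budget is the excess of the first graph of the class over the Kostochka-Yancey bound. The
    other value, 3 * c^2 - 7 * c + 2, is this excess for [crit_graph_double], which starts the class
    r = c - 1. *)
Lemma class_exceptions (r : 'I_c) : exists s : seq nat,
  (2 * c%:Z * (size s)%:Z <= (if (r.+2 <= c)%N then class_defect c r
                              else 3 * c%:Z * c%:Z - 7 * c%:Z + 2))%R /\
  (forall j, j \notin s ->
     2 * f (c + 3 + r + j * c + c) = 2 * f (c + 3 + r + j * c) + (c * c.+1 - 2)).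
Proof.
have rc := ltn_ord r; have [s0 s0E] : exists s0, c * c.+1 = 2 * s0 + 2.
  have := odd_double_half (c * c.+1); rewrite oddM oddS andbN add0n => cE.
  exists ((c * c.+1)./2 - 1); have : 2 <= c * c.+1 by nia.
  by move: cE; rewrite -mul2n; move: (_./2) => a; lia.
(* A Hajos sum with K_(c+1) adds s0 edges, so h does not increase. The Kostochka-Yancey bound grows
   at the same rate, so 2 * c * h j is at least L for every j. *)
pose h j : int := ((f (c + 3 + r + j * c))%:Z - j%:Z * s0%:Z)%R.
pose L : int := ((c%:Z * c%:Z + c%:Z - 2) * (c%:Z + 3 + r%:Z) - (c%:Z * c%:Z - c%:Z - 2))%R.
have cc : (c%:Z * c%:Z + c%:Z = 2 * s0%:Z + 2)%R by move: s0E; clear; lia.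
have nE j : c + 3 + r + j.+1 * c = c + 3 + r + j * c + c by rewrite mulSn addnCA addnC.
have [||j|s [size_s hs]] := @eventually_constant h (2 * c%:Z)%R L.
- by move: c0; clear; lia.
- move=> j; have := crit_graph_step c1 (crit_graph_class j rc).
  rewrite /h nE s0E; move: (f _) (f _) => a b; clear; lia.
- have := crit_graph_lower c3 (crit_graph_class j rc); rewrite /h /L.
  move: (f (c + 3 + r + j * c)) (nat_of_ord r) c3 s0E => a r'; clear => c3 s0E le.
  have : c + 2 <= c * c by nia.
  by move: le s0E; nia.
exists s; split.
  apply: le_trans size_s _; have := min_edges_upper c0 (crit_graph_first rc).
  rewrite /h mul0n addn0 /first_bound /class_defect /L.
  move: (f _) rc; move: (val r) c3; clear=> r c3 a rc.
  case: ifP => pc.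
    have [i ci] : exists i, c = r + 2 + i by exists (c - r - 2); lia.
    have -> : c + 1 - r.+2 = i + 1 by lia.
    by rewrite ci; clear; nia.
  have -> : r = c - 1 by lia.
  by nia.
move=> j /hs; rewrite /h nE s0E; move: (f _) (f _) => a b; clear; lia.
Qed.

End Counting.

Lemma main_count (c : nat) : 2 < c -> exists s : seq nat,
  24 * size s + 3 * c.+1 ^ 2 <= 2 * c.+1 ^ 3 /\
  forall n, c + 3 <= n -> n \notin s ->
    2 * min_edges c.+1 (n + c) = 2 * min_edges c.+1 n + (c * c.+1 - 2).
Proof.
move=> c3; have [S SP] := fin_all_exists (class_exceptions c3).
exists (flatten [seq [seq c + 3 + r + j * c | j <- S r] | r : 'I_c <- enum 'I_c]).
split.
  have -> : size (flatten [seq [seq c + 3 + r + j * c | j <- S r] | r : 'I_c <- enum 'I_c])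
            = \sum_(r < c) size (S r).
    rewrite size_flatten /shape -map_comp sumnE big_map big_enum /=.
    by apply: eq_bigr => r _; rewrite size_map.
  case: c c3 S SP => // m m3 S SP.
  have le : (2 * m.+1%:Z * (\sum_(r < m.+1) size (S r))%:Z <=
     \sum_(r < m) class_defect m.+1 r + (3 * m.+1%:Z * m.+1%:Z - 7 * m.+1%:Z + 2))%R.
    rewrite big_ord_recr /= PoszD mulrDr; apply: lerD.
      rewrite (big_morph Posz PoszD (erefl _)) mulr_sumr; apply: ler_sum => r _.
      by have [+ _] := SP (widen_ord (leqnSn m) r); rewrite /= ltnS ltn_ord.
    by have [+ _] := SP ord_max; rewrite /= ltnn.
  have := sum_class_defect m.+1 m; move: le.
  move: (\sum_(r < m) _)%R (\sum_(r < m.+1) _) m3 => a z; clear=> m3 le aE.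
  have le2 : (12 * m.+1%:Z * z%:Z <=
      m.+1%:Z * (m.+1%:Z * (m.+1%:Z * m.+1%:Z - 1) + 6 * m.+1%:Z - 18))%R.
    have mE : Posz m.+1 = (m%:Z + 1)%R by lia.
    by move: le aE; rewrite mE; clear; lia.
  have {}le2 : (12 * z%:Z <= m.+1%:Z * (m.+1%:Z * m.+1%:Z - 1) + 6 * m.+1%:Z - 18)%R.
    rewrite -(ler_pM2l (x := m.+1%:Z)) //; move: le2; lia.
  (* With c for [m.+1], the count is at most (c^3 + 5 * c - 18) / 12. For k = c + 1 the claimed
     k^3/12 - k^2/8 equals (2 * c^3 + 3 * c^2 - 1) / 24, which is larger. *)
  by move: le2; rewrite !expnS expn0; nia.
move=> n cn nS; have c0 : 0 < c by apply: leq_trans c3.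
have r_lt : (n - (c + 3)) %% c < c by rewrite ltn_pmod.
have [_ /(_ ((n - (c + 3)) %/ c))] := SP (Ordinal r_lt).
have nE : c + 3 + (n - (c + 3)) %% c + (n - (c + 3)) %/ c * c = n.
  by rewrite -addnA [_ %% _ + _]addnC -divn_eq subnKC.
rewrite /= nE; apply; apply: contraNN nS => js.
apply/flatten_mapP; exists (Ordinal r_lt); rewrite ?mem_enum //.
by apply/mapP; exists ((n - (c + 3)) %/ c); rewrite ?nE.
Qed.

Local Open Scope ring_scope.

Theorem corollary7 (k : nat) (hk : (4 <= k)%N) :
  exists s : seq nat,
    (size s)%:R <= k%:R ^+ 3 / 12 - k%:R ^+ 2 / 8 :> rat /\
    forall n : nat, (k + 2 <= n)%N -> n \notin s ->
      (min_edges k (n + k - 1))%:R =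
        (min_edges k n)%:R + (k%:R - 1) / 2 * (k%:R - 2 / (k%:R - 1)) :> rat.
Proof.
case: k hk => // c hc; have [s [size_s sP]] := main_count hc; exists s; split.
  have : (24 * size s + 3 * c.+1 ^ 2)%:R <= (2 * c.+1 ^ 3)%:R :> rat by rewrite ler_nat.
  rewrite natrD (natrM _ 24) (natrM _ 3) (natrM _ 2) !natrX.
  move: (c.+1)%:R (size s)%:R => x y; lra.
move=> n; rewrite addSn -addnS => cn /(sP n cn).
rewrite addnS subn1 /= => /(congr1 (fun m : nat => m%:R : rat)).
have c0 : c%:R != 0 :> rat by rewrite pnatr_eq0; move: hc; clear; case: c.
rewrite natrD !natrM natrB ?natrM; last first.
  by move: hc; clear; nia.
rewrite -[c.+1]addn1 natrD addrK => fE.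
have -> : c%:R / 2 * (c%:R + 1 - 2 / c%:R) = (c%:R * (c%:R + 1) - 2) / 2 :> rat.
  by field.
move: fE; move: (min_edges _ _)%:R (min_edges _ _)%:R => a b fE; lra.
Qed.
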